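(* Let $2 \leq p < \infty$, and let $X$ be a $p$-convex, $p$-disjointly homogeneous Banach lattice. Then any subspace of $X$ contains a subspace which is complemented in $X$ and is isomorphic to either $\ell_p$ or $\ell_2$. Consequently, $X$ is subprojective.
   Context: All Banach spaces are assumed infinite dimensional, and subspaces are closed and infinite dimensional. A Banach space $X$ is subprojective if every subspace $Y \subset X$ contains a further subspace $Z \subset Y$ that is complemented in $X$. A Banach lattice $X$ is $p$-disjointly homogeneous if every disjoint normalized sequence in $X$ contains a subsequence equivalent to the standard basis of $\ell_p$. $p$-convexity is the usual Banach lattice notion: there is a constant $M$ with $\|(\sum_i|x_i|^p)^{1/p}\|\leq M(\sum_i\|x_i\|^p)^{1/p}$ for all finite families $(x_i)$ in $X$. *)

(* Defs.v *)
From HB Require Import structures.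
From mathcomp Require Import all_boot all_order all_algebra.
From mathcomp Require Import all_classical all_reals all_analysis.

Set Implicit Arguments.
Unset Strict Implicit.
Unset Printing Implicit Defensive.
Import Order.TTheory GRing.Theory Num.Theory.
Import numFieldNormedType.Exports.

Local Open Scope classical_set_scope.
Local Open Scope ring_scope.

(* The order is carried by the mixin rather than inherited from
   [Order.Lattice]: Hierarchy Builder cannot join [Order.Lattice] with
   [CompleteNormedModule] without redeclaring [Num.RealDomain]. *)
HB.mixin Record CompleteNormedModule_isBanachLattice (R : realType) X
    of CompleteNormedModule R X := {
  ble : rel X ;
  bmeet : X -> X -> X ;
  bjoin : X -> X -> X ;
  ble_refl : reflexive ble ;
  ble_anti : antisymmetric ble ;
  ble_trans : transitive ble ;
  ble_meet : forall x y z, ble x (bmeet y z) = ble x y && ble x z ;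
  ble_join : forall x y z, ble (bjoin x y) z = ble x z && ble y z ;
  ble_add2r : forall x y z, ble x y -> ble (x + z) (y + z) ;
  ble_scale : forall (a : R) x y, 0 <= a -> ble x y -> ble (a *: x) (a *: y) ;
  ble_norm : forall x y : X,
    ble (bjoin x (- x)) (bjoin y (- y)) -> `|x| <= `|y|
}.

#[short(type="banachLatticeType")]
HB.structure Definition BanachLattice (R : realType) :=
  {X of CompleteNormedModule R X & CompleteNormedModule_isBanachLattice R X}.

Section Subspaces.
Context {R : realType} {X : completeNormedModType R}.
Implicit Types Y Z : set X.

Definition infinite_dimensional Y : Prop :=
  ~ exists (n : nat) (e : 'I_n -> X), forall y, Y y ->
      exists c : 'I_n -> R, y = \sum_(i < n) c i *: e i.

Definition subspace_inf Y : Prop :=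
  [/\ submod_closed (mem Y), closed Y & infinite_dimensional Y].

Definition complemented Z : Prop :=
  exists P : {linear X -> X},
    [/\ continuous P, forall x, P (P x) = P x & range P = Z].

Definition lp_norm (p : R) (u : nat -> R) : R :=
  fine ('N[counting]_p%:E[EFin \o u])%E.

(* [LfunType counting p1] is the vector space of all p-summable real sequences:
   over the counting measure no quotient by null sets is needed. *)
Definition isomorphic_lp Z (p : R) : Prop :=
  exists (p1 : (1 <= p%:E)%E)
         (T : {linear LfunType (@counting nat R) p1 -> X}) (c C : R),
    [/\ 0 < c,
        forall u : LfunType (@counting nat R) p1,
          c * lp_norm p u <= `|T u| <= C * lp_norm p u
      & range T = Z].

Definition equivalent_lp_basis (p : R) (x : nat -> X) : Prop :=
  exists c C : R, 0 < c /\ forall (n : nat) (a : 'I_n -> R),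
    c * (\sum_(i < n) `|a i| `^ p) `^ p^-1 <= `|\sum_(i < n) a i *: x i|
      <= C * (\sum_(i < n) `|a i| `^ p) `^ p^-1.

End Subspaces.

Definition subprojective (R : realType) (X : completeNormedModType R) : Prop :=
  forall Y : set X, subspace_inf Y ->
    exists Z : set X, [/\ Z `<=` Y, subspace_inf Z & complemented Z].

Section BanachLatticeNotions.
Context {R : realType} (X : banachLatticeType R).

(* [`|x|] is the norm of x, [modulus x] its lattice absolute value. *)
Definition modulus (x : X) : X := bjoin x (- x).

Definition lattice_disjoint (x y : X) : Prop :=
  bmeet (modulus x) (modulus y) = 0.

Definition disjointly_homogeneous (p : R) : Prop :=
  forall x : nat -> X,
    (forall n, `|x n| = 1) ->
    (forall m n, m <> n -> lattice_disjoint (x m) (x n)) ->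
    exists2 phi : nat -> nat, increasing_seq phi &
      equivalent_lp_basis p (x \o phi).

Definition pos_homogeneous_continuous (n : nat) (f : 'rV[R]_n -> R) : Prop :=
  continuous f /\ forall (a : R) t, 0 <= a -> f (a *: t) = a * f t.

(* Krivine's functional calculus: for given x_1, ..., x_n there is exactly one
   linear lattice homomorphism from the positively homogeneous continuous
   functions on R^n to X taking the i-th coordinate function to x_i.  The values
   of [tau] at other functions are irrelevant. *)
Record krivine_calculus (n : nat) (x : 'I_n -> X) (tau : ('rV[R]_n -> R) -> X)
    : Prop := KrivineCalculus {
  krivine_coord : forall i, tau (fun t => t 0 i) = x i ;
  krivine_linear : forall (a : R) f g,
    pos_homogeneous_continuous f -> pos_homogeneous_continuous g ->
    tau (fun t => a * f t + g t) = a *: tau f + tau g ;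
  krivine_join : forall f g,
    pos_homogeneous_continuous f -> pos_homogeneous_continuous g ->
    tau (fun t => Num.max (f t) (g t)) = bjoin (tau f) (tau g) ;
  krivine_meet : forall f g,
    pos_homogeneous_continuous f -> pos_homogeneous_continuous g ->
    tau (fun t => Num.min (f t) (g t)) = bmeet (tau f) (tau g)
}.

(* [z] is the element (|x_1|^p + ... + |x_n|^p)^(1/p) of X. *)
Definition is_lp_mean (p : R) (n : nat) (x : 'I_n -> X) (z : X) : Prop :=
  exists2 tau, krivine_calculus x tau &
    z = tau (fun t => (\sum_(i < n) `|t 0 i| `^ p) `^ p^-1).

Definition p_convex (p : R) : Prop :=
  exists M : R, forall (n : nat) (x : 'I_n -> X) (z : X), is_lp_mean p x z ->
    `|z| <= M * (\sum_(i < n) `|x i| `^ p) `^ p^-1.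

End BanachLatticeNotions.

(* Main.v *)
Require Import Defs.
From HB Require Import structures.
From mathcomp Require Import all_boot all_order all_algebra.
From mathcomp Require Import all_classical all_reals all_analysis.
From mathcomp Require Import ring lra.

Import Order.TTheory GRing.Theory Num.Theory.
Import numFieldNormedType.Exports.

Local Open Scope classical_set_scope.
Local Open Scope ring_scope.

(** Why the theorem holds.  Call a subspace [Y] far from disjoint when, for some
    positive [e] and some [eps > 0], every unit vector [y] of [Y] satisfies
    [eps <= | |y| /\ e |].  The proof is the Kadec-Pelczynski dichotomy, carried
    out inside the lattice instead of in a function space over it.

    If [Y] is not far from disjoint, unit vectors [y_n] of [Y] can be chosen one
    after the other so as to be small perturbations of disjoint unit vectors [x_n]
    ([almost_disjoint_sequence]).  By disjoint homogeneity a subsequence of [x_n]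
    is equivalent to the basis of l_p.  Its p-th powers span a copy of l_1 in the
    p-concavification, which p-convexity makes locally convex, so a single positive
    functional [phi] is bounded below on all of them.  The restrictions of [phi] to
    the bands of the [x_n] are biorthogonal to [x_n], and their values on a vector
    are p-summable because the L_p norm of [phi] is dominated by the norm of [X]
    ([disjoint_lp_functionals]).  This projects [X] onto the span of the [x_n], and
    a Neumann series carries the projection over to the [y_n] ([perturbed_copy]).

    If [Y] is far from disjoint from [e], a functional [phi] of the same kind exists
    that is bounded below on all components of [e] of norm at least [eps / 2]
    ([uniform_functional]).  As [p] is at least 2 and [phi] is a finite measure on
    the components of [e], [X] maps into the L_2 space of [phi]; the square of that
    L_2 norm is the supremum over finite partitions of [e] of the squared norms of
    the conditional expectations ([square_form]).  On [Y] this norm dominates the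
    norm of [X] ([hilbert_form_lower]), so [Y] is a Hilbert space and orthogonal
    projection complements it ([hilbert_subspace]).

    Three tools replace the representation of [X] as a function space.  Disjoint
    homogeneity makes monotone order bounded sequences converge
    ([increasing_cvg]), which yields components and the Freudenthal approximation
    by step elements ([band_component], [step_approx]).  On step elements powers
    are taken coefficientwise, and the coefficients themselves provide the
    functional calculus in which p-convexity is expressed ([step_power_convex]).
    Functionals are produced by maximal convex cones of linear constraints
    ([cone_linear_form], [power_functional_exists]). *)

Set Implicit Arguments.
Unset Strict Implicit.

(** * Linear identities in a module *)

Section VectorTerms.
Context {R : comPzRingType} {V : lmodType R}.

Inductive vterm :=
  | VVar of nat | VZero | VAdd of vterm & vterm | VOpp of vterm
  | VScale of R & vterm.

Fixpoint veval (e : seq V) (t : vterm) : V :=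
  match t with
  | VVar i => e`_i
  | VZero => 0
  | VAdd t u => veval e t + veval e u
  | VOpp t => - veval e t
  | VScale a t => a *: veval e t
  end.

Fixpoint vcoef (t : vterm) (i : nat) : R :=
  match t with
  | VVar j => if eqn i j then 1 else 0
  | VZero => 0
  | VAdd t u => vcoef t i + vcoef u i
  | VOpp t => - vcoef t i
  | VScale a t => a * vcoef t i
  end.

Lemma vevalE e t : veval e t = \sum_(i < size e) vcoef t i *: e`_i.
Proof.
elim: t => [j||t IHt u IHu|t IHt|a t IHt] /=.
- have [jlt|jge] := ltnP j (size e).
    rewrite (bigD1 (Ordinal jlt)) //= big1 ?addr0 => [|i /eqP ij].
      by rewrite (introT (@eqnP _ _)) // scale1r.
    case: (@eqnP i j) => [ij'|]; last by rewrite scale0r.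
    by case: ij; apply: val_inj.
  rewrite nth_default // big1 // => i _.
  case: (@eqnP i j) => [ij|]; last by rewrite scale0r.
  by move: (ltn_ord i); rewrite ij ltnNge jge.
- by rewrite big1 // => i _; rewrite scale0r.
- by rewrite IHt IHu -big_split; apply: eq_bigr => i _; rewrite scalerDl.
- by rewrite IHt -sumrN; apply: eq_bigr => i _; rewrite scaleNr.
- by rewrite IHt scaler_sumr; apply: eq_bigr => i _; rewrite scalerA.
Qed.

Fixpoint all_below (n : nat) (P : nat -> Prop) : Prop :=
  match n with 0%N => True | n.+1 => P n /\ all_below n P end.

Lemma veval_eq e t u :
  all_below (size e) (fun i => vcoef t i = vcoef u i) -> veval e t = veval e u.
Proof.
move=> H; rewrite !vevalE; apply: eq_bigr => i _; congr (_ *: _).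
have below : forall n, all_below n (fun i => vcoef t i = vcoef u i) ->
    forall k, (k < n)%N -> vcoef t k = vcoef u k.
  by elim=> // n IH /= [Hn /IH{}IH] k; rewrite ltnS leq_eqVlt => /orP[/eqP->|/IH].
exact: below H _ _.
Qed.

End VectorTerms.

(* Atoms are identified up to conversion: the same vector may reach the goal
   through different paths of the algebraic hierarchy. *)
Ltac vindex e x :=
  match e with
  | x :: _ => constr:(0%N)
  | ?y :: _ => let _ := match goal with _ => unify x y end in constr:(0%N)
  | _ :: ?e' => let i := vindex e' x in constr:(S i)
  end.

Ltac vatoms e x :=
  match x with
  | (?a + ?b)%R => let e := vatoms e a in vatoms e b
  | (- ?a)%R => vatoms e a
  | (_ *: ?a)%R => vatoms e a
  | 0%R => e
  | _ => match e with
         | _ => let i := vindex e x in e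
         | _ => constr:(x :: e)
         end
  end.

Ltac vreify R e x :=
  match x with
  | (?a + ?b)%R =>
      let a := vreify R e a in let b := vreify R e b in constr:(@VAdd R a b)
  | (- ?a)%R => let a := vreify R e a in constr:(@VOpp R a)
  | (?c *: ?a)%R => let a := vreify R e a in constr:(@VScale R c a)
  | 0%R => constr:(@VZero R)
  | _ => let i := vindex e x in constr:(@VVar R i)
  end.

Ltac vlin_with R solver :=
  match goal with
  | |- @eq ?V ?x ?y =>
      let e := vatoms (@nil V) x in let e := vatoms e y in
      let t := vreify R e x in let u := vreify R e y in
      change (veval e t = veval e u); apply: veval_eq; cbn -[GRing.add GRing.opp GRing.mul GRing.one GRing.zero];
      repeat (split; [solver|]); exact I
  end.

Ltac vlin :=
  match goal with R : realType |- _ => vlin_with R ltac:(by [ring|field]) end.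

Notation "x <=b y" := (ble x y) (at level 70, no associativity).
Notation "x /\b y" := (bmeet x y) (at level 45, left associativity).
Notation "x \/b y" := (bjoin x y) (at level 45, left associativity).

Section LatticeBasics.
Context {R : realType} {X : banachLatticeType R}.
Implicit Types x y z u v w a b c e : X.

Lemma blexx x : x <=b x. Proof. exact: ble_refl. Qed.
Hint Resolve blexx : core.

Lemma ble_eq x y : x <=b y -> y <=b x -> x = y.
Proof. by move=> xy yx; apply: ble_anti; rewrite xy yx. Qed.

Lemma ble_tr y x z : x <=b y -> y <=b z -> x <=b z.
Proof. by move=> xy yz; exact: ble_trans _ _ _ xy yz. Qed.

Lemma ble_sub x y : (x <=b y) = (0 <=b y - x).
Proof.
apply/idP/idP => H; [have := ble_add2r _ _ (- x) H|have := ble_add2r _ _ x H].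
  by rewrite subrr.
by rewrite add0r subrK.
Qed.

Lemma bleD2r z x y : (x + z <=b y + z) = (x <=b y).
Proof. by rewrite ble_sub (ble_sub x); congr (0 <=b _); vlin. Qed.

Lemma bleD x y u v : x <=b y -> u <=b v -> x + u <=b y + v.
Proof.
move=> xy uv; apply: (@ble_tr (y + u)); first by rewrite bleD2r.
by rewrite ![y + _]addrC bleD2r.
Qed.

Lemma bleDl x y z : (x <=b y + z) = (x - z <=b y).
Proof. by rewrite -(bleD2r (- z)) addrK. Qed.

Lemma bleN x y : (- x <=b - y) = (y <=b x).
Proof. by rewrite ble_sub (ble_sub y); congr (0 <=b _); vlin. Qed.

Lemma bleNr x y : (x <=b - y) = (y <=b - x).
Proof. by rewrite -bleN opprK. Qed.

Lemma bleD0 x y : 0 <=b x -> 0 <=b y -> 0 <=b x + y.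
Proof. by move=> x0 y0; have := bleD x0 y0; rewrite addr0. Qed.

Lemma ble_addl x y : 0 <=b y -> x <=b x + y.
Proof. by rewrite (ble_sub x) (_ : x + y - x = y) //; vlin. Qed.

Lemma bleZ (k : R) x y : 0 <= k -> x <=b y -> k *: x <=b k *: y.
Proof. by move=> k0 xy; apply: ble_scale. Qed.

Lemma bleZ0 (k : R) x : 0 <= k -> 0 <=b x -> 0 <=b k *: x.
Proof. by move=> k0 x0; have := bleZ k0 x0; rewrite scaler0. Qed.

Lemma bleZl (k l : R) x : k <= l -> 0 <=b x -> k *: x <=b l *: x.
Proof.
move=> kl x0; rewrite ble_sub -scalerBl.
by apply: bleZ0 => //; rewrite subr_ge0.
Qed.

Lemma ble_sum (I : Type) (r : seq I) (P : pred I) (f g : I -> X) :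
  (forall i, P i -> f i <=b g i) ->
  \sum_(i <- r | P i) f i <=b \sum_(i <- r | P i) g i.
Proof. by move=> H; elim/big_ind2 : _ => // *; exact: bleD. Qed.

Lemma sum_ble0 (I : Type) (r : seq I) (P : pred I) (f : I -> X) :
  (forall i, P i -> 0 <=b f i) -> 0 <=b \sum_(i <- r | P i) f i.
Proof. by move=> H; elim/big_ind : _ => // *; exact: bleD0. Qed.

Lemma bmeet_ble x y z : (x <=b y /\b z) = (x <=b y) && (x <=b z).
Proof. exact: ble_meet. Qed.

Lemma bjoin_ble x y z : (x \/b y <=b z) = (x <=b z) && (y <=b z).
Proof. exact: ble_join. Qed.

Lemma bmeetl x y : x /\b y <=b x.
Proof. by have := blexx (x /\b y); rewrite bmeet_ble => /andP[]. Qed.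

Lemma bmeetr x y : x /\b y <=b y.
Proof. by have := blexx (x /\b y); rewrite bmeet_ble => /andP[]. Qed.

Lemma bjoinl x y : x <=b x \/b y.
Proof. by have := blexx (x \/b y); rewrite bjoin_ble => /andP[]. Qed.

Lemma bjoinr x y : y <=b x \/b y.
Proof. by have := blexx (x \/b y); rewrite bjoin_ble => /andP[]. Qed.

Lemma bmeetC x y : x /\b y = y /\b x.
Proof. by apply: ble_eq; rewrite bmeet_ble bmeetl bmeetr. Qed.

Lemma bjoinC x y : x \/b y = y \/b x.
Proof. by apply: ble_eq; rewrite bjoin_ble bjoinl bjoinr. Qed.

Lemma bmeet_l x y : x <=b y -> x /\b y = x.
Proof. by move=> xy; apply: ble_eq; rewrite ?bmeetl // bmeet_ble blexx. Qed.

Lemma bmeet_r x y : y <=b x -> x /\b y = y.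
Proof. by rewrite bmeetC; exact: bmeet_l. Qed.

Lemma bjoin_l x y : y <=b x -> x \/b y = x.
Proof. by move=> xy; apply: ble_eq; rewrite ?bjoinl // bjoin_ble blexx. Qed.

Lemma bmeet_mono x y u v : x <=b y -> u <=b v -> x /\b u <=b y /\b v.
Proof.
move=> xy uv; rewrite bmeet_ble (ble_tr (bmeetl _ _) xy).
exact: ble_tr (bmeetr _ _) uv.
Qed.

Lemma bjoinD x y z : (x \/b y) + z = (x + z) \/b (y + z).
Proof.
apply: ble_eq; last by rewrite bjoin_ble !bleD2r bjoinl bjoinr.
by rewrite -(bleD2r (- z)) addrK bjoin_ble -!(bleD2r z _ (_ - z)) subrK bjoinl bjoinr.
Qed.

Lemma bmeetD x y z : (x /\b y) + z = (x + z) /\b (y + z).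
Proof.
apply: ble_eq; first by rewrite bmeet_ble !bleD2r bmeetl bmeetr.
by rewrite -(bleD2r (- z)) addrK bmeet_ble -!(bleD2r z (_ - z)) subrK bmeetl bmeetr.
Qed.

Lemma bjoinN x y : - (x \/b y) = (- x) /\b (- y).
Proof.
apply: ble_eq; first by rewrite bmeet_ble !bleN bjoinl bjoinr.
by rewrite bleNr bjoin_ble (bleNr x) (bleNr y) bmeetl bmeetr.
Qed.

Lemma bjoinZ (k : R) x y : 0 <= k -> k *: (x \/b y) = (k *: x) \/b (k *: y).
Proof.
rewrite le_eqVlt => /orP[/eqP<-|k0].
  by rewrite !scale0r; apply: ble_eq; rewrite ?bjoinl // bjoin_ble blexx.
have kV : 0 <= k^-1 by rewrite invr_ge0 ltW.
have kK z : k^-1 *: (k *: z) = z by rewrite scalerA mulVf ?gt_eqF // scale1r.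
apply: ble_eq; last by rewrite bjoin_ble !bleZ ?bjoinl ?bjoinr // ltW.
have : x \/b y <=b k^-1 *: (k *: x \/b k *: y).
  by rewrite bjoin_ble -{1}(kK x) -{2}(kK y) !bleZ ?bjoinl ?bjoinr.
by move/(bleZ (ltW k0)); rewrite scalerA mulfV ?gt_eqF // scale1r.
Qed.

(** ** Positive parts *)

Definition pos x := x \/b 0.

Lemma pos_ge0 x : 0 <=b pos x. Proof. exact: bjoinr. Qed.
Lemma pos_ge x : x <=b pos x. Proof. exact: bjoinl. Qed.
Hint Resolve pos_ge0 pos_ge : core.

Lemma pos_ble x z : x <=b z -> 0 <=b z -> pos x <=b z.
Proof. by move=> ? ?; rewrite bjoin_ble; apply/andP. Qed.

Lemma pos_mono x y : x <=b y -> pos x <=b pos y.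
Proof. by move=> xy; rewrite pos_ble // (ble_tr xy). Qed.

Lemma pos_id x : 0 <=b x -> pos x = x. Proof. exact: bjoin_l. Qed.

Lemma bjoinE x y : x \/b y = x + pos (y - x).
Proof. by rewrite addrC bjoinD subrK add0r bjoinC. Qed.

Lemma bmeetE x y : x /\b y = x - pos (x - y).
Proof.
rewrite -[LHS]opprK -{1}(opprK x) -{1}(opprK y) -bjoinN opprK bjoinE opprK.
by rewrite [- y + x]addrC opprD opprK.
Qed.

Lemma pos_meet x y : pos (x - y) = x - x /\b y.
Proof. by rewrite bmeetE; vlin. Qed.

Lemma bjoin_bmeet x y : x \/b y + x /\b y = x + y.
Proof. by rewrite bjoinE bmeetC bmeetE; vlin. Qed.

Lemma posZ (k : R) x : 0 <= k -> pos (k *: x) = k *: pos x.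
Proof. by move=> k0; rewrite /pos bjoinZ // scaler0. Qed.

Lemma bmeetZ (k : R) x y : 0 <= k -> k *: (x /\b y) = (k *: x) /\b (k *: y).
Proof. by move=> k0; rewrite !bmeetE scalerBr -posZ // scalerBr. Qed.

Lemma pos_sub x : x = pos x - pos (- x).
Proof.
have := bjoinD x 0 (- x); rewrite subrr add0r -/(pos x) bjoinC -/(pos (- x)).
by move=> <-; vlin.
Qed.

Lemma pos_disjoint x : pos x /\b pos (- x) = 0.
Proof. by rewrite bmeetE -pos_sub; vlin. Qed.

Lemma pos_eq u v : u /\b v = 0 -> pos (u - v) = u.
Proof. by rewrite pos_meet => ->; rewrite subr0. Qed.

Lemma modulusE x : modulus x = pos x + pos (- x).
Proof.
rewrite /modulus bjoinE (_ : - x - x = 2 *: (- x)); last by vlin.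
by rewrite posZ // {1}(pos_sub x); vlin.
Qed.

Lemma modulus_ge0 x : 0 <=b modulus x.
Proof. by rewrite modulusE bleD0. Qed.
Hint Resolve modulus_ge0 : core.

Lemma modulusN x : modulus (- x) = modulus x.
Proof. by rewrite !modulusE opprK addrC. Qed.

Lemma modulus_id x : 0 <=b x -> modulus x = x.
Proof.
move=> x0; apply: bjoin_l; apply: ble_tr (x0).
by move: x0; rewrite -bleN oppr0.
Qed.

Lemma modulus_modulus x : modulus (modulus x) = modulus x.
Proof. exact: modulus_id. Qed.

Lemma pos_modulus x : pos x <=b modulus x.
Proof. by rewrite modulusE ble_addl. Qed.

Lemma posN_modulus x : pos (- x) <=b modulus x.
Proof. by rewrite -modulusN pos_modulus. Qed.

Lemma modulus_ge x : x <=b modulus x. Proof. exact: bjoinl. Qed.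
Lemma modulus_geN x : - x <=b modulus x. Proof. exact: bjoinr. Qed.

Lemma modulus_ble x z : x <=b z -> - x <=b z -> modulus x <=b z.
Proof. by move=> ? ?; rewrite bjoin_ble; apply/andP. Qed.

Lemma modulusD x y : modulus (x + y) <=b modulus x + modulus y.
Proof. by rewrite modulus_ble ?opprD ?bleD ?modulus_ge ?modulus_geN. Qed.

Lemma modulusZ (k : R) x : modulus (k *: x) = `|k| *: modulus x.
Proof.
have [k0|k0] := leP 0 k.
  by rewrite /modulus ger0_norm // bjoinZ // scalerN.
rewrite -modulusN ltr0_norm // -scaleNr /modulus bjoinZ ?scalerN //.
by rewrite oppr_ge0 ltW.
Qed.

(** ** Norm monotonicity *)

Lemma norm_modulus x : `|modulus x| = `|x|.
Proof.
apply/eqP; rewrite eq_le; apply/andP; split; apply: ble_norm;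
  by rewrite -!/(modulus _) modulus_modulus.
Qed.

Lemma norm_ble x y : modulus x <=b modulus y -> `|x| <= `|y|.
Proof. exact: ble_norm. Qed.

Lemma norm_ble0 x y : 0 <=b x -> x <=b y -> `|x| <= `|y|.
Proof.
move=> x0 xy; apply: norm_ble; rewrite !modulus_id //; exact: ble_tr xy.
Qed.

Lemma norm_le_modulus x y : modulus x <=b y -> `|x| <= `|y|.
Proof. by move=> xy; rewrite -norm_modulus norm_ble0. Qed.

Lemma pos_lip x y : modulus (pos x - pos y) <=b modulus (x - y).
Proof.
have half u v : pos u - pos v <=b modulus (u - v).
  rewrite -bleDl; apply: pos_ble; last by rewrite bleD0.
  by rewrite -[u in X in X <=b _](subrK v u) bleD ?modulus_ge.
by apply: modulus_ble; rewrite ?opprB // -(opprB y x) modulusN.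
Qed.

Lemma norm_pos_lip x y : `|pos x - pos y| <= `|x - y|.
Proof. exact/norm_ble/pos_lip. Qed.

Lemma norm_pos x : `|pos x| <= `|x|.
Proof. by rewrite -(norm_modulus x) norm_ble0 // pos_modulus. Qed.


(** ** Disjoint positive elements *)

Lemma pos_posD x u : 0 <=b u -> pos (pos x - u) = pos (x - u).
Proof.
move=> u0; apply: ble_eq; last by rewrite pos_mono // bleD2r.
apply: pos_ble => //; rewrite -bleDl; apply: pos_ble; last by rewrite bleD0.
by rewrite bleDl pos_ge.
Qed.

Lemma bmeet_ge0 x y : 0 <=b x -> 0 <=b y -> 0 <=b x /\b y.
Proof. by rewrite bmeet_ble => -> ->. Qed.

Lemma disj_le a b u v : 0 <=b u -> 0 <=b v -> u <=b a -> v <=b b ->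
  a /\b b = 0 -> u /\b v = 0.
Proof.
move=> u0 v0 ua vb ab; apply: ble_eq; last exact: bmeet_ge0.
by rewrite -ab bmeet_mono.
Qed.

(** Subtract [a /\ c]: as [w = (a + b) /\ c] lies below both [a + b] and [c], the
    elements [w - a] and [w - c] both lie below [b /\ c]. *)
Lemma bmeet_addl a b c : 0 <=b a -> 0 <=b b -> 0 <=b c ->
  (a + b) /\b c <=b a /\b c + b /\b c.
Proof.
move=> a0 b0 c0; set w := (a + b) /\b c.
have wc : w <=b c := bmeetr _ _; have wab : w <=b a + b := bmeetl _ _.
rewrite [X in _ <=b X]addrC bleDl.
have -> : w - a /\b c = (w - a) \/b (w - c).
  by rewrite bjoinE (_ : w - c - (w - a) = a - c) 1?bmeetE; vlin.
have lc : w - c <=b 0 by rewrite -bleDl add0r.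
rewrite bjoin_ble !bmeet_ble !(ble_tr lc) // !andbT -!bleDl.
by rewrite addrC wab (ble_tr wc) // ble_addl.
Qed.

Lemma disjDl a b c : 0 <=b a -> 0 <=b b -> 0 <=b c ->
  a /\b c = 0 -> b /\b c = 0 -> (a + b) /\b c = 0.
Proof.
move=> a0 b0 c0 ac bc; apply: ble_eq; last by rewrite bmeet_ge0 // bleD0.
by apply: ble_tr (bmeet_addl a0 b0 c0) _; rewrite ac bc addr0.
Qed.

Lemma disj_suml (I : Type) (r : seq I) (P : pred I) (f : I -> X) c :
  0 <=b c -> (forall i, P i -> 0 <=b f i) -> (forall i, P i -> f i /\b c = 0) ->
  (\sum_(i <- r | P i) f i) /\b c = 0.
Proof.
move=> c0 f0 fc.
suff [] : 0 <=b \sum_(i <- r | P i) f i /\ (\sum_(i <- r | P i) f i) /\b c = 0 by [].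
elim/big_ind : _ => [|x y [x0 xc] [y0 yc]|i Pi]; last by split; auto.
  by rewrite bmeet_l.
by rewrite bleD0 // disjDl.
Qed.

Lemma disj_sum (I J : Type) (r : seq I) (s : seq J) (P : pred I) (Q : pred J)
    (f : I -> X) (g : J -> X) :
  (forall i, P i -> 0 <=b f i) -> (forall j, Q j -> 0 <=b g j) ->
  (forall i j, P i -> Q j -> f i /\b g j = 0) ->
  (\sum_(i <- r | P i) f i) /\b (\sum_(j <- s | Q j) g j) = 0.
Proof.
move=> f0 g0 fg; apply: disj_suml => //; first exact: sum_ble0.
move=> i Pi; rewrite bmeetC; apply: disj_suml => [|//|j Qj]; first exact: f0.
by rewrite bmeetC fg.
Qed.

Lemma disj_scale (k l : R) a b : 0 <= k -> 0 <= l -> 0 <=b a -> 0 <=b b ->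
  a /\b b = 0 -> (k *: a) /\b (l *: b) = 0.
Proof.
move=> k0 l0 a0 b0 ab; pose m := Num.max k l.
have m0 : 0 <= m by rewrite le_max k0.
apply: (@disj_le (m *: a) (m *: b)); rewrite ?bleZ0 ?bleZl ?le_max ?lexx ?orbT //.
by rewrite -bmeetZ // ab scaler0.
Qed.

Lemma ble_disj u v w : 0 <=b u -> 0 <=b v -> 0 <=b w ->
  w /\b v = 0 -> w <=b u + v -> w <=b u.
Proof.
move=> u0 v0 w0 wv wuv.
rewrite -(bmeet_r wuv); apply: ble_tr (bmeet_addl _ _ _) _ => //.
by rewrite [v /\b w]bmeetC wv addr0 bmeetl.
Qed.

Lemma disj_add_le a b u : 0 <=b a -> 0 <=b b -> a /\b b = 0 ->
  a <=b u -> b <=b u -> a + b <=b u.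
Proof. by move=> a0 b0 ab au bu; rewrite -bjoin_bmeet ab addr0 bjoin_ble au. Qed.

(** ** Finite disjoint families *)

Definition disj_family (I : Type) (d : I -> X) : Prop :=
  (forall i, 0 <=b d i) /\ (forall i j, i <> j -> d i /\b d j = 0).

Lemma disj_family_sum_le (I : finType) (d : I -> X) u : disj_family d ->
  0 <=b u -> (forall i, d i <=b u) -> forall r : seq I, uniq r ->
  \sum_(i <- r) d i <=b u.
Proof.
move=> [d0 dd] u0 du; elim=> [|i r IH] /=; first by rewrite big_nil.
move=> /andP[ir ur]; rewrite big_cons disj_add_le ?sum_ble0 ?IH //.
rewrite bmeetC big_seq; apply: disj_suml => // j jr; apply: dd => ji.
by rewrite -ji jr in ir.
Qed.

Lemma bmeet_sumr (I : finType) (d : I -> X) u : disj_family d -> 0 <=b u ->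
  u /\b (\sum_i d i) = \sum_i (u /\b d i).
Proof.
move=> dd u0; have [d0 dij] := dd; apply: ble_eq; last first.
  rewrite bmeet_ble; apply/andP; split; last first.
    by apply: ble_sum => i _; rewrite bmeetr.
  apply: disj_family_sum_le (index_enum_uniq _) => // [|i]; last exact: bmeetl.
  split=> [i|i j ij]; first exact: bmeet_ge0.
  by apply: disj_le (dij _ _ ij); rewrite ?bmeet_ge0 ?bmeetr.
suff [_] : 0 <=b \sum_i d i /\ u /\b (\sum_i d i) <=b \sum_i (u /\b d i) by [].
elim/big_ind2 : _ => [|x x' y y' [x0 IHx] [y0 IHy]|i _].
- by rewrite bmeetr.
- split; first exact: bleD0.
  rewrite bmeetC; apply: ble_tr (bmeet_addl _ _ _) _ => //.
  by rewrite ![_ /\b u]bmeetC bleD.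
- by rewrite blexx d0.
Qed.

Lemma step_disj (I : finType) (d : I -> X) (a b : I -> R) : disj_family d ->
  (forall i, 0 <= a i) -> (forall i, 0 <= b i) -> (forall i, a i * b i = 0) ->
  (\sum_i a i *: d i) /\b (\sum_i b i *: d i) = 0.
Proof.
move=> [d0 dd] a0 b0 ab; apply: disj_sum => [i _|i _|i j _ _]; rewrite ?bleZ0 //.
have [<-|ij] := eqVneq i j; last by rewrite disj_scale // dd //; exact/eqP.
have /eqP := ab i; rewrite mulf_eq0 => /orP[]/eqP->; rewrite scale0r.
  by rewrite bmeet_l // bleZ0.
by rewrite bmeet_r // bleZ0.
Qed.

(** The positive and the negative coefficients give two disjoint elements, and a
    difference of disjoint elements has the first one as its positive part. *)
Lemma pos_step (I : finType) (d : I -> X) (a : I -> R) : disj_family d ->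
  pos (\sum_i a i *: d i) = \sum_i Num.max (a i) 0 *: d i.
Proof.
move=> dd; rewrite -[RHS](@pos_eq _ (\sum_i Num.max (- a i) 0 *: d i)).
  congr pos; rewrite -sumrB; apply: eq_bigr => i _; rewrite -scalerBl.
  congr (_ *: _); rewrite !maxEle oppr_le0.
  by case: (leP 0 (a i)); case: (leP (a i) 0); lra.
apply: step_disj => // i; rewrite ?le_max ?lexx ?orbT //.
rewrite !maxEle oppr_le0.
by case: (leP 0 (a i)); case: (leP (a i) 0); nra.
Qed.

Lemma bjoin_step (I : finType) (d : I -> X) (a b : I -> R) : disj_family d ->
  (\sum_i a i *: d i) \/b (\sum_i b i *: d i) =
  \sum_i Num.max (a i) (b i) *: d i.
Proof.
move=> dd; rewrite bjoinE -sumrB; under [in pos _]eq_bigr do rewrite -scalerBl.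
rewrite pos_step // -big_split; apply: eq_bigr => i _ /=; rewrite -scalerDl.
congr (_ *: _); rewrite !maxEle subr_le0.
by case: (leP (b i) (a i)); case: (leP (a i) (b i)); lra.
Qed.

Lemma bmeet_step (I : finType) (d : I -> X) (a b : I -> R) : disj_family d ->
  (\sum_i a i *: d i) /\b (\sum_i b i *: d i) =
  \sum_i Num.min (a i) (b i) *: d i.
Proof.
move=> dd; rewrite bmeetE -sumrB; under [in pos _]eq_bigr do rewrite -scalerBl.
rewrite pos_step // -sumrB; apply: eq_bigr => i _ /=; rewrite -scalerBl.
congr (_ *: _); rewrite minEle maxEle subr_le0.
by case: (leP (b i) (a i)); case: (leP (a i) (b i)); lra.
Qed.

(** The positive part of the difference of two step elements is the step element
    with the positive parts of the coefficients; so it vanishes only when each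
    offending coefficient multiplies zero. *)
Lemma step_coef_le (I : finType) (d : I -> X) (a b : I -> R) : disj_family d ->
  \sum_i a i *: d i <=b \sum_i b i *: d i ->
  forall i, d i = 0 \/ a i <= b i.
Proof.
move=> dd; have [d0 _] := dd; rewrite ble_sub -sumrB => ab i.
have := @pos_step _ _ (fun i => a i - b i) dd.
under eq_bigr do rewrite scalerBl.
have -> : pos (\sum_i (a i *: d i - b i *: d i)) = 0.
  apply: ble_eq => //; apply: pos_ble => //; rewrite -bleN oppr0 -sumrN.
  by under eq_bigr do rewrite opprB.
move=> S0; have [|ba] := leP (a i) (b i); [by right|left].
have : Num.max (a i - b i) 0 *: d i <=b 0.
  rewrite S0 (bigD1 i) //= ble_addl // sum_ble0 // => j _.
  by rewrite bleZ0 // le_max lexx orbT.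
have ba0 : 0 < Num.max (a i - b i) 0 by rewrite lt_max subr_gt0 ba.
move=> /(bleZ (ltW (_ : 0 < (Num.max (a i - b i) 0)^-1))).
rewrite invr_gt0 => /(_ ba0); rewrite scalerA mulVf ?gt_eqF // scale1r scaler0.
by move=> di; apply: ble_eq.
Qed.

End LatticeBasics.

#[global] Hint Resolve blexx pos_ge0 pos_ge modulus_ge0 : core.

(** * Sequences in normed spaces *)

Section Sequences.
Context {R : realType}.

Lemma cvg_epsP (V : normedModType R) (u : nat -> V) (l : V) :
  u @ \oo --> l <->
  (forall eps : R, 0 < eps -> exists N, forall n, (N <= n)%N -> `|u n - l| < eps).
Proof.
split=> [/cvgrPdist_lt ul eps eps0|ul].
  have [N _ HN] := ul _ eps0; exists N => n Nn.
  by rewrite distrC; exact: HN.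
apply/cvgrPdist_lt => eps eps0; have [N HN] := ul _ eps0.
by exists N => // n Nn /=; rewrite distrC; exact: HN.
Qed.

Lemma cvg_addn (V : normedModType R) (u : nat -> V) (l : V) (k : nat) :
  u @ \oo --> l -> (fun n => u (k + n)%N) @ \oo --> l.
Proof.
move=> /cvg_epsP ul; apply/cvg_epsP => eps /ul[N HN]; exists N => n Nn.
by apply: HN; rewrite (leq_trans Nn) // leq_addl.
Qed.

Lemma cauchy_eps_cvg (V : completeNormedModType R) (u : nat -> V) :
  (forall eps : R, 0 < eps ->
     exists N, forall n, (N <= n)%N -> `|u n - u N| < eps) ->
  exists l : V, u @ \oo --> l.
Proof.
move=> uC; exists (lim (u @ \oo)); apply/cauchy_cvgP/cauchy_exP => eps eps0.
have [N HN] := uC _ eps0; exists (u N), N => // n Nn /=.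
by rewrite -ball_normE /ball_ /= distrC; exact: HN.
Qed.

Lemma cvg_norm_le (V : normedModType R) (u : nat -> V) l (B : R) :
  u @ \oo --> l -> (forall n, `|u n| <= B) -> `|l| <= B.
Proof.
move=> /cvg_epsP ul uB; rewrite leNgt; apply/negP => Bl.
have [|N HN] := ul (`|l| - B); first by rewrite subr_gt0.
have := HN N (leqnn N); have := uB N; have := ler_normB (u N) (u N - l).
by rewrite (_ : u N - (u N - l) = l); [lra|vlin].
Qed.

Lemma geo_small (eps : R) : 0 < eps -> exists N, 2^-1 ^+ N < eps.
Proof.
move=> eps0; have := @cvg_geometric R 1 2^-1.
rewrite ger0_norm ?invr_ge0 // invf_lt1 // ltr1n => /(_ isT)/cvg_epsP/(_ _ eps0)[N].
move/(_ N (leqnn N)); rewrite subr0 /geometric /= mul1r ger0_norm ?exprn_ge0 ?invr_ge0 //.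
by exists N.
Qed.

Lemma nat_above (a : R) : exists n : nat, a < n%:R.
Proof.
exists (Num.bound a); have [a0|a0] := leP 0 a; first exact: archi_boundP.
exact: lt_le_trans a0 _.
Qed.

Lemma powR_unbounded (r a : R) : 0 < r -> exists n : nat, a < n%:R `^ r.
Proof.
move=> r0; have [n an] := nat_above (`|a| `^ r^-1); exists n.
apply: le_lt_trans (ler_norm a) _.
have := gt0_ltr_powR r0; move=> /(_ (`|a| `^ r^-1) n%:R); rewrite !nnegrE powR_ge0 ler0n => /(_ isT isT an).
by rewrite -powRrM mulVf ?gt_eqF // powRr1.
Qed.

Lemma infinitely_often (P : nat -> Prop) :
  (forall N, exists2 n, (N <= n)%N & P n) ->
  exists2 phi : nat -> nat, (forall k, (phi k < phi k.+1)%N) & forall k, P (phi k).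
Proof.
move=> H; have /choice[f Hf] N : exists n, (N <= n)%N /\ P n by have [n] := H N; exists n.
exists (fix phi k := if k is k'.+1 then f (phi k').+1 else f 0%N) => [k|[|k]] /=.
- exact: (Hf _).1.
- exact: (Hf _).2.
- exact: (Hf _).2.
Qed.

End Sequences.

Section OrderContinuity.
Context {R : realType} {X : banachLatticeType R}.
Implicit Types x y z w a b c e : X.

Lemma norm_pos_sub w b : 0 <=b w -> 0 <=b b -> `|w| - `|b| <= `|pos (w - b)|.
Proof.
move=> w0 b0; rewrite lerBlDr; apply: le_trans (ler_normD _ _).
by apply: norm_ble0 => //; rewrite -{1}(subrK b w) bleD2r.
Qed.

Lemma pos_sub_le a b : 0 <=b a -> 0 <=b b -> pos (a - b) <=b a.
Proof. by move=> a0 b0; apply: pos_ble => //; rewrite -bleDl ble_addl. Qed.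

Lemma cvg_pos (u : nat -> X) l : u @ \oo --> l -> pos \o u @ \oo --> pos l.
Proof.
move=> /cvg_epsP ul; apply/cvg_epsP => eps /ul[N HN]; exists N => n /HN.
exact/le_lt_trans/norm_pos_lip.
Qed.

Lemma cvg_ble0 (u : nat -> X) l :
  u @ \oo --> l -> (forall n, 0 <=b u n) -> 0 <=b l.
Proof.
move=> ul u0; have := cvg_pos ul; have -> : pos \o u = u.
  by apply/funext => n; rewrite /= pos_id.
by move=> /(cvg_unique _ ul) ->.
Qed.

Lemma cvg_ble (u v : nat -> X) l m : u @ \oo --> l -> v @ \oo --> m ->
  (forall n, u n <=b v n) -> l <=b m.
Proof.
move=> ul vm uv; rewrite ble_sub; apply: cvg_ble0 (cvgB vm ul) _ => n.
by rewrite -ble_sub.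
Qed.

Lemma cvg_ble_cst (u : nat -> X) l e : u @ \oo --> l ->
  (forall n, u n <=b e) -> l <=b e.
Proof. by move=> ul; apply: cvg_ble ul (cvg_cst e). Qed.

Lemma cvg_bge_cst (u : nat -> X) l e : u @ \oo --> l ->
  (forall n, e <=b u n) -> e <=b l.
Proof. by move=> ul; apply: cvg_ble (cvg_cst e) ul. Qed.

Lemma cvg_bmeet (u : nat -> X) l a :
  u @ \oo --> l -> (fun n => a /\b u n) @ \oo --> a /\b l.
Proof.
move=> ul; rewrite bmeetE (_ : (fun _ => _) = fun n => a - pos (a - u n)).
  by apply: cvgB; [exact: cvg_cst|apply: cvg_pos; apply: cvgB => //; exact: cvg_cst].
by apply/funext => n; rewrite bmeetE.
Qed.

Lemma bseq_mono (u : nat -> X) : (forall n, u n <=b u n.+1) ->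
  forall m n, (m <= n)%N -> u m <=b u n.
Proof.
move=> H m n /subnKC <-; elim: (n - m)%N => [|k IH]; rewrite ?addn0 ?addnS //.
exact: ble_tr IH (H _).
Qed.

Lemma sum_ord_mono (u : nat -> X) m n : (forall k, 0 <=b u k) -> (m <= n)%N ->
  \sum_(k < m) u k <=b \sum_(k < n) u k.
Proof.
move=> u0; apply: (@bseq_mono (fun m => \sum_(k < m) u k)) => k.
by rewrite big_ord_recr ble_addl.
Qed.

Variables (p : R) (p_gt0 : 0 < p).
Hypothesis X_dh : disjointly_homogeneous X p.

(** [n] normalized disjoint vectors have a sum of norm about [n^(1/p)] along a
    subsequence, whereas order boundedness keeps these norms bounded. *)
Lemma no_bounded_disjoint e (v : nat -> X) (eps : R) : 0 < eps ->
  (forall k, 0 <=b v k) -> (forall k, v k <=b e) -> (forall k, eps <= `|v k|) ->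
  (forall k l, (k < l)%N -> v k /\b v l = 0) -> False.
Proof.
move=> eps0 v0 ve veps vd.
have nv0 k : 0 < `|v k| by apply: lt_le_trans (veps k).
have vdd k l : k <> l -> v k /\b v l = 0.
  by move=> /eqP; rewrite neq_ltn => /orP[/vd|/vd] //; rewrite bmeetC.
pose x k := `|v k|^-1 *: v k.
have x0 k : 0 <=b x k by rewrite bleZ0 // invr_ge0.
have [k|k l kl|phi phi_inc [c [C [c0 cC]]]] := X_dh (x := x).
- by rewrite normrZ normfV normr_id mulVf ?gt_eqF.
- by rewrite /lattice_disjoint !modulus_id // disj_scale ?invr_ge0 // vdd.
have := @powR_unbounded R p^-1 (c^-1 * (eps^-1 * `|e|)).
rewrite invr_gt0 => /(_ p_gt0)[n]; rewrite ltr_pdivrMl // ltNge => /negP[].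
have /andP[+ _] := cC n (fun=> 1).
rewrite (eq_bigr (fun=> 1)) => [|i _]; last by rewrite normr1 powR1.
rewrite sumr_const card_ord => /le_trans; apply.
have -> : eps^-1 * `|e| = `|eps^-1 *: e| by rewrite normrZ ger0_norm // invr_ge0 ltW.
have phi_inj : injective phi := increasing_seq_injective phi_inc.
apply: norm_ble0; first by apply: sum_ble0 => i _; rewrite /= scale1r.
apply: (@ble_tr _ _ (\sum_(i < n) eps^-1 *: v (phi i))).
  apply: ble_sum => i _; rewrite /= scale1r /x; apply: bleZl => //.
  by rewrite lef_pV2 ?posrE.
rewrite -scaler_sumr; apply: bleZ; first by rewrite invr_ge0 ltW.
apply: disj_family_sum_le (index_enum_uniq _) => //.
- split=> // i j ij; apply: vdd => /phi_inj/val_inj; exact: ij.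
- exact: ble_tr (ve 0%N).
Qed.

(** The increments of an increasing order bounded sequence that is not Cauchy have
    this form; the next lemmas show that the property cannot hold. *)
Definition summable_below e (eps : R) (u : nat -> X) : Prop :=
  [/\ forall k, 0 <=b u k, forall n, \sum_(k < n) u k <=b e
    & forall k, eps <= `|u k|].

Lemma summable_below_le e eps (u : nat -> X) : summable_below e eps u -> forall k, u k <=b e.
Proof.
case=> u0 ue _ k; apply: ble_tr (ue k.+1); rewrite big_ord_recr /= addrC.
by rewrite ble_addl // sum_ble0.
Qed.

(** Among finitely many members [u_0, ..., u_(J-1)], the average of the
    [u_m - t u_i] exceeds [u_m - (t / J) e]; so for each [m] some [i < J] makes
    [(u_m - t u_i)^+] large, and one [i] serves infinitely many [m]. *)
Lemma summable_below_step e (eps eps' t : R) (u : nat -> X) : 0 <= t -> eps' < eps ->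
  0 <= eps' -> summable_below e eps u ->
  exists i u', summable_below e eps' u' /\
    forall k, exists m, u' k = pos (u m - t *: u i).
Proof.
move=> t0 eps_lt eps'0 us; have ule := summable_below_le us.
have [u0 ue ueps] := us.
have e0 : 0 <=b e by apply: ble_tr (ule 0%N).
have [J HJ] := nat_above (t * `|e| / (eps - eps')).
have J0 : 0 < J%:R :> R.
  by apply: le_lt_trans HJ; rewrite divr_ge0 ?mulr_ge0 // subr_ge0 ltW.
have some m : exists2 i : 'I_J, True & eps' <= `|pos (u m - t *: u i)|.
  apply: contrapT => no.
  have lt i : `|pos (u m - t *: u (val (i : 'I_J)))| < eps'.
    by rewrite ltNge; apply/negP => le; apply: no; exists i.
  have avg : pos (u m - (t / J%:R) *: e) <=b
             J%:R^-1 *: \sum_(i < J) pos (u m - t *: u i).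
    apply: pos_ble; last by rewrite bleZ0 ?invr_ge0 ?ler0n // sum_ble0.
    apply: (@ble_tr _ _ (J%:R^-1 *: \sum_(i < J) (u m - t *: u i))).
      have -> : \sum_(i < J) (u m - t *: u i) = J%:R *: u m - t *: \sum_(i < J) u i.
        by rewrite sumrB sumr_const card_ord scaler_nat scaler_sumr.
      rewrite scalerBr scalerA mulVf ?gt_eqF // scale1r scalerA [_^-1 * t]mulrC.
      rewrite ble_sub (_ : _ - _ = (t / J%:R) *: (e - \sum_(i < J) u i)).
        by rewrite bleZ0 ?divr_ge0 ?ler0n // -ble_sub ue.
      vlin.
    by rewrite bleZ ?invr_ge0 ?ler0n // ble_sum.
  have := norm_ble0 (pos_ge0 _) avg; apply/negP; rewrite -ltNge.
  rewrite normrZ ger0_norm ?invr_ge0 ?ler0n //.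
  have sumlt : `|\sum_(i < J) pos (u m - t *: u i)| <= J%:R * eps'.
    apply: le_trans (ler_norm_sum _ _ _) _.
    have -> : J%:R * eps' = \sum_(i < J) eps' by rewrite sumr_const card_ord mulr_natl.
    by apply: ler_sum => i _; exact/ltW/lt.
  apply: (@le_lt_trans _ _ eps'); first by rewrite ler_pdivrMl.
  apply: lt_le_trans (norm_pos_sub (u0 m) _); last first.
    by rewrite bleZ0 ?divr_ge0 ?ler0n.
  rewrite normrZ ger0_norm ?divr_ge0 ?ler0n //.
  move: HJ; rewrite ltr_pdivrMr ?subr_gt0 // => HJ.
  have : t / J%:R * `|e| < eps - eps'.
    by rewrite mulrAC ltr_pdivrMr // [ltRHS]mulrC.
  by have := ueps m; lra.
have [i often] : exists i, forall N, exists2 m, (N <= m)%N &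
    eps' <= `|pos (u m - t *: u i)|.
  apply: contrapT => /forallNP no.
  have /choice[N HN] i : exists N, forall m, (N <= m)%N ->
      ~ eps' <= `|pos (u m - t *: u i)|.
    by have /existsNP[N HN] := no i; exists N => m Nm le; apply: HN; exists m.
  have [i _] := some (\max_(i < J) N i)%N; apply: HN.
  exact: (leq_bigmax (F := fun i : 'I_J => N i)).
have [phi phi_inc phiP] := infinitely_often often.
exists i, (fun k => pos (u (phi k) - t *: u i)); split; last by move=> k; exists (phi k).
split=> // n; apply: ble_tr (ue (phi n)).
elim: n => [|n IH]; first by rewrite big_ord0 sum_ble0.
rewrite big_ord_recr /=; apply: (@ble_tr _ _ (\sum_(k < (phi n).+1) u k)).
  by rewrite big_ord_recr bleD //= pos_sub_le // bleZ0.
exact: sum_ord_mono.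
Qed.

(** Iterating the extraction with one fixed [t] produces [w_0, w_1, ...] in [[0, e]]
    such that every later [w_l] lies below [(e - t w_k)^+].  Hence the elements
    [(w_k - e / t)^+] are disjoint, and they keep half of the norm when [t] is large,
    against [no_bounded_disjoint]. *)
Lemma no_summable_below e (eps : R) (u : nat -> X) : 0 < eps -> ~ summable_below e eps u.
Proof.
move=> eps0 us; have e0 : 0 <=b e.
  by apply: ble_tr (summable_below_le us 0%N); have [] := us.
(* With this [t] the norm of [t^-1 *: e] is below [eps / 4]. *)
pose t := 4 * (`|e| + 1) / eps.
have t0 : 0 < t by rewrite divr_gt0 ?mulr_gt0 ?ltr_wpDl.
(* Each extraction loses a little of the norm; [E] decreases from [eps] and stays
   above [eps / 2]. *)
pose E k := eps / 2 * (1 + 2^-1 ^+ k).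
have E_pos k : eps / 2 <= E k.
  rewrite /E ler_peMr ?divr_ge0 ?ltW // ltrDl exprn_gt0 ?invr_gt0 //.
have E_lt k : E k.+1 < E k.
  rewrite /E ltr_pM2l ?divr_gt0 // ltrD2l exprS gtr_pMl ?exprn_gt0 ?invr_gt0 //.
  by rewrite invf_lt1 // ltr1n.
have /choice[F HF] (ku : nat * (nat -> X)) : exists F : nat * (nat -> X),
    summable_below e (E ku.1) ku.2 ->
    summable_below e (E ku.1.+1) F.2 /\
    forall k, exists m, F.2 k = pos (ku.2 m - t *: ku.2 F.1).
  case: ku => k v /=.
  have [vs|nvs] := pselect (summable_below e (E k) v); last by exists (0%N, v).
  have Ek0 : 0 <= E k.+1 by apply: le_trans (E_pos _); rewrite divr_ge0 ?ltW.
  have [i [v' [v's v'E]]] := summable_below_step (ltW t0) (E_lt k) Ek0 vs.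
  by exists (i, v').
pose U := fix U k := if k is k'.+1 then (F (k', U k')).2 else u.
pose w k := U k (F (k, U k)).1.
have Us k : summable_below e (E k) (U k).
  elim: k => [|k IH]; last exact: (HF (k, U k) IH).1.
  by rewrite /E expr0 (_ : eps / 2 * (1 + 1) = eps) //; field.
have Ue k j : U k j <=b e := summable_below_le (Us k) j.
have U0 k j : 0 <=b U k j by have [] := Us k.
have Uw k l j : U (k + l.+1)%N j <=b pos (e - t *: w k).
  elim: l j => [|l IH] j.
    rewrite addn1 /=; have [m ->] := (HF (k, U k) (Us k)).2 j.
    by rewrite pos_mono // bleD2r Ue.
  rewrite addnS /=; have [m ->] := (HF (_, U (k + l.+1)%N) (Us _)).2 j.
  by apply: ble_tr (IH m); apply: pos_sub_le; rewrite /= ?bleZ0 ?U0 // ltW.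
apply: (@no_bounded_disjoint e (fun k => pos (w k - t^-1 *: e)) (eps / 4)).
- by rewrite divr_gt0.
- by [].
- move=> k; apply: ble_tr (Ue k _); apply: pos_sub_le; rewrite ?bleZ0 ?invr_ge0 1?ltW //.
  exact: U0.
- move=> k; have wk : eps / 2 <= `|w k|.
    by have [_ _ /(_ (F (k, U k)).1)] := Us k; apply: le_trans.
  have te : t^-1 * `|e| <= eps / 4.
    rewrite ler_pdivrMl // /t (_ : _ / eps * _ = `|e| + 1); first by rewrite lerDl.
    by field; rewrite gt_eqF.
  have te0 : 0 <=b t^-1 *: e by rewrite bleZ0 // invr_ge0 ltW.
  have := norm_pos_sub (U0 k _ : 0 <=b w k) te0.
  by rewrite /= normrZ ger0_norm ?invr_ge0 ?(ltW t0) //; lra.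
- move=> k l kl.
  apply: (@disj_le _ _ (t^-1 *: pos (t *: w k - e)) (pos (e - t *: w k))) => //.
  + rewrite -posZ ?invr_ge0 1?ltW // scalerBr scalerA mulVf ?gt_eqF // scale1r //.
  + apply: (@ble_tr _ _ (w l)); last first.
      by have := Uw k (l - k.+1)%N; rewrite addnS -addSn subnKC //; apply.
    by apply: pos_sub_le; rewrite ?bleZ0 ?invr_ge0 1?ltW //; exact: U0.
  + rewrite -(scale1r (pos (e - _))) disj_scale ?invr_ge0 1?ltW //.
    by rewrite -[e - _]opprB pos_disjoint.
Qed.

(** If the sequence were not Cauchy, its increments along a subsequence would be
    summable below [e] with norms bounded away from zero. *)
Theorem increasing_cvg (x : nat -> X) e : (forall n, x n <=b x n.+1) ->
  (forall n, x n <=b e) -> exists l : X, x @ \oo --> l.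
Proof.
move=> x_inc xe; apply: cauchy_eps_cvg => eps eps0; apply: contrapT => /forallNP no.
have /choice[f Hf] N : exists n, (N <= n)%N /\ eps <= `|x n - x N|.
  have /existsNP[n /not_implyP[Nn /negP]] := no N.
  by rewrite -leNgt => le; exists n.
pose n := fix n k := if k is k'.+1 then f (n k') else 0%N.
apply: (@no_summable_below (e - x 0%N) eps (fun k => x (n k.+1) - x (n k))) => //.
split=> [k|K|k]; last exact: (Hf _).2.
  by rewrite -ble_sub; apply: bseq_mono => //; exact: (Hf _).1.
rewrite (_ : \sum_(k < K) _ = x (n K) - x 0%N) ?bleD2r //.
elim: K => [|K IH]; first by rewrite big_ord0 subrr.
by rewrite big_ord_recr /= IH; vlin.
Qed.

End OrderContinuity.

Section PowerFacts.
Context {R : realType}.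
Implicit Types a b r : R.

Lemma powR_le r a b : 0 <= r -> 0 <= a -> a <= b -> a `^ r <= b `^ r.
Proof.
by move=> r0 a0 ab; apply: ge0_ler_powR; rewrite ?nnegrE // (le_trans a0).
Qed.

Lemma powR_le_inv r a b : 0 < r -> 0 <= b -> a `^ r <= b `^ r -> a <= b.
Proof.
move=> r0 b0; apply: contraTT; rewrite -!ltNge => ba.
by apply: gt0_ltr_powR; rewrite ?nnegrE // (le_trans b0) // ltW.
Qed.

Lemma powRK r a : r != 0 -> 0 <= a -> (a `^ r) `^ r^-1 = a.
Proof. by move=> r0 a0; rewrite -powRrM mulfV // powRr1. Qed.

Lemma powRVK r a : r != 0 -> 0 <= a -> (a `^ r^-1) `^ r = a.
Proof. by move=> r0 a0; rewrite -powRrM mulVf // powRr1. Qed.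

(** The tangent line of [t |-> t ^ p] at [a], obtained from Young's inequality. *)
Lemma powR_tangent p a b : 1 < p -> 0 <= a -> 0 <= b ->
  p * (b * a `^ (p - 1)) <= b `^ p + (p - 1) * a `^ p.
Proof.
move=> p1 a0 b0; have p0 : 0 < p by apply: lt_trans p1.
have p10 : 0 < p - 1 by rewrite subr_gt0.
have q0 : 0 < p / (p - 1) by rewrite divr_gt0.
have := conjugate_powR b0 (powR_ge0 a (p - 1)) p0 q0.
rewrite -powRrM (mulrC (p - 1)) divfK ?gt_eqF // => H.
have /H {}H : p^-1 + (p / (p - 1))^-1 = 1 by field; rewrite !gt_eqF.
have := ler_wpM2l (ltW p0) H; congr (_ <= _).
by field; rewrite !gt_eqF.
Qed.

(** If [b^(1/p)] exceeds [beta], then [b] exceeds it by the factor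
    [(b^(1/p) / beta)^(p-1)].  With [beta] small this bounds the root of a step
    element by a small multiple of the unit plus a multiple of the element. *)
Lemma powR_root_le p (beta : R) b : 1 < p -> 0 < beta -> 0 <= b ->
  b `^ p^-1 <= beta + beta `^ (1 - p) * b.
Proof.
move=> p1 beta0 b0; have p0 : 0 < p by apply: lt_trans p1.
set c := b `^ p^-1; have c0 : 0 <= c := powR_ge0 _ _.
have -> : b = c `^ p by rewrite powRVK ?gt_eqF.
have [cb|bc] := leP c beta; first by rewrite ler_wpDr // mulr_ge0 ?powR_ge0.
have cp : 0 < c by apply: lt_trans bc.
have -> : c `^ p = c `^ (p - 1) * c.
  by rewrite -[in RHS](powRr1 c0) -powRrM mul1r -powRD ?subrK // gt_eqF ?implybT.
rewrite mulrA ler_wpDl ?(ltW beta0) // ler_peMl // -opprB powRN.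
by rewrite ler_pdivlMl ?powR_gt0 // mulr1 powR_le ?subr_ge0 ?ltW.
Qed.

End PowerFacts.

Section Components.
Context {R : realType} {X : banachLatticeType R}.
Implicit Types x y z w a b c e g : X.

Definition order_continuous_norm : Prop := forall (x : nat -> X) e,
  (forall n, x n <=b x n.+1) -> (forall n, x n <=b e) ->
  exists l : X, x @ \oo --> l.

(** When [e] is the constant function one, components are indicator functions. *)
Definition component e g : Prop := g /\b (e - g) = 0.

Lemma component_ge0 e g : component e g -> 0 <=b g.
Proof. by move=> <-; exact: bmeetl. Qed.

Lemma component_le e g : component e g -> g <=b e.
Proof. by move=> eg; rewrite ble_sub -eg bmeetr. Qed.

Definition partition e (I : finType) (d : I -> X) : Prop :=
  disj_family d /\ \sum_i d i = e.

Lemma partition_component e (I : finType) (d : I -> X) i :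
  partition e d -> component e (d i).
Proof.
move=> [[d0 dd] <-]; rewrite /component (bigD1 i) //= addrC addrK bmeetC.
by apply: disj_suml => // j /eqP ji; rewrite dd.
Qed.

Lemma component_partition e g : component e g ->
  partition e (fun b : bool => if b then g else e - g).
Proof.
move=> eg; split; last by rewrite big_bool /= addrC subrK.
split=> [[]|[] []] //=; rewrite ?(component_ge0 eg) //.
  by rewrite -ble_sub (component_le eg).
by rewrite bmeetC.
Qed.

(** Meeting [d i] with the sum [e] of the disjoint family [g] splits it. *)
Lemma partition_refine e (I J : finType) (d : I -> X) (g : J -> X) :
  partition e d -> partition e g ->
  [/\ partition e (fun ij : I * J => d ij.1 /\b g ij.2),
      forall i, d i = \sum_j (d i /\b g j) & forall j, g j = \sum_i (d i /\b g j)].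
Proof.
move=> ed eg; have [[d0 dd] de] := ed; have [[g0 gg] ge] := eg.
have dE i : d i = \sum_j (d i /\b g j).
  rewrite -bmeet_sumr // ge bmeet_l //.
  exact/component_le/(partition_component i ed).
have gE j : g j = \sum_i (d i /\b g j).
  under eq_bigr do rewrite bmeetC; rewrite -bmeet_sumr // de bmeet_l //.
  exact/component_le/(partition_component j eg).
split=> //; split; last first.
  by rewrite -(pair_bigA _ (fun i j => d i /\b g j)) /= -de; apply: eq_bigr.
split=> [ij|[i j] [i' j'] /= ne]; first exact: bmeet_ge0.
have [ii|/eqP ii] := eqVneq i i'.
  apply: disj_le (gg j j' _); rewrite ?bmeet_ge0 ?bmeetr // => jj.
  by apply: ne; rewrite ii jj.
by apply: disj_le (dd i i' ii); rewrite ?bmeet_ge0 ?bmeetl.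
Qed.

(** The truncations [e /\ k v] increase to a limit [g], the indicator of the set
    where [v > 0].  Doubling [k] does not change the limit, so [e /\ 2 g = g], which
    says that [g] is a component. *)
Lemma band_component (oc : order_continuous_norm) e v : 0 <=b e -> 0 <=b v ->
  exists g, [/\ component e g, forall k : R, 0 <= k -> e /\b (k *: v) <=b g,
    forall w, (forall k : nat, e /\b (k%:R *: v) <=b w) -> g <=b w
    & forall w, 0 <=b w -> v /\b w = 0 -> g /\b w = 0].
Proof.
move=> e0 v0; pose f (k : nat) := e /\b (k%:R *: v).
have fmono k : f k <=b f k.+1 by rewrite bmeet_mono // bleZl // ler_nat.
have fe k : f k <=b e := bmeetl _ _.
have [g fg] := oc f e fmono fe.
have f_le k : f k <=b g.
  apply: (@cvg_bge_cst _ _ (fun n => f (n + k)%N)); first by rewrite cvg_shiftn.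
  by move=> n; apply: bseq_mono => //; exact: leq_addl.
have g0 : 0 <=b g by apply: ble_tr (f_le 0%N); rewrite bmeet_ge0 // bleZ0.
have ge : g <=b e by exact: cvg_ble_cst fg fe.
exists g; split=> [|k k0|w fw|w w0 vw].
- suff e2g : e /\b (2 *: g) = g.
    rewrite /component; have := bmeetD e (2 *: g) (- g).
    by rewrite e2g subrr (_ : 2 *: g - g = g) 1?bmeetC //; vlin.
  apply: ble_eq; last by rewrite bmeet_ble ge -{1}(scale1r g) bleZl // ler1n.
  have : (fun n => e /\b (2 *: f n)) @ \oo --> e /\b (2 *: g).
    by apply: cvg_bmeet; exact: cvgZr.
  move/cvg_ble_cst; apply=> n; rewrite /f bmeetZ // scalerA -natrM.
  apply: ble_tr (f_le (2 * n)%N); apply: bmeet_mono => //; exact: bmeetr.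
- have [n kn] := nat_above k; apply: ble_tr (f_le n).
  by rewrite bmeet_mono // bleZl // ltW.
- exact: cvg_ble_cst fg fw.
- have : (fun n => w /\b f n) @ \oo --> w /\b g by exact: cvg_bmeet.
  rewrite bmeetC => /cvg_ble_cst H; apply: ble_eq; last exact: bmeet_ge0.
  apply: H => n; rewrite /f bmeetC.
  rewrite (@disj_le _ _ (n%:R *: v) w) // ?bmeet_ge0 ?bleZ0 ?ler0n ?bmeetr //.
  by rewrite -[w]scale1r disj_scale.
Qed.

(** ** Step elements and their powers *)

Definition step e s : Prop := exists (I : finType) (d : I -> X) (b : I -> R),
  [/\ partition e d, forall i, 0 <= b i & s = \sum_i b i *: d i].

Lemma step_ge0 e s : step e s -> 0 <=b s.
Proof.
by move=> [I [d [b [[[d0 _] _] b0 ->]]]]; apply: sum_ble0 => i _; rewrite bleZ0.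
Qed.

Lemma step_component e g : component e g -> step e g.
Proof.
move=> eg; exists bool, (fun b : bool => if b then g else e - g), (fun b : bool => b%:R).
split; [exact: component_partition|by move=> b; rewrite ler0n|].
by rewrite big_bool /= scale1r scale0r addr0.
Qed.

Lemma stepD e s t : step e s -> step e t -> step e (s + t).
Proof.
move=> [I [d [b [ed b0 ->]]]] [J [g [c [eg c0 ->]]]].
have [edg dE gE] := partition_refine ed eg.
exists (I * J)%type, (fun ij => d ij.1 /\b g ij.2), (fun ij => b ij.1 + c ij.2).
split=> // [ij|]; first by rewrite addr_ge0.
under [RHS]eq_bigr do rewrite scalerDl.
rewrite big_split /= -(pair_bigA _ (fun i j => b i *: (d i /\b g j))).
rewrite -(pair_bigA _ (fun i j => c j *: (d i /\b g j))) /= [X in _ = _ + X]exchange_big /=.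
congr (_ + _); apply: eq_bigr => i _; rewrite -scaler_sumr; first by rewrite -dE.
by rewrite -gE.
Qed.

Lemma stepZ e (k : R) s : 0 <= k -> step e s -> step e (k *: s).
Proof.
move=> k0 [I [d [b [ed b0 ->]]]]; exists I, d, (fun i => k * b i).
split=> // [i|]; first by rewrite mulr_ge0.
by rewrite scaler_sumr; apply: eq_bigr => i _; rewrite scalerA.
Qed.

Lemma step0 e : 0 <=b e -> step e 0.
Proof.
by move=> e0; apply: step_component; rewrite /component subr0 bmeet_l.
Qed.

Lemma step_unit e : 0 <=b e -> step e e.
Proof.
by move=> e0; apply: step_component; rewrite /component subrr bmeet_r.
Qed.

Lemma step_sum e (J : Type) (r : seq J) (s : J -> X) : 0 <=b e ->
  (forall j, step e (s j)) -> step e (\sum_(j <- r) s j).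
Proof.
by move=> e0 es; elim/big_ind : _ => [|x y|j _]; [exact: step0|exact: stepD|].
Qed.

Lemma step_bounded e s : step e s -> exists2 C : R, 0 <= C & s <=b C *: e.
Proof.
move=> [I [d [b [[[d0 _] <-] b0 ->]]]].
exists (\sum_i b i); first exact: sumr_ge0.
rewrite scaler_sumr; apply: ble_sum => i _; apply: bleZl => //.
by rewrite (bigD1 i) //= lerDl sumr_ge0.
Qed.

(** The left side lives where [z > 0], and there [z + eta e] is at least [eta e]. *)
Lemma layer_le e z (eta k : R) : 0 <=b e -> 0 < eta -> 0 <= k ->
  eta *: (e /\b (k *: pos z)) <=b pos (z + eta *: e).
Proof.
move=> e0 eta0 k0; set w := e /\b _.
have w0 : 0 <=b w by rewrite bmeet_ge0 // bleZ0.
have wz : w /\b pos (- z) = 0.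
  apply: (@disj_le _ _ (k *: pos z) (pos (- z))); rewrite ?bmeetr //.
  by rewrite -[pos (- z)]scale1r disj_scale // pos_disjoint.
apply: (@ble_disj _ _ _ (pos (- z))); rewrite ?bleZ0 ?(ltW eta0) //.
  by rewrite -[pos (- z)]scale1r disj_scale ?(ltW eta0).
apply: (@ble_tr _ _ (eta *: e)); first by rewrite bleZ ?(ltW eta0) // bmeetl.
rewrite -[X in X <=b _](_ : (z + eta *: e) + (- z) = eta *: e); last by vlin.
by rewrite bleD.
Qed.

(** Freudenthal approximation: with [g_i] the component where [x > i eta e], the
    layer-cake sum [eta (g_1 + ... + g_n)] approximates [x] from below. *)
Lemma step_approx (oc : order_continuous_norm) e x (C eta : R) :
  0 <=b e -> 0 <=b x -> 0 < eta ->
  exists s, [/\ step e s, s <=b x & x /\b (C *: e) <=b s + eta *: e].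
Proof.
move=> e0 x0 eta0; pose v (i : nat) := pos (x - (i%:R * eta) *: e).
have v0 : v 0%N = x by rewrite /v mul0r scale0r subr0 pos_id.
have /choice[g Hg] i := band_component oc e0 (pos_ge0 (x - (i%:R * eta) *: e)).
pose u := eta *: e; have u0 : 0 <=b u by rewrite bleZ0 // ltW.
have vS i : v i.+1 = pos (v i - u).
  rewrite /v pos_posD //; congr pos; rewrite /u -natr1; vlin.
have v_g i : v i /\b u <=b eta *: g i.
  have [_ /(_ eta^-1) + _ _] := Hg i; rewrite invr_ge0 ltW // => /(_ isT).
  move=> /(bleZ (ltW eta0)); rewrite bmeetZ ?ltW // scalerA mulfV ?gt_eqF //.
  by rewrite scale1r bmeetC.
have g_v i : eta *: g i.+1 <=b v i /\b u.
  have [eg _ gl _] := Hg i.+1; rewrite bmeet_ble; apply/andP; split; last first.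
    by rewrite bleZ ?ltW // (component_le eg).
  suff : g i.+1 <=b eta^-1 *: v i.
    by move=> /(bleZ (ltW eta0)); rewrite scalerA mulfV ?gt_eqF // scale1r.
  apply: gl => k; have := layer_le (x - (i.+1%:R * eta) *: e) e0 eta0 (ler0n _ k).
  rewrite (_ : x - _ + _ = x - (i%:R * eta) *: e); last by rewrite -natr1; vlin.
  by move=> /bleZ H; have := H eta^-1; rewrite scalerA mulVf ?gt_eqF // scale1r; apply; rewrite invr_ge0 ltW.
have vsum n : x - v n = \sum_(i < n) (v i /\b u).
  elim: n => [|n IH]; first by rewrite v0 subrr big_ord0.
  by rewrite big_ord_recr /= -IH vS pos_meet; vlin.
have [n Cn] := nat_above (C / eta).
exists (eta *: \sum_(i < n) g i.+1); split.
- apply: stepZ (ltW eta0) _; apply: step_sum => // i.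
  by have [/step_component] := Hg i.+1.
- rewrite scaler_sumr; apply: (@ble_tr _ _ (\sum_(i < n) (v i /\b u))).
    by apply: ble_sum => i _; exact: g_v.
  by rewrite -vsum -bleDl ble_addl // pos_ge0.
- apply: (@ble_tr _ _ (\sum_(i < n.+1) (v i /\b u))).
    rewrite -vsum bmeetE ble_sub.
    rewrite (_ : _ - _ = pos (x - C *: e) - v n.+1); last by vlin.
    rewrite -ble_sub; apply: pos_mono; rewrite ble_sub.
    rewrite (_ : _ - _ = (n.+1%:R * eta - C) *: e); last by vlin.
    rewrite bleZ0 // subr_ge0 -ler_pdivrMr // (le_trans (ltW Cn)) // ler_nat.
    exact: leqnSn.
  rewrite big_ord_recl addrC scaler_sumr bleD ?bmeetr //.
  by apply: ble_sum => i _; exact: v_g.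
Qed.

Variable p : R.
Hypothesis p_gt1 : 1 < p.
Let p_gt0 : 0 < p. Proof. exact: lt_trans p_gt1. Qed.
Let p_neq0 : p != 0. Proof. by rewrite gt_eqF. Qed.

(** [step_power e y z] says that [z] is the p-th power of the step element [y],
    computed with [e] as the constant function one. *)
Definition step_power e y z : Prop := exists (I : finType) (d : I -> X) (b : I -> R),
  [/\ partition e d, forall i, 0 <= b i, y = \sum_i b i *: d i
    & z = \sum_i (b i `^ p) *: d i].

Lemma step_power_step e y z : step_power e y z -> step e y /\ step e z.
Proof.
move=> [I [d [b [ed b0 yE zE]]]]; split; first by exists I, d, b.
by exists I, d, (fun i => b i `^ p); split=> // i; exact: powR_ge0.
Qed.

Lemma step_has_power e y : step e y -> exists z, step_power e y z.
Proof.
move=> [I [d [b [ed b0 yE]]]]; exists (\sum_i (b i `^ p) *: d i).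
by exists I, d, b.
Qed.

Lemma step_power_component e g (k : R) : component e g -> 0 <= k ->
  step_power e (k *: g) (k `^ p *: g).
Proof.
move=> eg k0; exists bool, (fun b : bool => if b then g else e - g).
exists (fun b : bool => if b then k else 0); split.
- exact: component_partition.
- by case.
- by rewrite big_bool /= scale0r addr0.
- by rewrite big_bool /= powR0 // scale0r addr0.
Qed.

Lemma step_powerZ e y z (k : R) : 0 <= k -> step_power e y z ->
  step_power e (k *: y) (k `^ p *: z).
Proof.
move=> k0 [I [d [b [ed b0 -> ->]]]]; exists I, d, (fun i => k * b i).
split=> // [i||]; first by rewrite mulr_ge0.
  by rewrite scaler_sumr; apply: eq_bigr => i _; rewrite scalerA.
by rewrite scaler_sumr; apply: eq_bigr => i _; rewrite scalerA powRM.
Qed.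

(** Refining one partition at a time gives a partition on which all the elements
    have constant coefficients, so identities between powers become identities
    between coefficients. *)
Lemma step_power_common e (J : finType) (y z : J -> X) : 0 <=b e ->
  (forall j, step_power e (y j) (z j)) ->
  exists (I : finType) (d : I -> X) (B : J -> I -> R),
  [/\ partition e d, forall j i, 0 <= B j i,
      forall j, y j = \sum_i B j i *: d i
    & forall j, z j = \sum_i (B j i `^ p) *: d i].
Proof.
move=> e0 yz.
suff H (r : seq J) : exists (I : finType) (d : I -> X) (B : J -> I -> R),
    partition e d /\ forall j, j \in r -> [/\ forall i, 0 <= B j i,
      y j = \sum_i B j i *: d i & z j = \sum_i (B j i `^ p) *: d i].
  have [I [d [B [ed HB]]]] := H (enum J).
  by exists I, d, B; split=> // j; have [] := HB j (mem_enum _ j).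
elim: r => [|k r [I [d [B [ed HB]]]]].
  exists unit, (fun=> e), (fun _ _ => 0); split=> //; split; last by rewrite big_const card_unit /= addr0.
  by split=> // -[] [].
have [J' [g [c [eg c0 ykE zkE]]]] := yz k.
have [edg dE gE] := partition_refine ed eg.
exists (I * J')%type, (fun ij => d ij.1 /\b g ij.2).
exists (fun j ij => if j == k then c ij.2 else B j ij.1); split=> // j.
have sumI (f : I -> R) : \sum_i f i *: d i =
    \sum_(ij : I * J') f ij.1 *: (d ij.1 /\b g ij.2).
  rewrite -(pair_bigA _ (fun i j => f i *: (d i /\b g j))) /=.
  by apply: eq_bigr => i _; rewrite -scaler_sumr -dE.
have sumJ (f : J' -> R) : \sum_i f i *: g i =
    \sum_(ij : I * J') f ij.2 *: (d ij.1 /\b g ij.2).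
  rewrite -(pair_bigA _ (fun i j => f j *: (d i /\b g j))) /= exchange_big /=.
  by apply: eq_bigr => i _; rewrite -scaler_sumr -gE.
rewrite inE; have [->|jk] /= := eqVneq j k.
  by move=> _; split=> //; rewrite ?ykE ?zkE ?sumJ.
by move=> /HB[B0 yE zE]; split=> [ij||] //; rewrite ?yE ?zE ?sumI.
Qed.

Lemma step_power_le e k t y z : 0 <=b e -> step_power e k t -> step_power e y z ->
  t <=b z -> k <=b y.
Proof.
move=> e0 kt yz.
have [|I [d [B [[dd _] B0 yE zE]]]] := @step_power_common e bool
  (fun c : bool => if c then k else y) (fun c : bool => if c then t else z) e0.
  by case.
rewrite (zE true) (zE false) => /(step_coef_le dd) le.
rewrite (yE true) (yE false); apply: ble_sum => i _.
have [->|tz] := le i; first by rewrite !scaler0.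
by apply: bleZl; [exact: powR_le_inv p_gt0 _ tz|have [] := dd].
Qed.

(** On a common partition, wherever the member is nonzero one of the two
    coefficients vanishes. *)
Lemma step_powerD_disj e y z y' z' : 0 <=b e -> y /\b y' = 0 ->
  step_power e y z -> step_power e y' z' -> step_power e (y + y') (z + z').
Proof.
move=> e0 yy' yz yz'.
have [|I [d [B [ed B0 yE zE]]]] := @step_power_common e bool
  (fun c : bool => if c then y else y') (fun c : bool => if c then z else z') e0.
  by case.
have [dd _] := ed; move: yy'.
rewrite (yE true) (yE false) (zE true) (zE false) bmeet_step // => min0.
exists I, d, (fun i => B true i + B false i); split=> //.
- by move=> i; rewrite addr_ge0.
- by rewrite -big_split; apply: eq_bigr => i _; rewrite scalerDl.
rewrite -big_split; apply: eq_bigr => i _ /=; rewrite -scalerDl.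
have [|->|] := @step_coef_le _ _ _ d (fun i => Num.min (B true i) (B false i)) (fun=> 0) dd _ i; last 2 first.
- by rewrite !scaler0.
- rewrite ge_min => /orP[] H.
    have -> : B true i = 0 by apply/eqP; rewrite eq_le H B0.
    by rewrite powR0 // !add0r.
  have -> : B false i = 0 by apply/eqP; rewrite eq_le H B0.
  by rewrite powR0 // !addr0.
- by rewrite min0; apply: sum_ble0 => j _; rewrite scale0r.
Qed.

Lemma step_power_sum_disj e (J : finType) (y z : J -> X) : 0 <=b e ->
  disj_family y -> (forall j, step_power e (y j) (z j)) ->
  step_power e (\sum_j y j) (\sum_j z j).
Proof.
move=> e0 [y0 yd] yz.
suff H (r : seq J) : uniq r -> step_power e (\sum_(j <- r) y j) (\sum_(j <- r) z j).
  exact: H (index_enum_uniq _).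
elim: r => [_|j r IH /=].
  rewrite !big_nil; exists unit, (fun=> e), (fun=> 0); split=> //.
  - by split; [split=> // -[] []|rewrite big_const card_unit /= addr0].
  - by rewrite big1 // => i _; rewrite scale0r.
  - by rewrite big1 // => i _; rewrite powR0 // scale0r.
move=> /andP[jr ur]; rewrite !big_cons; apply: step_powerD_disj => //; last exact: IH.
rewrite bmeetC big_seq; apply: disj_suml => // i ir; apply: yd => ij.
by rewrite -ij ir in jr.
Qed.

(** A component of a component is a component, so powers computed below a
    component agree with powers computed below the whole unit. *)
Lemma step_power_sub e d y z : component e d ->
  step_power d y z -> step_power e y z.
Proof.
move=> ed [I [f [b [df b0 yE zE]]]]; have [[f0 fd] fE] := df.
have d0 := component_ge0 ed; have de := component_le ed.
exists (option I), (fun o => if o is Some i then f i else e - d).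
exists (fun o => if o is Some i then b i else 0).
have opt (F : option I -> X) : \sum_o F o = F None + \sum_i F (Some i).
  rewrite (bigD1 None) //=; congr (_ + _).
  rewrite (reindex_omap Some id) /=; last by case.
  by apply: eq_bigl => i; rewrite eqxx.
split; last 3 first.
- by case.
- by rewrite opt scale0r add0r.
- by rewrite opt powR0 // scale0r add0r.
split; last by rewrite opt fE subrK.
have fl i : f i /\b (e - d) = 0.
  apply: disj_le ed; rewrite // -?ble_sub //.
  by rewrite (component_le (partition_component i df)).
split=> [[i|]|[i|] [j|] ij] //; first by rewrite -ble_sub.
- by apply: fd => ij'; apply: ij; rewrite ij'.
- by rewrite bmeetC.
Qed.

(** ** Convexity for step elements *)

Variable M : R.
Hypothesis M_ge1 : 1 <= M.
Hypothesis M_convex : forall (n : nat) (x : 'I_n -> X) (z : X), is_lp_mean p x z ->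
  `|z| <= M * (\sum_(i < n) `|x i| `^ p) `^ p^-1.

(** On a disjoint family the lattice operations act on coefficients, so any
    function of the coefficients defines the functional calculus. *)
Lemma step_power_convex e (J : finType) (y z : J -> X) : 0 <=b e ->
  (forall j, step_power e (y j) (z j)) ->
  exists2 Y, step_power e Y (\sum_j z j)
    & `|Y| `^ p <= M `^ p * \sum_j `|y j| `^ p.
Proof.
move=> e0 yz; have [I [d [B [ed B0 yE zE]]]] := step_power_common e0 yz.
have [dd _] := ed.
have S0 i : 0 <= \sum_j B j i `^ p by apply: sumr_ge0 => j _; exact: powR_ge0.
pose Y := \sum_i ((\sum_j B j i `^ p) `^ p^-1) *: d i; exists Y.
  exists I, d, (fun i => (\sum_j B j i `^ p) `^ p^-1); split=> // [i|].
    exact: powR_ge0.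
  under eq_bigr do rewrite zE; rewrite exchange_big /=; apply: eq_bigr => i _.
  by rewrite -scaler_suml powRVK.
pose n := #|J|.
pose b (i : I) : 'rV[R]_n := \row_(j < n) B (enum_val j) i.
have sumE (V : nmodType) (F : J -> V) : \sum_j F j = \sum_(j < n) F (enum_val j).
  by rewrite -(big_enum_val F) /=; apply: eq_bigl.
have mean : is_lp_mean p (fun j : 'I_n => y (enum_val j)) Y.
  exists (fun f => \sum_i f (b i) *: d i).
    split=> [j|a f g _ _|f g _ _|f g _ _].
    - by rewrite yE; apply: eq_bigr => i _; rewrite mxE.
    - rewrite scaler_sumr -big_split; apply: eq_bigr => i _.
      by rewrite scalerDl scalerA.
    - by rewrite bjoin_step.
    - by rewrite bmeet_step.
  apply: eq_bigr => i _; congr (_ `^ _ *: _); rewrite sumE; apply: eq_bigr => j _.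
  by rewrite mxE ger0_norm.
have := M_convex mean; rewrite -(sumE R (fun j => `|y j| `^ p)) => YM.
have M0 : 0 <= M by apply: le_trans M_ge1.
have T0 : 0 <= \sum_j `|y j| `^ p by apply: sumr_ge0 => j _; exact: powR_ge0.
have := powR_le (ltW p_gt0) (normr_ge0 Y) YM.
by rewrite powRM ?powR_ge0 // powRVK.
Qed.

Lemma step_power_bound e (J : finType) (y z : J -> X) k t : 0 <=b e ->
  (forall j, step_power e (y j) (z j)) -> step_power e k t ->
  t <=b \sum_j z j -> `|k| `^ p <= M `^ p * \sum_j `|y j| `^ p.
Proof.
move=> e0 yz kt tz; have [Y Yz YM] := step_power_convex e0 yz.
apply: le_trans YM; apply: powR_le (ltW p_gt0) (normr_ge0 _) _.
apply: norm_ble0 (step_power_le e0 kt Yz tz).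
by have [/step_ge0] := step_power_step kt.
Qed.

End Components.

Section LinearForms.
Context {R : realType} {V : lmodType R}.
Implicit Types (f : V -> R) (x y : V).

Definition lin f : Prop := forall (a : R) x y, f (a *: x + y) = a * f x + f y.

Lemma linD f x y : lin f -> f (x + y) = f x + f y.
Proof. by move=> fl; rewrite -{1}[x]scale1r fl mul1r. Qed.

Lemma lin0 f : lin f -> f 0 = 0.
Proof. by move=> fl; have := linD 0 0 fl; rewrite addr0; lra. Qed.

Lemma linZ f (a : R) x : lin f -> f (a *: x) = a * f x.
Proof. by move=> fl; rewrite -[a *: x]addr0 fl lin0 // addr0. Qed.

Lemma linN f x : lin f -> f (- x) = - f x.
Proof. by move=> fl; rewrite -scaleN1r linZ // mulN1r. Qed.

Lemma linB f x y : lin f -> f (x - y) = f x - f y.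
Proof. by move=> fl; rewrite linD // linN. Qed.

Lemma lin_sum f (I : Type) (r : seq I) (P : pred I) (F : I -> V) : lin f ->
  f (\sum_(i <- r | P i) F i) = \sum_(i <- r | P i) f (F i).
Proof.
move=> fl; apply: (big_morph f _ (lin0 fl)) => x y; exact: linD.
Qed.

End LinearForms.

(** * Linear forms below a convex cone of constraints *)

Section Sandwich.
Context {R : realType} {V : lmodType R}.

(** A pair [(x, s)] in the cone stands for the constraint [f x <= s]. *)
Definition constraint_cone (C : set (V * R)) : Prop :=
  [/\ C (0, 0),
      forall x s y t, C (x, s) -> C (y, t) -> C (x + y, s + t)
    & forall (k : R) x s, 0 < k -> C (x, s) -> C (k *: x, k * s)].

Definition consistent (C : set (V * R)) : Prop := forall s, C (0, s) -> 0 <= s.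

(** A constraint [(y, s)] outside a maximal consistent cone cannot be adjoined, so
    some member of the cone contradicts it: up to scaling, [(- y, s')] with
    [s' < - s]. *)
Lemma maximal_cone (C0 : set (V * R)) : constraint_cone C0 -> consistent C0 ->
  exists C, [/\ C0 `<=` C, constraint_cone C, consistent C
    & forall y s, ~ C (y, s) -> exists2 s', s' < - s & C (- y, s')].
Proof.
move=> cone0 cons0.
pose P (A : set (V * R)) := constraint_cone (A `|` C0) /\ consistent (A `|` C0).
have [|A [[coneA consA] maxA]] := @Zorn_bigcup _ P.
  move=> F FP Ftot; have [z0 add0 scale0] := cone0.
  split; last first.
    by move=> s [[B FB Bs]|/cons0//]; apply: (FP _ FB).2; left.
  split; first by right.
    move=> x s y t [[B FB Bx]|Cx] [[B' FB' By]|Cy].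
    - have [BB|BB] := Ftot _ _ FB FB'.
        have [_ add _] := (FP _ FB').1.
        have [//||H|H] := add x s y t; [by left; exact: BB|by left| |by right].
        by left; exists B'.
      have [_ add _] := (FP _ FB).1.
      have [//||H|H] := add x s y t; [by left|by left; exact: BB| |by right].
      by left; exists B.
    - have [_ add _] := (FP _ FB).1.
      have [//||H|H] := add x s y t; [by left|by right| |by right].
      by left; exists B.
    - have [_ add _] := (FP _ FB').1.
      have [//||H|H] := add x s y t; [by right|by left| |by right].
      by left; exists B'.
    - by right; exact: add0.
  move=> k x s k0 [[B FB Bx]|Cx]; last by right; exact: scale0.
  have [_ _ scale] := (FP _ FB).1.
  by have [|H|H] := scale k x s k0; [by left|left; exists B|right].
pose C := A `|` C0; exists C; split=> // [x C0x|y s nC]; first by right.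
have [C00 addC scaleC] := coneA.
pose B : set (V * R) := [set w | exists x g t, [/\ C (x, g), 0 <= t,
  w.1 = x + t *: y & w.2 = g + t * s]].
have CB : C `<=` B.
  by move=> [x g] Cx; exists x, g, 0; split=> //=; rewrite ?scale0r ?mul0r addr0.
have BE : B `|` C0 = B.
  apply/seteqP; split=> [w [//|C0w]|w]; last by left.
  by apply: CB; right.
have coneB : constraint_cone B.
  split; first exact: CB.
    move=> _ _ _ _ [x [g [t [Cx t0 /= -> ->]]]] [x' [g' [t' [Cx' t0' /= -> ->]]]].
    exists (x + x'), (g + g'), (t + t'); split=> /=; [exact: addC|exact: addr_ge0| |].
      by vlin.
    by ring.
  move=> k _ _ k0 [x [g [t [Cx t0 /= -> ->]]]].
  exists (k *: x), (k * g), (k * t); split=> /=; first exact: scaleC.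
  - by rewrite mulr_ge0 // ltW.
  - by vlin.
  - by ring.
apply: contrapT => no; apply: (maxA B).
  split; first by move=> w Aw; apply: CB; left.
  move=> BA; apply: nC; left; apply: BA.
  by exists 0, 0, 1; split=> //=; rewrite ?add0r ?scale1r ?mul1r.
rewrite /P BE; split=> // _ [x [g [t [Cx t0 /= x0 ->]]]].
rewrite leNgt; apply/negP => neg.
have t_gt0 : 0 < t.
  rewrite lt_def t0 andbT; apply/eqP => t00; move: Cx neg.
  have -> : x = 0 by rewrite x0 t00 scale0r addr0.
  by move=> /consA g0; rewrite t00; lra.
apply: no; exists (t^-1 * g).
  by rewrite -ltrN2 opprK; rewrite -ltrN2 opprK ltr_pdivrMl //; lra.
have -> : - y = t^-1 *: x.
  have -> : x = - (t *: y) by apply/eqP; rewrite -addr_eq0 -x0.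
  by rewrite scalerN scalerA mulVf ?gt_eqF // scale1r.
by apply: scaleC => //; rewrite invr_gt0.
Qed.

(** In a maximal consistent cone each constraint or a strict form of its negation
    is present.  So the infimum of the admissible bounds, which is subadditive on
    any cone, takes opposite values at opposite vectors and is linear. *)
Theorem cone_linear_form (C0 : set (V * R)) : constraint_cone C0 ->
  consistent C0 -> (forall x, exists s, C0 (x, s)) ->
  exists2 f : V -> R, lin f & forall x s, C0 (x, s) -> f x <= s.
Proof.
move=> cone0 cons0 tot0.
have [C [C0C [C00 addC scaleC] consC maxC]] := maximal_cone cone0 cons0.
have tot x : exists s, C (x, s) by have [s /C0C] := tot0 x; exists s.
pose f x := inf [set s | C (x, s)].
have lb x : has_lbound [set s | C (x, s)].
  have [s Cs] := tot (- x); exists (- s) => t /= Ct.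
  by have := consC (t + s); rewrite -{1}(subrr x) => /(_ (addC _ _ _ _ Ct Cs)); lra.
have f_le x s : C (x, s) -> f x <= s by move=> Cs; apply: ge_inf.
have le_f x m : (forall s, C (x, s) -> m <= s) -> m <= f x.
  move=> H; apply: lb_le_inf => [|s Cs]; last exact: H.
  by have [s Cs] := tot x; exists s.
have fD x y : f (x + y) <= f x + f y.
  rewrite -lerBlDr; apply: (le_f) => s Cs; rewrite lerBlDr -lerBlDl.
  by apply: (le_f) => t Ct; rewrite lerBlDl; apply: (f_le); exact: addC.
have f0 : 0 <= f 0 by apply: (le_f) => s /consC.
have fN y : f (- y) = - f y.
  apply/eqP; rewrite eq_le; apply/andP; split; last first.
    by have := fD y (- y); rewrite subrr; lra.
  rewrite leNgt; apply/negP => lt; pose s := (f y - f (- y)) / 2.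
  have [s' s's Cs'] : exists2 s', s' < - s & C (- y, s').
    by apply: maxC => /f_le; rewrite /s; lra.
  by have := f_le _ _ Cs'; move: s's lt; rewrite /s; lra.
have fDE x y : f (x + y) = f x + f y.
  apply/eqP; rewrite eq_le fD /=.
  by have := fD (x + y) (- y); rewrite addrK fN; lra.
have f00 : f 0 = 0 by have := fDE 0 0; rewrite addr0; lra.
have fZ_le k x : 0 < k -> f (k *: x) <= k * f x.
  move=> k0; rewrite -ler_pdivrMl //; apply: (le_f) => s Cs.
  by rewrite ler_pdivrMl //; apply: (f_le); exact: scaleC.
have fZ k x : 0 < k -> f (k *: x) = k * f x.
  move=> k0; apply/eqP; rewrite eq_le fZ_le //= -ler_pdivlMl //.
  have := fZ_le k^-1 (k *: x); rewrite scalerA mulVf ?gt_eqF // scale1r.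
  by apply; rewrite invr_gt0.
exists f => [a x y|x s /C0C/f_le//]; rewrite fDE; congr (_ + _).
have [a0|a0|->] := ltgtP a 0; last by rewrite scale0r mul0r.
  by rewrite -[a in LHS]opprK scaleNr fN fZ ?oppr_gt0 // mulNr opprK.
exact: fZ.
Qed.

End Sandwich.

(** * Positive functionals on the p-concavification *)

Section PowerFunctionals.
Context {R : realType} {X : banachLatticeType R}.
Variables (p : R) (M : R).
Hypothesis p_gt1 : 1 < p.
Hypothesis M_ge1 : 1 <= M.
Hypothesis M_convex : forall (n : nat) (x : 'I_n -> X) (z : X), is_lp_mean p x z ->
  `|z| <= M * (\sum_(i < n) `|x i| `^ p) `^ p^-1.
Hypothesis oc : @order_continuous_norm R X.
Implicit Types e k t y z g : X.

Let p_gt0 : 0 < p. Proof. exact: lt_trans p_gt1. Qed.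
Let p_neq0 : p != 0. Proof. by rewrite gt_eqF. Qed.
Let M_gt0 : 0 < M. Proof. exact: lt_le_trans M_ge1. Qed.

(** Such a [phi] is the integral against a positive measure on the components of
    [e]; since [z] is the p-th power of [y], the last clause says that the L_p norm
    of this measure is dominated by the norm of [X]. *)
Definition power_functional e (L : R) (phi : X -> R) : Prop :=
  [/\ lin phi, forall x, 0 <=b x -> 0 <= phi x, forall x, phi x <= L * `|x|
    & forall y z, step_power p e y z -> phi z <= `|y| `^ p].

Lemma step_root_norm e v s (beta : R) : 0 < beta -> step_power p e v s ->
  `|v| <= beta * `|e| + beta `^ (1 - p) * `|s|.
Proof.
move=> beta0 [I [d [b [[[d0 dd] de] b0 vE sE]]]].
have v_le : v <=b beta *: e + beta `^ (1 - p) *: s.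
  rewrite vE sE -de !scaler_sumr -big_split; apply: ble_sum => i _ /=.
  rewrite scalerA -scalerDl; apply: bleZl => //.
  by rewrite -{1}(powRK p_neq0 (b0 i)) powR_root_le ?powR_ge0.
have v0 : 0 <=b v by rewrite vE; apply: sum_ble0 => i _; rewrite bleZ0.
apply: le_trans (norm_ble0 v0 v_le) _; apply: le_trans (ler_normD _ _) _.
by rewrite !normrZ (ger0_norm (ltW beta0)) ger0_norm // powR_ge0.
Qed.

Lemma step_has_root e s : step e s -> exists v, step_power p e v s.
Proof.
move=> [I [d [b [ed b0 sE]]]]; exists (\sum_i (b i `^ p^-1) *: d i).
exists I, d, (fun i => b i `^ p^-1); split=> // [i|]; first exact: powR_ge0.
by rewrite sE; apply: eq_bigr => i _; rewrite powRVK.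
Qed.

Lemma big_option_sum (V : nmodType) (I : finType) (F : option I -> V) :
  \sum_o F o = F None + \sum_i F (Some i).
Proof.
rewrite (bigD1 None) //=; congr (_ + _).
rewrite (reindex_omap Some id) /=; last by case.
by apply: eq_bigl => i; rewrite eqxx.
Qed.

(** A target of norm at least [c0^(1/p)] cannot be dominated cheaply: absorbing
    part of it in an error [r] of small norm costs a p-th root of [r], which is
    again of small norm relative to the unit [e]. *)
Lemma domination_cost e (c0 : R) : 0 <=b e -> 0 < c0 ->
  exists c L : R, [/\ 0 < c, 0 <= L & forall (J : finType) (y z : J -> X) k t r,
    (forall j, step_power p e (y j) (z j)) -> step_power p e k t ->
    c0 <= `|k| `^ p -> t <=b \sum_j z j + r ->
    c <= \sum_j `|y j| `^ p + L * `|r|].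
Proof.
move=> e0 c00; set E := `|e| + 1.
have E0 : 0 < E by rewrite ltr_wpDl.
have eE : `|e| <= E by rewrite lerDl.
(* The root of the error will have norm at most [3 * theta], which costs at most
   half of [c0]. *)
pose theta := (c0 / 2) `^ p^-1 / M / 3.
have theta0 : 0 < theta by rewrite /theta !divr_gt0 ?powR_gt0 ?divr_gt0.
have thetaE : M `^ p * (3 * theta) `^ p = c0 / 2.
  have E3 : M * (3 * theta) = (c0 / 2) `^ p^-1 by rewrite /theta; field; rewrite gt_eqF.
  have t3 : 0 <= 3 * theta by rewrite mulr_ge0 // ltW.
  by rewrite -(powRM p (ltW M_gt0) t3) E3 powRVK // divr_ge0 // ltW.
pose beta := theta / E; have beta0 : 0 < beta by rewrite divr_gt0.
have Mp0 : 0 < M `^ p by rewrite powR_gt0.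
pose c := c0 / 2 / M `^ p; have cc0 : 0 < c by rewrite !divr_gt0.
have bp0 : 0 < beta `^ (1 - p) by rewrite powR_gt0.
pose L := beta `^ (1 - p) * c / theta; have L0 : 0 < L.
  by rewrite /L divr_gt0 // mulr_gt0.
exists c, L; split=> [//||J y z k t r yz kt kc tz]; first exact: ltW.
have ysum0 : 0 <= \sum_j `|y j| `^ p by apply: sumr_ge0 => j _; exact: powR_ge0.
have [cr|rc] := leP c (L * `|r|); first by rewrite ler_wpDl.
have [_ t_step] := step_power_step kt.
have [C C0 tC] := step_bounded t_step.
pose eta := theta / (beta `^ (1 - p) * E).
have eta0 : 0 < eta by rewrite /eta divr_gt0 // mulr_gt0.
have [s [s_step sr rs]] := step_approx oc C e0 (pos_ge0 r) eta0.
pose r' := s + eta *: e.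
have r'_step : step e r'.
  by apply: stepD => //; apply: stepZ (ltW eta0) _; exact: step_unit.
have [v vr'] := step_has_root r'_step.
have z0 : 0 <=b \sum_j z j.
  by apply: sum_ble0 => j _; have [_ /step_ge0] := step_power_step (yz j).
have t_le : t <=b \sum_j z j + r'.
  apply: (@ble_tr _ _ (\sum_j z j + pos (t - \sum_j z j))).
    by rewrite addrC bleDl pos_ge.
  apply: bleD => //; apply: ble_tr rs.
  rewrite bmeet_ble; apply/andP; split.
    by apply: pos_mono; rewrite -bleDl addrC.
  apply: ble_tr tC; apply: pos_sub_le => //; exact: step_ge0 t_step.
pose y' (o : option J) := if o is Some j then y j else v.
pose z' (o : option J) := if o is Some j then z j else r'.
have yz' o : step_power p e (y' o) (z' o) by case: o => [j|] /=.
have := step_power_bound p_gt1 M_ge1 M_convex e0 yz' kt.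
rewrite !big_option_sum /= addrC => /(_ t_le) kM.
have s_norm : `|s| <= `|r|.
  apply: le_trans (norm_pos r); apply: norm_ble0 sr; exact: step_ge0 s_step.
have r'_norm : beta `^ (1 - p) * `|r'| <= 2 * theta.
  have r'le : `|r'| <= `|r| + eta * E.
    apply: le_trans (ler_normD _ _) _; rewrite normrZ (ger0_norm (ltW eta0)).
    by rewrite lerD // ler_wpM2l // ltW.
  have eq1 : beta `^ (1 - p) * (eta * E) = theta.
    by rewrite /eta; field; rewrite !gt_eqF.
  have le2 : beta `^ (1 - p) * `|r| <= theta.
    have -> : beta `^ (1 - p) * `|r| = L * `|r| * theta / c.
      by rewrite /L; field; rewrite !gt_eqF.
    by rewrite ler_pdivrMr // [theta * c]mulrC ler_wpM2r ?ltW.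
  have := ler_wpM2l (ltW bp0) r'le; rewrite mulrDr eq1; lra.
have v_norm : `|v| <= 3 * theta.
  have := step_root_norm beta0 vr'.
  have : beta * `|e| <= theta.
    by rewrite /beta mulrAC ler_pdivrMr // ler_wpM2l // ltW.
  by lra.
have vp : M `^ p * `|v| `^ p <= c0 / 2.
  rewrite -thetaE; apply: ler_wpM2l; first exact: ltW.
  by apply: powR_le => //; exact: ltW.
have : c0 / 2 <= M `^ p * \sum_j `|y j| `^ p.
  by move: kM; rewrite mulrDr; lra.
move=> le; apply: (@le_trans _ _ (\sum_j `|y j| `^ p)); last first.
  by rewrite lerDl mulr_ge0 // ltW.
by rewrite /c ler_pdivrMr // [leRHS]mulrC.
Qed.

(** Duality for the p-concavification: a set [K] of p-th powers whose positive
    combinations all have a large p-th root is bounded below by a single power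
    functional, with constants depending on [e] and [c0] alone. *)
Theorem power_functional_exists e (c0 : R) : 0 <=b e -> 0 < c0 ->
  exists c L : R, [/\ 0 < c, 0 <= L & forall K : set X,
    (forall (J : finType) (lam : J -> R) (t : J -> X), (forall j, 0 <= lam j) ->
      (forall j, K (t j)) -> exists2 k, step_power p e k (\sum_j lam j *: t j)
        & c0 * \sum_j lam j <= `|k| `^ p) ->
    exists2 phi, power_functional e L phi & forall t, K t -> c <= phi t].
Proof.
move=> e0 c00; have [c [L [cc0 L0 cost]]] := domination_cost e0 c00.
exists c, L; split=> // K HK.
(* The pair [(x, s)] is in [C] when [s] is at least the cost of dominating [x] by
   powers of step elements, by an arbitrary [r] at the price [L * `|r|], and by
   negatives of members of [K] at the price [- c] each. *)
pose C : set (X * R) := [set w | exists (J J' : finType) (y z : J -> X)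
  (lam : J' -> R) (t : J' -> X) (r : X), [/\ forall j, step_power p e (y j) (z j),
    forall j, 0 <= lam j, forall j, K (t j),
    w.1 + \sum_j lam j *: t j <=b \sum_j z j + r
    & \sum_j `|y j| `^ p + L * `|r| - c * \sum_j lam j <= w.2]].
have void0 (V : nmodType) (F : void -> V) : \sum_i F i = 0 by rewrite big1 // => -[].
have of_r r : C (r, L * `|r|).
  exists void, void, (fun=> 0), (fun=> 0), (fun=> 0), (fun=> 0), r.
  by split=> [[]|[]|[]||] //=; rewrite !void0 ?mulr0 ?subr0 ?add0r ?addr0.
have of_yz y z : step_power p e y z -> C (z, `|y| `^ p).
  move=> yz; exists unit, void, (fun=> y), (fun=> z), (fun=> 0), (fun=> 0), 0.
  split=> [//|[]|[]||] //=; rewrite !void0 big_const card_unit /= ?addr0 //.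
  by rewrite normr0 !mulr0 subr0 addr0.
have of_K t : K t -> C (- t, - c).
  move=> Kt; exists void, unit, (fun=> 0), (fun=> 0), (fun=> 1), (fun=> t), 0.
  split=> [[]|//|//||] /=; rewrite ?void0 big_const card_unit /= ?addr0.
    by rewrite scale1r addNr.
  by rewrite normr0 mulr0 mulr1 add0r sub0r.
have of_neg x : 0 <=b x -> C (- x, 0).
  move=> x0; exists void, void, (fun=> 0), (fun=> 0), (fun=> 0), (fun=> 0), 0.
  split=> [[]|[]|[]||] //=; rewrite !void0 ?normr0 ?mulr0 ?subr0 ?addr0 //.
  by move: x0; rewrite -bleN oppr0.
have coneC : constraint_cone C.
  split; first by have := of_r 0; rewrite normr0 mulr0.
    move=> x s x' s' [J1 [J1' [y1 [z1 [l1 [t1 [r1 [yz1 l10 K1 /= ble1 le1]]]]]]]].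
    move=> [J2 [J2' [y2 [z2 [l2 [t2 [r2 [yz2 l20 K2 /= ble2 le2]]]]]]]].
    pose join (A : Type) (I1 I2 : Type) (f1 : I1 -> A) (f2 : I2 -> A) (i : I1 + I2) :=
      match i with inl i => f1 i | inr i => f2 i end.
    exists (J1 + J2)%type, (J1' + J2')%type, (join _ _ _ y1 y2), (join _ _ _ z1 z2).
    exists (join _ _ _ l1 l2), (join _ _ _ t1 t2), (r1 + r2).
    have lt_sum : \sum_j join _ _ _ l1 l2 j *: join _ _ _ t1 t2 j =
        \sum_j l1 j *: t1 j + \sum_j l2 j *: t2 j by rewrite big_sumType.
    have z_sum : \sum_j join _ _ _ z1 z2 j = \sum_j z1 j + \sum_j z2 j.
      by rewrite big_sumType.
    have l_sum : \sum_j join _ _ _ l1 l2 j = \sum_j l1 j + \sum_j l2 j.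
      by rewrite big_sumType.
    have y_sum : \sum_j `|join _ _ _ y1 y2 j| `^ p =
        \sum_j `|y1 j| `^ p + \sum_j `|y2 j| `^ p by rewrite big_sumType.
    split=> [[j|j]|[j|j]|[j|j]||] //=; rewrite ?lt_sum ?z_sum ?l_sum ?y_sum.
      by have := bleD ble1 ble2; congr (_ <=b _); vlin.
    apply: le_trans (lerD le1 le2).
    have := ler_wpM2l L0 (ler_normD r1 r2); rewrite !mulrDr; lra.
  move=> k x s k0 [J1 [J1' [y1 [z1 [l1 [t1 [r1 [yz1 l10 K1 /= ble1 le1]]]]]]]].
  exists J1, J1', (fun j => k `^ p^-1 *: y1 j), (fun j => k *: z1 j).
  exists (fun j => k * l1 j), t1, (k *: r1).
  have kE : (k `^ p^-1) `^ p = k by rewrite powRVK // ltW.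
  split=> [j|j|//||] /=.
  - by rewrite -[k in k *: z1 j]kE; apply: step_powerZ => //; exact: powR_ge0.
  - by rewrite mulr_ge0 // ltW.
  - have := bleZ (ltW k0) ble1; congr (_ <=b _); rewrite scalerDr scaler_sumr //.
    by congr (_ + _); apply: eq_bigr => j _; rewrite scalerA.
  - have -> : \sum_j `|k `^ p^-1 *: y1 j| `^ p = k * \sum_j `|y1 j| `^ p.
      rewrite mulr_sumr; apply: eq_bigr => j _.
      by rewrite normrZ powRM // ger0_norm ?powR_ge0 // kE.
    rewrite normrZ (ger0_norm (ltW k0)) -mulr_sumr.
    by have := ler_wpM2l (ltW k0) le1; congr (_ <= _); ring.
have consC : consistent C.
  move=> s [J [J' [y [z [lam [t [r [yz lam0 Kt /= le1 le2]]]]]]]].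
  apply: le_trans le2; rewrite subr_ge0; set Lam := \sum_j lam j.
  have Lam0 : 0 <= Lam by exact: sumr_ge0.
  have y0 : 0 <= \sum_j `|y j| `^ p + L * `|r|.
    by rewrite addr_ge0 ?mulr_ge0 // sumr_ge0 // => j _; exact: powR_ge0.
  have [->|LamN0] := eqVneq Lam 0; first by rewrite mulr0.
  have Lam_gt0 : 0 < Lam by rewrite lt_def LamN0.
  have lam'0 j : 0 <= Lam^-1 * lam j by rewrite mulr_ge0 // invr_ge0.
  have [k kt kc] := HK J' (fun j => Lam^-1 * lam j) t lam'0 Kt.
  have := cost J (fun j => (Lam^-1) `^ p^-1 *: y j) (fun j => Lam^-1 *: z j)
    k _ (Lam^-1 *: r) _ kt.
  have kE : (Lam^-1 `^ p^-1) `^ p = Lam^-1 by rewrite powRVK // invr_ge0.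
  have yz' j : step_power p e (Lam^-1 `^ p^-1 *: y j) (Lam^-1 *: z j).
    by rewrite -[X in X *: z j]kE; apply: step_powerZ => //; exact: powR_ge0.
  move/(_ yz'); rewrite -mulr_sumr mulVf // mulr1 in kc; move/(_ kc).
  have tz : \sum_j (Lam^-1 * lam j) *: t j <=b
      \sum_j Lam^-1 *: z j + Lam^-1 *: r.
    rewrite -scaler_sumr -scalerDr; under eq_bigr do rewrite -scalerA.
    by rewrite -scaler_sumr bleZ ?invr_ge0 // -[X in X <=b _]add0r.
  move/(_ tz); rewrite normrZ ger0_norm ?invr_ge0 // => H.
  rewrite mulrC -ler_pdivlMl // mulrDr mulr_sumr; apply: le_trans H _.
  rewrite mulrCA lerD2r; apply: ler_sum => j _.
  by rewrite normrZ powRM // ger0_norm ?powR_ge0 // kE.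
have [|phi phil phiC] := cone_linear_form coneC consC.
  by move=> x; exists (L * `|x|).
exists phi; last by move=> t /of_K/phiC; rewrite linN // lerN2.
split=> [//|x x0|x|y z yz]; [|exact: phiC|exact/phiC/of_yz].
by have := phiC _ _ (of_neg _ x0); rewrite linN // oppr_le0.
Qed.

End PowerFunctionals.

(** * Restricting a positive functional to a band *)

Section BandFunctionals.
Context {R : realType} {X : banachLatticeType R}.
Implicit Types x y d e : X.

(** The value [m u - m v] depends on [u - v] alone, by additivity on the positive
    cone. *)
Lemma cone_extension (m : X -> R) :
  (forall x y, 0 <=b x -> 0 <=b y -> m (x + y) = m x + m y) ->
  (forall (k : R) x, 0 < k -> 0 <=b x -> m (k *: x) = k * m x) ->
  lin (fun x => m (pos x) - m (pos (- x))).
Proof.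
move=> mD mZ; set f := fun x => _.
have m_sub u v x : 0 <=b u -> 0 <=b v -> x = u - v -> f x = m u - m v.
  move=> u0 v0 xuv; have := mD (pos x) v (pos_ge0 _) v0.
  have := mD (pos (- x)) u (pos_ge0 _) u0.
  have -> : pos (- x) + u = pos x + v; last by rewrite /f; lra.
  have -> : u = x + v by rewrite xuv subrK.
  by rewrite [X in _ + (X + _)]pos_sub; vlin.
have fD x y : f (x + y) = f x + f y.
  rewrite (@m_sub (pos x + pos y) (pos (- x) + pos (- y))) ?bleD0 //.
    by rewrite !mD // /f; ring.
  by rewrite [x in LHS]pos_sub [y in LHS]pos_sub; vlin.
have f0 : f 0 = 0 by have := fD 0 0; rewrite addr0; lra.
have fZ k x : 0 < k -> f (k *: x) = k * f x.
  move=> k0; rewrite (@m_sub (k *: pos x) (k *: pos (- x))) ?bleZ0 ?(ltW k0) //.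
    by rewrite !mZ // /f; ring.
  by rewrite [x in LHS]pos_sub scalerBr.
have fN x : f (- x) = - f x by rewrite /f opprK opprB.
move=> a x y; rewrite fD; congr (_ + _).
have [a0|a0|->] := ltgtP a 0; last by rewrite scale0r mul0r.
  by rewrite -[a in LHS]opprK scaleNr fN fZ ?oppr_gt0 // mulNr opprK.
exact: fZ.
Qed.

Variables (phi : X -> R) (phi_lin : lin phi).
Hypothesis phi_ge0 : forall x, 0 <=b x -> 0 <= phi x.

Lemma lin_mono x y : x <=b y -> phi x <= phi y.
Proof. by rewrite ble_sub => /phi_ge0; rewrite linB // subr_ge0. Qed.

Lemma lin_modulus x : `|phi x| <= phi (modulus x).
Proof.
rewrite ler_norml lerNl -linN // !lin_mono ?modulus_ge //.
exact: modulus_geN.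
Qed.

(** This is [phi] after the projection of [x] onto the band of [d], expressed through
    the truncations [x /\ k d]. *)
Definition band_sup d x : R := sup (range (fun k : nat => phi (x /\b (k%:R *: d)))).

Definition band_form d x : R := band_sup d (pos x) - band_sup d (pos (- x)).

Section OneBand.
Variables (d : X) (d_ge0 : 0 <=b d).

Lemma band_sup_ge x (k : R) : phi (x /\b (k *: d)) <= band_sup d x.
Proof.
have [n kn] := nat_above k.
apply: (@le_trans _ _ (phi (x /\b (n%:R *: d)))).
  by apply: lin_mono; rewrite bmeet_mono // bleZl // ltW.
apply: ub_le_sup; last by exists n.
by exists (phi x) => _ [j _ <-]; apply: lin_mono; exact: bmeetl.
Qed.

Lemma band_sup_le x (m : R) :
  (forall k : nat, phi (x /\b (k%:R *: d)) <= m) -> band_sup d x <= m.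
Proof.
by move=> H; apply: ge_sup; [exists (phi (x /\b (0%:R *: d))), 0%N|move=> _ [k _ <-]].
Qed.

Lemma band_supD x y : 0 <=b x -> 0 <=b y ->
  band_sup d (x + y) = band_sup d x + band_sup d y.
Proof.
move=> x0 y0; have kd0 (k : nat) : 0 <=b k%:R *: d by rewrite bleZ0 ?ler0n.
apply/eqP; rewrite eq_le; apply/andP; split.
  apply: band_sup_le => k; apply: le_trans (lin_mono (bmeet_addl _ _ _)) _ => //.
  by rewrite linD // lerD ?band_sup_ge.
rewrite -lerBrDr; apply: band_sup_le => k; rewrite lerBrDr -lerBrDl.
apply: band_sup_le => l; rewrite lerBrDl -linD //.
apply: le_trans (band_sup_ge _ (k%:R + l%:R)); apply: lin_mono.
by rewrite bmeet_ble scalerDl !bleD ?bmeetl ?bmeetr.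
Qed.

Lemma band_supZ (k : R) x : 0 < k -> 0 <=b x -> band_sup d (k *: x) = k * band_sup d x.
Proof.
have le (l : R) y : 0 < l -> band_sup d (l *: y) <= l * band_sup d y.
  move=> l0; apply: band_sup_le => n.
  have -> : (l *: y) /\b (n%:R *: d) = l *: (y /\b ((l^-1 * n%:R) *: d)).
    by rewrite bmeetZ ?(ltW l0) // scalerA mulrA mulfV ?gt_eqF // mul1r.
  by rewrite linZ // ler_wpM2l ?band_sup_ge // ltW.
move=> k0 x0; apply/eqP; rewrite eq_le le //= -ler_pdivlMl //.
apply: le_trans (le k^-1 (k *: x) _); last by rewrite invr_gt0.
by rewrite scalerA mulVf ?gt_eqF // scale1r.
Qed.

Lemma band_form_lin : lin (band_form d).
Proof. exact: cone_extension band_supD band_supZ. Qed.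

Lemma band_form_pos x : 0 <=b x -> band_form d x = band_sup d x.
Proof.
move=> x0; rewrite /band_form pos_id // (_ : pos (- x) = 0); last first.
  by apply: ble_eq => //; apply: pos_ble => //; rewrite -bleN opprK oppr0.
by have := band_supD (blexx 0) (blexx 0); rewrite addr0; lra.
Qed.

Lemma band_form_ge0 x : 0 <=b x -> 0 <= band_form d x.
Proof.
move=> x0; rewrite band_form_pos //; apply: le_trans (band_sup_ge x 0).
by rewrite scale0r bmeet_r // lin0.
Qed.

Lemma band_form_le x : 0 <=b x -> band_form d x <= phi x.
Proof.
move=> x0; rewrite band_form_pos //; apply: band_sup_le => k.
by apply: lin_mono; exact: bmeetl.
Qed.

Lemma band_form_self : band_form d d = phi d.
Proof.
apply/eqP; rewrite eq_le band_form_le //= band_form_pos //.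
by apply: le_trans (band_sup_ge d 1); rewrite scale1r bmeet_l.
Qed.

Lemma band_form_disj x : 0 <=b x -> x /\b d = 0 -> band_form d x = 0.
Proof.
move=> x0 xd; apply/eqP; rewrite eq_le band_form_ge0 // andbT band_form_pos //.
apply: band_sup_le => k; rewrite -[x]scale1r disj_scale ?ler0n //.
by rewrite lin0.
Qed.

Lemma band_form_null x : phi d = 0 -> 0 <=b x -> band_form d x = 0.
Proof.
move=> d0 x0; apply/eqP; rewrite eq_le band_form_ge0 // andbT band_form_pos //.
apply: band_sup_le => k; apply: le_trans (lin_mono (bmeetr _ _)) _.
by rewrite linZ // d0 mulr0.
Qed.

End OneBand.

Lemma band_form_add d d' x : 0 <=b d -> 0 <=b d' -> d /\b d' = 0 ->
  band_form (d + d') x = band_form d x + band_form d' x.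
Proof.
move=> d0 d'0 dd'.
suff H y : 0 <=b y -> band_sup (d + d') y = band_sup d y + band_sup d' y.
  by rewrite /band_form !H //; lra.
move=> y0; have dd0 := bleD0 d0 d'0.
have kdd (k l : R) : 0 <= k -> 0 <= l -> (k *: d) /\b (l *: d') = 0.
  by move=> k0 l0; rewrite disj_scale.
apply/eqP; rewrite eq_le; apply/andP; split.
  apply: band_sup_le => k; rewrite bmeetC scalerDr.
  apply: le_trans (lin_mono (bmeet_addl _ _ _)) _; rewrite ?bleZ0 ?ler0n //.
  by rewrite linD // ![_ /\b y]bmeetC lerD ?band_sup_ge.
rewrite -lerBrDr; apply: band_sup_le => k; rewrite lerBrDr -lerBrDl.
apply: band_sup_le => l; rewrite lerBrDl -linD //.
apply: le_trans (band_sup_ge dd0 y (k%:R + l%:R)); apply: lin_mono.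
have kl : 0 <= k%:R + l%:R :> R by rewrite addr_ge0 ?ler0n.
apply: disj_add_le; rewrite ?bmeet_ge0 ?bleZ0 ?ler0n //.
- by apply: disj_le (kdd k%:R l%:R (ler0n _ _) (ler0n _ _)); rewrite ?bmeet_ge0 ?bleZ0 ?ler0n ?bmeetr.
- apply: bmeet_mono => //; rewrite scalerDr -[k%:R *: d]addr0.
  by rewrite bleD ?bleZ0 // bleZl // lerDl ler0n.
- apply: bmeet_mono => //; rewrite scalerDr -[l%:R *: d']add0r.
  by rewrite bleD ?bleZ0 // bleZl // lerDr ler0n.
Qed.

Lemma band_form_sum (I : finType) (d : I -> X) x : disj_family d ->
  band_form (\sum_i d i) x = \sum_i band_form (d i) x.
Proof.
move=> [d0 dd].
suff H (r : seq I) : uniq r ->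
    band_form (\sum_(i <- r) d i) x = \sum_(i <- r) band_form (d i) x.
  exact: H (index_enum_uniq _).
elim: r => [_|i r IH /= /andP[ir ur]].
  rewrite !big_nil.
  have null y : 0 <=b y -> band_form 0 y = 0.
    by move=> y0; rewrite band_form_null // lin0.
  have fl := band_form_lin (blexx 0).
  by rewrite (pos_sub x) linB // !null // subrr.
rewrite !big_cons band_form_add ?IH // ?sum_ble0 //.
rewrite bmeetC big_seq; apply: disj_suml => // j jr; apply: dd => ji.
by rewrite -ji jr in ir.
Qed.

End BandFunctionals.

(** * Conditional expectations are bounded *)

Section ConditionalExpectation.
Context {R : realType} {X : banachLatticeType R}.
Variable p : R.
Hypothesis p_gt1 : 1 < p.
Hypothesis oc : @order_continuous_norm R X.
Variables (e : X) (L : R) (phi : X -> R).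
Hypothesis e_ge0 : 0 <=b e.
Hypothesis phiP : power_functional p e L phi.
Implicit Types x y z d s : X.

Let p_gt0 : 0 < p. Proof. exact: lt_trans p_gt1. Qed.
Let p_neq0 : p != 0. Proof. by rewrite gt_eqF. Qed.
Let phi_lin : lin phi. Proof. by case: phiP. Qed.
Let phi_ge0 : forall x, 0 <=b x -> 0 <= phi x. Proof. by case: phiP. Qed.

(** Jensen's inequality for the measure carried by [phi] on the components
    below [d]. *)
Lemma step_power_jensen d s z : step_power p d s z ->
  phi s `^ p * phi d `^ (1 - p) <= phi z.
Proof.
move=> [I [f [b [[[f0 fd] fE] b0 sE zE]]]].
have w0 i : 0 <= phi (f i) by exact: phi_ge0.
have phis : phi s = \sum_i b i * phi (f i).
  by rewrite sE lin_sum //; apply: eq_bigr => i _; rewrite linZ.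
have phiz : phi z = \sum_i b i `^ p * phi (f i).
  by rewrite zE lin_sum //; apply: eq_bigr => i _; rewrite linZ.
have phid : phi d = \sum_i phi (f i) by rewrite -fE lin_sum.
have z0 : 0 <= phi z by rewrite phiz sumr_ge0 // => i _; rewrite mulr_ge0 ?powR_ge0.
have s0 : 0 <= phi s by rewrite phis sumr_ge0 // => i _; rewrite mulr_ge0.
have d0 : 0 <= phi d by rewrite phid sumr_ge0.
have [dz|dN0] := eqVneq (phi d) 0.
  by rewrite dz powR0 ?mulr0 // subr_eq0 lt_eqF.
have d_gt0 : 0 < phi d by rewrite lt_def dN0.
pose a := phi s / phi d; have a0 : 0 <= a by rewrite divr_ge0.
have sa : phi s = a * phi d by rewrite /a divfK.
have : \sum_i p * (b i * a `^ (p - 1)) * phi (f i) <=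
       \sum_i (b i `^ p + (p - 1) * a `^ p) * phi (f i).
  by apply: ler_sum => i _; rewrite ler_wpM2r // powR_tangent.
under [leRHS]eq_bigr do rewrite mulrDl.
rewrite big_split /= -phiz -mulr_sumr -phid.
have -> : \sum_i p * (b i * a `^ (p - 1)) * phi (f i) = p * a `^ (p - 1) * phi s.
  by rewrite phis mulr_sumr; apply: eq_bigr => i _; ring.
have aE : a `^ (p - 1) * a = a `^ p.
  have [->|aN0] := eqVneq a 0; first by rewrite mulr0 powR0.
  by rewrite -[X in _ * X](powRr1 a0) -powRD ?subrK // aN0 implybT.
have -> : p * a `^ (p - 1) * phi s = p * (a `^ p * phi d) by rewrite sa -aE; ring.
have -> : phi s `^ p * phi d `^ (1 - p) = a `^ p * phi d; last by lra.
rewrite sa powRM // -mulrA; congr (_ * _).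
by rewrite -powRD ?dN0 ?implybT // addrC subrK powRr1.
Qed.

(** Truncate [x] at a multiple of [d], then approximate the truncation by a step
    element from below.  The factor [theta] keeps the statement meaningful when the
    value is zero. *)
Lemma band_form_approx d x (theta : R) : 0 <=b d -> 0 <=b x -> 0 <= theta < 1 ->
  exists s z, [/\ step_power p d s z, s <=b x & theta * band_form phi d x <= phi s].
Proof.
move=> d0 x0 /andP[th0 th1]; set a := band_form phi d x.
have a0 : 0 <= a by exact: band_form_ge0.
have [->|aN0] := eqVneq a 0.
  have [z dz] := step_has_power p (step0 d0); exists 0, z; split=> //.
  by rewrite mulr0 lin0.
have a_gt0 : 0 < a by rewrite lt_def aN0.
have [k ka] : exists k : nat, (1 + theta) / 2 * a < phi (x /\b (k%:R *: d)).
  apply: contrapT => /forallNP no.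
  have : a <= (1 + theta) / 2 * a.
    rewrite {1}/a band_form_pos //; apply: band_sup_le => k.
    by rewrite leNgt; apply/negP; exact: no.
  by apply/negP; rewrite -ltNge gtr_pMl //; lra.
have pd0 : 0 <= phi d := phi_ge0 d0.
pose eta := (1 - theta) / 2 * a / (phi d + 1).
have den0 : 0 < phi d + 1 by rewrite ltr_wpDl.
have num0 : 0 < (1 - theta) / 2 * a by rewrite mulr_gt0 //; lra.
have eta0 : 0 < eta by rewrite /eta divr_gt0.
have [s [ds sx xs]] := step_approx oc k%:R d0 x0 eta0.
have [z dz] := step_has_power p ds; exists s, z; split=> //.
have := lin_mono phi_lin phi_ge0 xs; rewrite linD // linZ // => H.
have : eta * phi d <= (1 - theta) / 2 * a.
  by rewrite /eta mulrAC ler_pdivrMr // ler_wpM2l ?lerDl // ltW.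
lra.
Qed.

(** For a step element [x] this is Jensen's inequality on each [d j], summed up; a
    general [x] is approximated from below inside each [d j] separately, and the
    disjoint approximants add up to a step element below [x]. *)
Theorem conditional_expectation_bound (J : finType) (d : J -> X) x :
  disj_family d -> (forall j, component e (d j)) -> 0 <=b x ->
  \sum_j band_form phi (d j) x `^ p * phi (d j) `^ (1 - p) <= `|x| `^ p.
Proof.
move=> [d0 dd] ed x0; set S := \sum_j _; set N := `|x| `^ p.
have N0 : 0 <= N := powR_ge0 _ _.
have S0 : 0 <= S by apply: sumr_ge0 => j _; rewrite mulr_ge0 ?powR_ge0.
(* Approximation up to a factor [theta < 1] suffices: otherwise take [theta ^ p]
   halfway between [N / S] and 1. *)
suff scaled theta : 0 <= theta < 1 -> theta `^ p * S <= N.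
  rewrite leNgt; apply/negP => NS; have S_gt0 : 0 < S by apply: le_lt_trans NS.
  pose q := (N / S + 1) / 2.
  have NS1 : N / S < 1 by rewrite ltr_pdivrMr // mul1r.
  have NS0 : 0 <= N / S by rewrite divr_ge0.
  have q0 : 0 <= q by rewrite /q; lra.
  have q1 : q < 1 by rewrite /q; lra.
  have := scaled (q `^ p^-1); rewrite powR_ge0 powRVK //=.
  have -> : q `^ p^-1 < 1.
    have pV0 : 0 < p^-1 by rewrite invr_gt0.
    by have := @gt0_ltr_powR R p^-1 pV0 q 1; rewrite !nnegrE powR1; apply.
  by move=> /(_ isT); rewrite -ler_pdivlMr // /q; lra.
move=> th; have /andP[th0 th1] := th.
have /choice[s /choice[z sz]] j := band_form_approx (d0 j) x0 th.
have sd0 j : 0 <=b s j by have [/step_power_step[/step_ge0]] := sz j.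
have s_disj : disj_family s.
  split=> // i j ij.
  have [/step_power_step[/step_bounded[C C0 sC] _] _ _] := sz i.
  have [/step_power_step[/step_bounded[D D0 sD] _] _ _] := sz j.
  by apply: (@disj_le _ _ (C *: d i) (D *: d j)); rewrite ?disj_scale // dd.
have ez j : step_power p e (s j) (z j).
  by have [/(step_power_sub p_gt1 (ed j))] := sz j.
have Yx : \sum_j s j <=b x.
  apply: disj_family_sum_le (index_enum_uniq _) => // j.
  by have [] := sz j.
have YN : phi (\sum_j z j) <= N.
  have [_ _ _ H] := phiP.
  apply: le_trans (H _ _ (step_power_sum_disj p_gt1 e_ge0 s_disj ez)) _.
  by apply: powR_le (ltW p_gt0) (normr_ge0 _) (norm_ble0 _ Yx); exact: sum_ble0.
apply: le_trans YN; rewrite [phi _]lin_sum // /S mulr_sumr; apply: ler_sum => j _.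
have [dz _ le] := sz j; apply: le_trans (step_power_jensen dz).
rewrite mulrA -powRM ?band_form_ge0 // ler_wpM2r ?powR_ge0 //.
by rewrite powR_le ?(ltW p_gt0) // mulr_ge0 // band_form_ge0.
Qed.

(** A finite measure embeds L_p into L_2: with [N] the norm of [x], a value [t] of
    the conditional expectation satisfies [t^2 <= N^2] or [t^2 <= N^2 (t / N)^p],
    and both terms have a bounded integral. *)
Lemma square_expectation_bound (J : finType) (d : J -> X) x : 2 <= p ->
  partition e d ->
  \sum_j band_form phi (d j) x ^+ 2 / phi (d j) <= (phi e + 1) * `|x| ^+ 2.
Proof.
move=> p2 ed; have [[d0 dd] de] := ed.
have bl j := band_form_lin phi_lin phi_ge0 (d0 j).
have bp j := band_form_ge0 phi_lin phi_ge0 (d0 j).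
set N := `|x|.
have [NE|NN0] := eqVneq N 0.
  have xE : x = 0 by apply/eqP; rewrite -normr_eq0 -/N NE.
  rewrite NE expr0n mulr0 big1 // => j _.
  by rewrite xE lin0 // expr0n mul0r.
have N0 : 0 < N by rewrite lt_def NN0 normr_ge0.
pose a j := band_form phi (d j) (modulus x); pose w j := phi (d j).
have a0 j : 0 <= a j by exact: bp.
have w0 j : 0 <= w j by exact: phi_ge0.
have term j : band_form phi (d j) x ^+ 2 / phi (d j) <=
    N ^+ 2 * (w j + N `^ (- p) * (a j `^ p * w j `^ (1 - p))).
  rewrite -/(w j); have [wz|wN0] := eqVneq (w j) 0.
    rewrite wz invr0 mulr0 add0r mulr_ge0 ?sqr_ge0 // mulr_ge0 ?powR_ge0 //.
    by rewrite mulr_ge0 ?powR_ge0.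
  have w_gt0 : 0 < w j by rewrite lt_def wN0 w0.
  pose t := a j / w j; have t0 : 0 <= t by rewrite divr_ge0.
  have aE : a j = t * w j by rewrite /t divfK.
  have xa : band_form phi (d j) x ^+ 2 <= (t * w j) ^+ 2.
    rewrite -aE -[leLHS]real_normK ?num_real // ler_sqr ?nnegrE //.
    exact: lin_modulus (bl j) (bp j) x.
  have -> : a j `^ p * w j `^ (1 - p) = t `^ p * w j.
    rewrite aE powRM // -mulrA; congr (_ * _).
    by rewrite -powRD ?wN0 ?implybT // addrC subrK powRr1.
  rewrite ler_pdivrMr //; apply: le_trans xa _.
  rewrite [X in _ <= N ^+ 2 * X * _](_ : _ = (1 + N `^ (- p) * t `^ p) * w j); last by ring.
  have -> : (t * w j) ^+ 2 = t ^+ 2 * (w j * w j) by ring.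
  have -> : N ^+ 2 * ((1 + N `^ (- p) * t `^ p) * w j) * w j =
      N ^+ 2 * (1 + N `^ (- p) * t `^ p) * (w j * w j) by ring.
  apply: ler_wpM2r; first by rewrite mulr_ge0.
  have [tN|Nt] := leP t N.
    apply: (@le_trans _ _ (N ^+ 2)); first by rewrite !expr2 ler_pM.
    by rewrite ler_peMr ?sqr_ge0 // lerDl mulr_ge0 ?powR_ge0.
  have t_gt0 : 0 < t by apply: lt_trans Nt.
  rewrite mulrDr mulr1; apply: ler_wpDl; first exact: sqr_ge0.
  rewrite -!powR_mulrn ?(ltW N0) // mulrA -powRD ?NN0 ?implybT //.
  have -> : 2%:R - p = - (p - 2) by ring.
  rewrite powRN ler_pdivlMl ?powR_gt0 //.
  have -> : t `^ p = t `^ (p - 2) * t `^ 2%:R.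
    by rewrite -powRD ?subrK // gt_eqF ?implybT.
  by rewrite ler_wpM2r ?powR_ge0 // powR_le ?subr_ge0 ?(ltW N0) ?(ltW Nt).
apply: (@le_trans _ _ (\sum_j N ^+ 2 * (w j + N `^ (- p) * (a j `^ p * w j `^ (1 - p))))).
  by apply: ler_sum => j _.
rewrite -mulr_sumr mulrC ler_wpM2r ?sqr_ge0 // big_split /= -lin_sum // de.
rewrite lerD2l -mulr_sumr.
have ce j : component e (d j) by exact: partition_component.
have := conditional_expectation_bound (conj d0 dd) ce (modulus_ge0 x).
rewrite norm_modulus -/N -/(a _) => H.
rewrite powRN ler_pdivrMl ?powR_gt0 // mulr1; exact: H.
Qed.

End ConditionalExpectation.

(** * A uniformly positive functional *)

Section UniformFunctional.
Context {R : realType} {X : banachLatticeType R}.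
Variables (p : R) (M : R).
Hypothesis p_gt1 : 1 < p.
Hypothesis M_ge1 : 1 <= M.
Hypothesis M_convex : forall (n : nat) (x : 'I_n -> X) (z : X), is_lp_mean p x z ->
  `|z| <= M * (\sum_(i < n) `|x i| `^ p) `^ p^-1.
Hypothesis oc : @order_continuous_norm R X.
Implicit Types x y z g s : X.

Let p_gt0 : 0 < p. Proof. exact: lt_trans p_gt1. Qed.
Let p_neq0 : p != 0. Proof. by rewrite gt_eqF. Qed.

(** For a single component the multiples [lam g] have the root [lam^(1/p) g], so the
    duality theorem applies with constants that depend only on [e] and [eps]. *)
Lemma component_functional e (eps : R) : 0 <=b e -> 0 < eps ->
  exists c L : R, [/\ 0 < c, 0 <= L & forall g, component e g -> eps <= `|g| ->
    exists2 phi, power_functional p e L phi & c <= phi g].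
Proof.
move=> e0 eps0; have c00 : 0 < eps `^ p by rewrite powR_gt0.
have [c [L [cc0 L0 H]]] := power_functional_exists p_gt1 M_ge1 M_convex oc e0 c00.
exists c, L; split=> // g eg geps.
have [|phi phiP phig] := H [set g]; last by exists phi => //; exact: phig.
move=> J lam t lam0 tg; have l0 : 0 <= \sum_j lam j by apply: sumr_ge0.
have -> : \sum_j lam j *: t j = (\sum_j lam j) *: g.
  by rewrite scaler_suml; apply: eq_bigr => j _; rewrite tg.
exists ((\sum_j lam j) `^ p^-1 *: g).
  by rewrite -{2}(powRVK p_neq0 l0); apply: step_power_component => //; exact: powR_ge0.
rewrite normrZ powRM ?powR_ge0 // ger0_norm ?powR_ge0 // powRVK // mulrC.
by rewrite ler_wpM2l // powR_le ?(ltW p_gt0) ?(ltW eps0).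
Qed.

Lemma lin_cvg_le (f : X -> R) (L B : R) (u : nat -> X) l : lin f ->
  (forall x, f x <= L * `|x|) -> 0 <= L -> u @ \oo --> l ->
  (forall n, f (u n) <= B) -> f l <= B.
Proof.
move=> fl fL L0 /cvg_epsP ul fu; apply/ler_addgt0Pr => eps eps0.
have L1 : 0 < L + 1 by rewrite ltr_wpDl.
have [|N HN] := ul (eps / (L + 1)); first by rewrite divr_gt0.
have := HN N (leqnn N); rewrite -normrN opprB => Nl.
have := fu N; have := fL (l - u N); rewrite linB // => H1 H2.
have : L * `|l - u N| <= eps.
  have : `|l - u N| * (L + 1) < eps by rewrite -ltr_pdivlMr.
  by have := normr_ge0 (l - u N); nra.
by lra.
Qed.

(** If no functional were bounded below on all large components, one could pick
    components [g_n] and functionals [f_n] with [f_n g_n >= c] and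
    [f_m g_n < 2^-n] for [m < n].  The upper limit of the [g_n] exists in norm and
    every [f_m] vanishes on it, which contradicts [f_m g_m >= c]. *)
Theorem uniform_functional e (eps : R) : 0 <=b e -> 0 < eps ->
  exists (L delta : R) (phi : X -> R), [/\ 0 < delta, power_functional p e L phi
    & forall g, component e g -> eps <= `|g| -> delta <= phi g].
Proof.
move=> e0 eps0; have [c [L [c0 L0 cf]]] := component_functional e0 eps0.
apply: contrapT => no.
(* [S] stands for the sum of the first [n] functionals already chosen; divided by
   [n.+1] it is again a power functional, also for [n = 0]. *)
pose Psi (n : nat) (S : X -> R) := [/\ lin S, forall x, 0 <=b x -> 0 <= S x,
  forall x, S x <= n.+1%:R * (L * `|x|)
  & forall y z, step_power p e y z -> S z <= n.+1%:R * `|y| `^ p].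
have pick n S : Psi n S -> exists g phi, [/\ component e g, S g < 2^-1 ^+ n,
    power_functional p e L phi & c <= phi g].
  move=> [Sl S0 SL Sp]; apply: contrapT => none; apply: no.
  have nV : 0 < n.+1%:R^-1 :> R by rewrite invr_gt0 ltr0n.
  exists L, (n.+1%:R^-1 * 2^-1 ^+ n), (fun x => n.+1%:R^-1 * S x); split.
  - by rewrite mulr_gt0 // exprn_gt0 // invr_gt0.
  - split=> [a x y|x /S0 Sx|x|y z yz].
    + by rewrite Sl; ring.
    + by rewrite mulr_ge0 // ltW.
    + by rewrite ler_pdivrMl ?ltr0n.
    + by rewrite ler_pdivrMl ?ltr0n // Sp.
  - move=> g eg geps; rewrite ler_pM2l // leNgt; apply/negP => Sg.
    by apply: none; have [phi phiP phig] := cf g eg geps; exists g, phi.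
have /choice[F HF] (nS : nat * (X -> R)) : exists G : X * (X -> R),
    Psi nS.1 nS.2 -> [/\ component e G.1, nS.2 G.1 < 2^-1 ^+ nS.1,
      power_functional p e L G.2 & c <= G.2 G.1].
  have [PS|nPS] := pselect (Psi nS.1 nS.2); last by exists (0, nS.2).
  by have [g [phi H]] := pick _ _ PS; exists (g, phi).
pose S := fix S n := if n is n'.+1 then (fun x => S n' x + (F (n', S n')).2 x)
  else fun=> 0.
pose g n := (F (n, S n)).1; pose f n := (F (n, S n)).2.
have Psi_S n : Psi n (S n).
  elim: n => [|n IH].
    split=> [a x y|x _|x|y z _] /=; rewrite ?mulr0 ?addr0 //.
    by rewrite mul1r mulr_ge0.
  have [_ _ [fl f0 fL fp] _] := HF (n, S n) IH; have [Sl S0 SL Sp] := IH.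
  split=> /= [a x y|x x0|x|y z yz].
  - by rewrite Sl fl; ring.
  - by rewrite addr_ge0 ?S0 ?f0.
  - by rewrite -[n.+2%:R]natr1 mulrDl mul1r lerD.
  - by rewrite -[n.+2%:R]natr1 mulrDl mul1r lerD ?Sp ?fp.
have eg n : component e (g n) by have [] := HF (n, S n) (Psi_S n).
have Sg n : S n (g n) < 2^-1 ^+ n by have [] := HF (n, S n) (Psi_S n).
have fP n : power_functional p e L (f n) by have [] := HF (n, S n) (Psi_S n).
have fg n : c <= f n (g n) by have [] := HF (n, S n) (Psi_S n).
have fl n : lin (f n) by have [] := fP n.
have f0 n x : 0 <=b x -> 0 <= f n x by have [_ H _ _] := fP n; exact: H.
have fL n x : f n x <= L * `|x| by have [_ _ H _] := fP n.
have g0 n : 0 <=b g n := component_ge0 (eg n).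
have ge n : g n <=b e := component_le (eg n).
have S0 n x : 0 <=b x -> 0 <= S n x by have [_ H _ _] := Psi_S n; exact: H.
have fS m k x : 0 <=b x -> f m x <= S (m + k.+1)%N x.
  move=> x0; elim: k => [|k IH]; first by rewrite addn1 /= lerDr S0.
  by rewrite addnS /= (le_trans IH) // lerDl; exact: f0.
have f_small m n : (m < n)%N -> f m (g n) <= 2^-1 ^+ n.
  move=> mn; apply: le_trans (ltW (Sg n)).
  by have := @fS m (n - m.+1)%N (g n) (g0 n); rewrite addnS -addSn subnKC.
(* [t n k] is the supremum of [g_n, ..., g_(n+k)]; its limit [s n] decreases to [r],
   the upper limit of the sequence. *)
pose t := fix t n k := if k is k'.+1 then t n k' \/b g (n + k'.+1)%N else g n.
have t_le n k u : (forall m, (n <= m)%N -> g m <=b u) -> t n k <=b u.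
  move=> gu; elim: k => [|k IH] /=; first exact: gu.
  by rewrite bjoin_ble IH gu // leq_addr.
have t_ge n k : g (n + k)%N <=b t n k.
  by case: k => [|k]; rewrite ?addn0 //=; exact: bjoinr.
have /choice[s ts] n : exists s : X, t n @ \oo --> s.
  apply: (oc (e := e)) => k; first exact: bjoinl.
  exact: t_le.
have gs n m : (n <= m)%N -> g m <=b s n.
  move=> nm; apply: (@ble_tr _ _ (t n (m - n)%N)).
    by have := t_ge n (m - n)%N; rewrite subnKC.
  apply: (@cvg_bge_cst _ _ (fun k => t n (k + (m - n))%N)).
    by rewrite cvg_shiftn; exact: ts.
  by move=> k; apply: bseq_mono (leq_addl _ _) => j; exact: bjoinl.
have s_le n u : (forall m, (n <= m)%N -> g m <=b u) -> s n <=b u.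
  by move=> gu; apply: cvg_ble_cst (ts n) _ => k; exact: t_le.
have sS n : s n.+1 <=b s n by apply: s_le => m nm; apply: gs; exact: ltnW.
have s_mono m n : (m <= n)%N -> s n <=b s m.
  by move=> mn; apply: s_le => k nk; apply: gs; exact: leq_trans nk.
have [r sr] : exists r : X, s @ \oo --> r.
  have [||q sq] := oc (x := fun n => e - s n) (e := e).
  - by move=> n; rewrite ![e - _]addrC bleD2r bleN.
  - move=> n; rewrite -bleDl ble_addl //; apply: ble_tr (g0 n) _; exact: gs.
  exists (e - q); apply/cvg_epsP => eta /((cvg_epsP _ _).1 sq)[N HN]; exists N => n /HN.
  by rewrite -normrN; congr (`|_| < _); vlin.
have rs n : r <=b s n.
  apply: (@cvg_ble_cst _ _ (fun k => s (k + n)%N)); first by rewrite cvg_shiftn.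
  by move=> k; apply: s_mono; exact: leq_addl.
have ft m n k : (m < n)%N -> f m (t n k) <= 2 * 2^-1 ^+ n - 2^-1 ^+ (n + k).
  move=> mn; elim: k => [|k IH] /=.
    by rewrite addn0; have := f_small _ _ mn; lra.
  have t0 : 0 <=b t n k by apply: ble_tr (t_ge n k).
  apply: (@le_trans _ _ (f m (t n k) + f m (g (n + k.+1)%N))).
    rewrite -linD //; apply: lin_mono => //; first exact: f0.
    rewrite bjoin_ble ble_addl //= addrC ble_addl //.
  have : f m (g (n + k.+1)%N) <= 2^-1 ^+ (n + k.+1).
    by apply: f_small; rewrite (leq_trans mn) // leq_addr.
  by rewrite addnS exprS; lra.
have fr m : f m r <= 0.
  apply/ler_addgt0Pr => eta eta0; rewrite add0r.
  have [N HN] := geo_small (divr_gt0 eta0 (ltr0n _ 2)).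
  pose n := maxn N m.+1.
  apply: (@le_trans _ _ (f m (s n))); first by apply: lin_mono => //; exact: f0.
  apply: (lin_cvg_le (fl m) (fL m) L0 (ts n)) => k.
  apply: le_trans (ft m n k _) _; first exact: leq_maxr.
  have : 2^-1 ^+ n <= 2^-1 ^+ N :> R.
    by apply: ler_wiXn2l; rewrite ?invr_ge0 ?invf_le1 ?ler1n // leq_maxl.
  have : 0 <= 2^-1 ^+ (n + k) :> R by rewrite exprn_ge0 // invr_ge0.
  by lra.
have far m : c <= L * `|s m - r|.
  apply: le_trans (fL m _); rewrite linB //.
  have : f m (g m) <= f m (s m).
    by apply: lin_mono => //; [exact: f0|exact: gs].
  by have := fg m; have := fr m; lra.
have L1 : 0 < L + 1 by rewrite ltr_wpDl.
have [N HN] := (cvg_epsP _ _).1 sr (c / (L + 1)) (divr_gt0 c0 L1).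
have := HN N (leqnn N); rewrite ltr_pdivlMr // => H.
by have := far N; have := normr_ge0 (s N - r); nra.
Qed.

End UniformFunctional.

(** * The Hilbertian form of a functional *)

Section HilbertForm.
Context {R : realType} {X : banachLatticeType R}.
Variable p : R.
Hypothesis p_ge2 : 2 <= p.
Hypothesis oc : @order_continuous_norm R X.
Variables (e : X) (L : R) (phi : X -> R).
Hypothesis e_ge0 : 0 <=b e.
Hypothesis phiP : power_functional p e L phi.
Implicit Types x y z d : X.

Let p_gt1 : 1 < p. Proof. by apply: lt_le_trans p_ge2; rewrite ltr1n. Qed.
Let phi_lin : lin phi. Proof. by case: phiP. Qed.
Let phi_ge0 : forall x, 0 <=b x -> 0 <= phi x. Proof. by case: phiP. Qed.

(** The L_2 inner product of the conditional expectations of [x] and [y] given the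
    partition [d]. *)
Definition partition_form (I : finType) (d : I -> X) x y : R :=
  \sum_i band_form phi (d i) x * band_form phi (d i) y / phi (d i).

Definition partition_forms x : set R :=
  [set r | exists (I : finType) (d : I -> X), partition e d /\ r = partition_form d x x].

Definition square_form x : R := sup (partition_forms x).

(** Polarization; bilinearity follows since finitely many values are approximated
    by the bilinear form of a single partition. *)
Definition hilbert_form x y : R := (square_form (x + y) - square_form (x - y)) / 4.

Lemma partition_form_bound (I : finType) (d : I -> X) x : partition e d ->
  partition_form d x x <= (phi e + 1) * `|x| ^+ 2.
Proof.
move=> ed; apply: le_trans (square_expectation_bound p_gt1 oc e_ge0 phiP x p_ge2 ed).
by apply: ler_sum => i _; rewrite expr2.
Qed.

Lemma partition_form_le (I : finType) (d : I -> X) x : partition e d ->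
  partition_form d x x <= square_form x.
Proof.
move=> ed; apply: ub_le_sup; last by exists I, d.
exists ((phi e + 1) * `|x| ^+ 2) => _ [J [g [eg ->]]].
exact: partition_form_bound.
Qed.

Lemma unit_partition : partition e (fun _ : unit => e).
Proof. by split; [split=> // -[] []|rewrite big_const card_unit /= addr0]. Qed.

Lemma square_form_bound x : square_form x <= (phi e + 1) * `|x| ^+ 2.
Proof.
apply: ge_sup; first by exists (partition_form (fun _ : unit => e) x x), unit, (fun=> e); split; first exact: unit_partition.
by move=> _ [J [g [eg ->]]]; exact: partition_form_bound.
Qed.

(** The Cauchy-Schwarz inequality, proved by summing the tangent lines of the
    squares at the mean [t]. *)
Lemma sum_square_ratio (J : finType) (a w : J -> R) : (forall j, 0 <= w j) ->
  (forall j, w j = 0 -> a j = 0) ->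
  (\sum_j a j) * (\sum_j a j) / (\sum_j w j) <= \sum_j a j * a j / w j.
Proof.
move=> w0 null; set A := \sum_j a j; set W := \sum_j w j.
have [W0|WN0] := eqVneq W 0.
  rewrite W0 invr0 mulr0; apply: sumr_ge0 => j _.
  by rewrite divr_ge0 // -expr2 sqr_ge0.
have W_gt0 : 0 < W by rewrite lt_def WN0 sumr_ge0.
pose t := A / W.
have : \sum_j (2 * t * a j - t ^+ 2 * w j) <= \sum_j a j * a j / w j.
  apply: ler_sum => j _; have [wj|wN0] := eqVneq (w j) 0.
    by rewrite wj null // invr0 !mulr0 subr0.
  have wj : 0 < w j by rewrite lt_def wN0 w0.
  rewrite ler_pdivlMr //; have := sqr_ge0 (a j - t * w j).
  by rewrite -[in X in _ -> X]subr_ge0; congr (_ <= _); ring.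
rewrite big_split /= sumrN -!mulr_sumr -/A -/W; apply: le_trans.
by rewrite /t le_eqVlt; apply/orP; left; apply/eqP; field.
Qed.

(** By convexity of the square, refining a partition increases the form. *)
Lemma partition_form_refine (I J : finType) (d : I -> X) (g : I * J -> X) x :
  partition e d -> partition e g -> (forall i, d i = \sum_j g (i, j)) ->
  partition_form d x x <= partition_form g x x.
Proof.
move=> [[d0 dd] _] [[g0 gg] _] dg.
have -> : partition_form g x x = \sum_i \sum_j
    band_form phi (g (i, j)) x * band_form phi (g (i, j)) x / phi (g (i, j)).
  by rewrite pair_bigA; apply: eq_bigr => -[].
apply: ler_sum => i _.
have gi : disj_family (fun j => g (i, j)).
  by split=> // j j' ne; apply: gg => -[].
rewrite dg band_form_sum // [phi _]lin_sum //.
apply: (sum_square_ratio (a := fun j => band_form phi (g (i, j)) x)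
  (w := fun j => phi (g (i, j)))) => [j|j wj]; first exact: phi_ge0.
have al := band_form_lin phi_lin phi_ge0 (g0 (i, j)).
by rewrite (pos_sub x) linB // !band_form_null // subrr.
Qed.

(** The forms are directed under refinement, so finitely many values of
    [square_form] are approximated by one partition. *)
Lemma square_form_approx (xs : seq X) (eps : R) : 0 < eps ->
  exists (I : finType) (d : I -> X), partition e d /\ forall x, x \in xs ->
    partition_form d x x <= square_form x <= partition_form d x x + eps.
Proof.
move=> eps0; elim: xs => [|x xs [I [d [ed H]]]].
  by exists unit, (fun=> e); split=> //; exact: unit_partition.
have [_ [J [g [eg ->]]] gx] : exists2 r, partition_forms x r & square_form x - eps < r.
  apply: sup_adherent => //; split.
    by exists (partition_form d x x), I, d.
  exists ((phi e + 1) * `|x| ^+ 2) => _ [J [g [eg ->]]]; exact: partition_form_bound.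
have [edg dE gE] := partition_refine ed eg.
exists (I * J)%type, (fun ij => d ij.1 /\b g ij.2); split=> // y.
have fineD z : partition_form d z z <= partition_form (fun ij : I * J => d ij.1 /\b g ij.2) z z.
  exact: partition_form_refine.
have fineG : partition_form g x x <= partition_form (fun ij : I * J => d ij.1 /\b g ij.2) x x.
  have [egd gE' _] := partition_refine eg ed.
  apply: le_trans (partition_form_refine x eg egd gE') _.
  rewrite /partition_form (reindex (fun ij : I * J => (ij.2, ij.1))) /=; last first.
    by exists (fun ji => (ji.2, ji.1)) => -[].
  by apply: ler_sum => -[i j] _; rewrite /= bmeetC.
rewrite inE partition_form_le //= => /orP[/eqP->|/H /andP[_ yd]].
  by move: gx fineG; lra.
by have := fineD y; lra.
Qed.


Lemma partition_form_lin (I : finType) (d : I -> X) y :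
  (forall i, 0 <=b d i) -> lin (fun x => partition_form d x y).
Proof.
move=> d0 a x z; rewrite /partition_form mulr_sumr -big_split; apply: eq_bigr => i _ /=.
have -> := band_form_lin phi_lin phi_ge0 (d0 i) a x z; ring.
Qed.

Lemma partition_formC (I : finType) (d : I -> X) x y :
  partition_form d x y = partition_form d y x.
Proof. by apply: eq_bigr => i _; rewrite [X in X / _]mulrC. Qed.

Lemma partition_form_polar (I : finType) (d : I -> X) x y :
  (forall i, 0 <=b d i) -> partition_form d x y =
  (partition_form d (x + y) (x + y) - partition_form d (x - y) (x - y)) / 4.
Proof.
move=> d0; have fl z := partition_form_lin z d0.
have right z u v : partition_form d z (u + v) = partition_form d z u + partition_form d z v.
  by rewrite !(partition_formC d z) (linD _ _ (fl _)).
have rightN z u : partition_form d z (- u) = - partition_form d z u.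
  by rewrite !(partition_formC d z) (linN _ (fl _)).
rewrite (linD _ _ (fl _)) (linB _ _ (fl _)) !right !rightN (partition_formC d y x).
by field.
Qed.

Lemma hilbert_form_approx (xys : seq (X * X)) (eps : R) : 0 < eps ->
  exists (I : finType) (d : I -> X), partition e d /\ forall x y, (x, y) \in xys ->
    `|hilbert_form x y - partition_form d x y| <= eps.
Proof.
move=> eps0.
have [I [d [ed H]]] := square_form_approx
  ([seq xy.1 + xy.2 | xy <- xys] ++ [seq xy.1 - xy.2 | xy <- xys]) eps0.
exists I, d; split=> // x y xy; have [[d0 _] _] := ed.
have /H/andP[p1 p2] : x + y \in [seq xy.1 + xy.2 | xy <- xys] ++ [seq xy.1 - xy.2 | xy <- xys].
  by rewrite mem_cat; apply/orP; left; apply/mapP; exists (x, y).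
have /H/andP[m1 m2] : x - y \in [seq xy.1 + xy.2 | xy <- xys] ++ [seq xy.1 - xy.2 | xy <- xys].
  by rewrite mem_cat; apply/orP; right; apply/mapP; exists (x, y).
rewrite partition_form_polar // /hilbert_form ler_norml.
by apply/andP; split; lra.
Qed.

Lemma small_eq0 (a C : R) : (forall eps : R, 0 < eps -> `|a| <= C * eps) -> a = 0.
Proof.
move=> H; apply/eqP; rewrite -normr_le0; apply/ler_addgt0Pr => eps eps0; rewrite add0r.
have C1 : 0 < `|C| + 1 by rewrite ltr_wpDl.
apply: le_trans (H (eps / (`|C| + 1)) _) _; first by rewrite divr_gt0.
rewrite mulrCA ler_piMr ?(ltW eps0) // ler_pdivrMr // mul1r.
by rewrite (le_trans (ler_norm C)) // lerDl.
Qed.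

Lemma hilbert_form_lin y : lin (fun x => hilbert_form x y).
Proof.
move=> a x z; apply/eqP; rewrite -subr_eq0; apply/eqP.
apply: (@small_eq0 _ (2 + `|a|)) => eps eps0.
have [I [d [ed H]]] := hilbert_form_approx [:: (a *: x + z, y); (x, y); (z, y)] eps0.
have [[d0 _] _] := ed; have fl := partition_form_lin y d0.
have := H (a *: x + z) y; rewrite !inE eqxx => /(_ isT).
rewrite (fl a x z).
have := H x y; rewrite !inE eqxx orbT => /(_ isT).
have := H z y; rewrite !inE eqxx !orbT => /(_ isT).
set h1 := hilbert_form z y; set h2 := hilbert_form x y; set h3 := hilbert_form _ y.
set k1 := partition_form d z y; set k2 := partition_form d x y => H1 H2 H3.
have -> : h3 - (a * h2 + h1) = (h3 - (a * k2 + k1)) - a * (h2 - k2) - (h1 - k1) by ring.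
apply: le_trans (ler_normB _ _) _; apply: (@le_trans _ _ (eps + `|a| * eps + eps)); last by lra.
apply: lerD => //; apply: le_trans (ler_normB _ _) _; apply: lerD => //.
by rewrite normrM ler_wpM2l.
Qed.

Lemma hilbert_formC x y : hilbert_form x y = hilbert_form y x.
Proof.
apply/eqP; rewrite -subr_eq0; apply/eqP; apply: (@small_eq0 _ 2) => eps eps0.
have [I [d [ed H]]] := hilbert_form_approx [:: (x, y); (y, x)] eps0.
have := H x y; rewrite !inE eqxx => /(_ isT).
have := H y x; rewrite !inE eqxx orbT => /(_ isT).
rewrite (partition_formC d y x) !ler_norml => /andP[a1 a2] /andP[b1 b2].
by apply/andP; split; lra.
Qed.

Lemma hilbert_form_diag x : hilbert_form x x = square_form x.
Proof.
apply/eqP; rewrite -subr_eq0; apply/eqP; apply: (@small_eq0 _ 2) => eps eps0.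
have [I [d [ed H]]] := square_form_approx [:: x; x + x; x - x] eps0.
have [[d0 _] _] := ed; have := partition_form_polar x x d0.
have := H x; rewrite !inE eqxx => /(_ isT)/andP[a1 a2].
have := H (x + x); rewrite !inE eqxx orbT => /(_ isT)/andP[b1 b2].
have := H (x - x); rewrite !inE eqxx !orbT => /(_ isT)/andP[c1 c2].
by rewrite /hilbert_form ler_norml => E; apply/andP; split; lra.
Qed.

Lemma hilbert_form_ge0 x : 0 <= hilbert_form x x.
Proof.
rewrite hilbert_form_diag; apply: le_trans (partition_form_le x unit_partition).
by apply: sumr_ge0 => _ _; rewrite divr_ge0 ?phi_ge0 // -expr2 sqr_ge0.
Qed.

Lemma hilbert_form_bound x : hilbert_form x x <= (phi e + 1) * `|x| ^+ 2.
Proof. by rewrite hilbert_form_diag square_form_bound. Qed.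

(** The components where [y > eta e] and where [- y > eta e] already give a
    lower bound for the form. *)
Lemma hilbert_form_lower (eps delta : R) y : 0 < eps -> 0 < delta ->
  (forall g, component e g -> eps / 2 <= `|g| -> delta <= phi g) ->
  eps <= `|modulus y /\b e| ->
  (eps / (2 * (`|e| + 1))) ^+ 2 * delta <= hilbert_form y y.
Proof.
move=> eps0 delta0 large ye; set eta := eps / _.
have E0 : 0 < `|e| + 1 by rewrite ltr_wpDl.
have eta0 : 0 < eta by rewrite /eta divr_gt0 // mulr_gt0.
have eta_e : eta * `|e| <= eps / 2.
  have -> : eps / 2 = eta * (`|e| + 1) by rewrite /eta; field; rewrite gt_eqF.
  by rewrite ler_wpM2l ?lerDl // ltW.
have [g [eg g_ge g_sup g_disj]] := band_component oc e_ge0 (pos_ge0 (y - eta *: e)).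
have [h [eh h_ge h_sup h_disj]] := band_component oc e_ge0 (pos_ge0 (- y - eta *: e)).
have g0 := component_ge0 eg; have h0 := component_ge0 eh.
have etae0 : 0 <=b eta *: e by rewrite bleZ0 // ltW.
have below z : pos (z - eta *: e) <=b pos z.
  by apply: pos_mono; rewrite -bleDl ble_addl.
have gN : g /\b pos (- y) = 0.
  by apply: g_disj => //; apply: disj_le (pos_disjoint y).
have hP : h /\b pos y = 0.
  apply: h_disj => //; rewrite bmeetC.
  by apply: disj_le (pos_disjoint y).
have gh : g /\b h = 0.
  rewrite bmeetC; apply: h_disj => //; rewrite bmeetC; apply: g_disj => //.
  by apply: disj_le (pos_disjoint y).
have gh_e : g + h <=b e by apply: disj_add_le; rewrite ?(component_le eg) ?(component_le eh).
have rest0 : 0 <=b e - (g + h) by rewrite -ble_sub.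
have g_rest : g /\b (e - (g + h)) = 0.
  apply: disj_le eg => //; rewrite ble_sub (_ : _ - _ = h) //; vlin.
have h_rest : h /\b (e - (g + h)) = 0.
  apply: disj_le eh => //; rewrite ble_sub (_ : _ - _ = g) //; vlin.
pose d (o : option bool) := match o with
  | Some true => g | Some false => h | None => e - (g + h) end.
have ed : partition e d.
  split; last by rewrite big_option_sum big_bool /= subrK.
  split=> [[[]|]|[[]|] [[]|] ne] //=;
    first [by case: ne | by [] | by rewrite bmeetC].
have egh : component e (g + h) by rewrite /component disjDl.
have gh_norm : eps / 2 <= `|g + h|.
  have : `|modulus y /\b e| <= `|g + h| + eta * `|e|.
    rewrite -[eta in eta * _](ger0_norm (ltW eta0)) -normrZ.
    apply: le_trans (ler_normD _ _); apply: norm_ble0; first by rewrite bmeet_ge0.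
    set v := pos (y - eta *: e) + pos (- y - eta *: e).
    have v0 : 0 <=b v by rewrite bleD0.
    have yv : modulus y <=b v + eta *: e.
      apply: modulus_ble; rewrite bleDl; apply: ble_tr (pos_ge _) _; rewrite /v.
        exact: ble_addl.
      by rewrite [X in _ <=b X]addrC; exact: ble_addl.
    apply: (@ble_tr _ _ ((v + eta *: e) /\b e)); first exact: bmeet_mono.
    apply: ble_tr (bmeet_addl _ _ _) _ => //; apply: bleD; last exact: bmeetl.
    apply: ble_tr (bmeet_addl _ _ _) _ => //; apply: bleD.
      by have := g_ge 1; rewrite scale1r bmeetC; apply.
    by have := h_ge 1; rewrite scale1r bmeetC; apply.
  by lra.
have phi_gh := large _ egh gh_norm.
rewrite hilbert_form_diag; apply: le_trans (partition_form_le y ed).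
rewrite /partition_form big_option_sum big_bool /=.
have value c z : component e c -> c /\b pos (- z) = 0 -> eta *: c <=b pos z ->
    eta * phi c <= band_form phi c z.
  move=> ec cz cz'; have c0 := component_ge0 ec.
  have cl := band_form_lin phi_lin phi_ge0 c0.
  rewrite (pos_sub z) linB // [X in _ - X]band_form_disj // ?subr0; last by rewrite bmeetC.
  rewrite -(band_form_self phi_lin phi_ge0 c0) -linZ //.
  by apply: lin_mono => // x; exact: band_form_ge0.
have layer c z : (forall w, (forall k : nat, e /\b (k%:R *: pos (z - eta *: e)) <=b w) -> c <=b w) ->
    eta *: c <=b pos z.
  move=> sup; suff : c <=b eta^-1 *: pos z.
    by move=> /(bleZ (ltW eta0)); rewrite scalerA mulfV ?gt_eqF // scale1r.
  apply: sup => k; have := layer_le (z - eta *: e) e_ge0 eta0 (ler0n _ k).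
  rewrite subrK => /bleZ H; have := H eta^-1.
  by rewrite scalerA mulVf ?gt_eqF // scale1r; apply; rewrite invr_ge0 ltW.
have vg : eta * phi g <= band_form phi g y by apply: value => //; exact: layer.
have vh : eta * phi h <= band_form phi h (- y).
  by apply: value; rewrite ?opprK //; exact: layer.
have pg := phi_ge0 g0; have ph := phi_ge0 h0.
have square c v : 0 <= c -> eta * c <= v -> eta ^+ 2 * c <= v * v / c.
  move=> c0 cv; have [->|cN0] := eqVneq c 0; first by rewrite invr0 !mulr0.
  rewrite ler_pdivlMr; last by rewrite lt_def cN0.
  rewrite (_ : eta ^+ 2 * c * c = (eta * c) * (eta * c)); last by ring.
  by apply: ler_pM => //; rewrite mulr_ge0 // ltW.
have := square _ _ pg vg; have := square _ _ ph vh.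
have hl := band_form_lin phi_lin phi_ge0 h0.
rewrite linN // mulrNN.
have rest : 0 <= band_form phi (e - (g + h)) y * band_form phi (e - (g + h)) y / phi (e - (g + h)).
  by rewrite divr_ge0 ?phi_ge0 // -expr2 sqr_ge0.
have : eta ^+ 2 * delta <= eta ^+ 2 * (phi g + phi h).
  by rewrite ler_wpM2l ?sqr_ge0 // -linD.
by rewrite mulrDr; lra.
Qed.

End HilbertForm.

(** * The sequence spaces l_r *)

Section SequenceSpace.
Context {R : realType}.
Variables (r : R) (r_ge1 : 1 <= r).

Let r_gt0 : 0 < r. Proof. exact: lt_le_trans r_ge1. Qed.
Let r_neq0 : r != 0. Proof. by rewrite gt_eqF. Qed.

Definition power_sum (u : nat -> R) (N : nat) : R := \sum_(k < N) `|u k| `^ r.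

Lemma power_sum_ge0 u N : 0 <= power_sum u N.
Proof. by apply: sumr_ge0 => k _; exact: powR_ge0. Qed.

Let S (u : nat -> R) : \bar R := (\sum_(k <oo) (`|u k| `^ r)%:E)%E.

Let LnormE (u : nat -> R) : ('N[counting]_r%:E[EFin \o u])%E = (S u `^ r^-1)%E.
Proof. by rewrite Lnorm_counting. Qed.

Let S_ge (u : nat -> R) N : ((power_sum u N)%:E <= S u)%E.
Proof.
have := @nneseries_lim_ge R (fun k => (`|u k| `^ r)%:E) xpredT 0%N N.
rewrite /power_sum -sumEFin big_mkord; apply=> k _ _.
by rewrite lee_fin powR_ge0.
Qed.

Let S_le (u : nat -> R) (K : R) : (forall N, power_sum u N <= K) -> (S u <= K%:E)%E.
Proof.
move=> uK; apply: lime_le; first by apply: is_cvg_nneseries => k _ _; rewrite lee_fin powR_ge0.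
by apply: nearW => N; rewrite /= big_mkord sumEFin lee_fin; exact: uK.
Qed.

Let S_ge0 (u : nat -> R) : (0 <= S u)%E.
Proof. by apply: nneseries_ge0 => k _ _; rewrite lee_fin powR_ge0. Qed.

Lemma lp_norm_le (u : nat -> R) (K : R) : 0 <= K ->
  (forall N, power_sum u N <= K `^ r) -> lp_norm r u <= K.
Proof.
move=> K0 /S_le SK; rewrite /lp_norm LnormE.
have Sfin : S u \is a fin_num.
  by rewrite ge0_fin_numE // (le_lt_trans SK) // ltry.
rewrite -(fineK Sfin) poweR_EFin /= -[leRHS](powRK r_neq0 K0).
apply: powR_le; rewrite ?invr_ge0 ?(ltW r_gt0) ?fine_ge0 //.
by rewrite -lee_fin fineK.
Qed.

Lemma power_sum_le (p1 : (1 <= r%:E)%E) (u : LfunType (@counting nat R) p1) N :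
  power_sum u N <= lp_norm r u `^ r.
Proof.
have := @Lfunction_finite _ _ _ _ _ p1 u; rewrite /finite_norm LnormE => fin.
have Sfin : S u \is a fin_num.
  by rewrite ge0_fin_numE //; apply: lty_poweRy fin; rewrite invr_eq0.
rewrite /lp_norm LnormE -(fineK Sfin) poweR_EFin /= powRVK ?fine_ge0 //.
by rewrite -lee_fin fineK.
Qed.

Lemma power_sum_Lfun (p1 : (1 <= r%:E)%E) (u : nat -> R) (K : R) :
  (forall N, power_sum u N <= K) ->
  exists v : LfunType (@counting nat R) p1, forall n, v n = u n.
Proof.
move=> /S_le SK.
have uL : u \in Lfun (@counting nat R) r%:E.
  rewrite inE /=; apply/andP; split; first by rewrite inE.
  rewrite inE /finLfun /= /finite_norm LnormE.
  have Sfin : S u \is a fin_num by rewrite ge0_fin_numE // (le_lt_trans SK) // ltry.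
  by rewrite -(fineK Sfin) poweR_EFin ltry.
by exists (Lfun_Sub p1 uL).
Qed.

End SequenceSpace.

(** * Complemented copies of l_r from biorthogonal systems *)

Section BiorthogonalSystem.
Context {R : realType} {X : completeNormedModType R}.
Variables (r : R) (r_ge1 : 1 <= r).
Variables (z : nat -> X) (psi : nat -> X -> R) (A B : R).
Hypothesis A_ge0 : 0 <= A.
Hypothesis B_gt0 : 0 < B.
Hypothesis psi_lin : forall n, lin (psi n).
Hypothesis psi_z : forall n m, psi n (z m) = (n == m)%:R.
Hypothesis psi_bound : forall N x,
  \sum_(n < N) `|psi n x| `^ r <= (B * `|x|) `^ r.
Hypothesis z_bound : forall N (a : nat -> R),
  `|\sum_(n < N) a n *: z n| <= A * (\sum_(n < N) `|a n| `^ r) `^ r^-1.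

Let r_gt0 : 0 < r. Proof. exact: lt_le_trans r_ge1. Qed.
Let r_neq0 : r != 0. Proof. by rewrite gt_eqF. Qed.

Definition partial (a : nat -> R) (N : nat) : X := \sum_(n < N) a n *: z n.

Lemma partial_diff a m k :
  `|partial a (m + k) - partial a m| <=
  A * (power_sum r a (m + k) - power_sum r a m) `^ r^-1.
Proof.
pose b n := if (n < m)%N then 0 else a n.
have -> : partial a (m + k) - partial a m = \sum_(n < m + k) b n *: z n.
  rewrite /partial !big_split_ord /= addrC addrK.
  rewrite [X in _ = X + _]big1 ?add0r => [|i _]; last by rewrite /b ltn_ord scale0r.
  by apply: eq_bigr => i _; rewrite /b ltnNge leq_addr.
have -> : power_sum r a (m + k) - power_sum r a m = \sum_(n < m + k) `|b n| `^ r.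
  rewrite /power_sum !big_split_ord /= addrC addrK.
  rewrite [X in _ = X + _]big1 ?add0r => [|i _]; last by rewrite /b ltn_ord normr0 powR0.
  by apply: eq_bigr => i _; rewrite /b ltnNge leq_addr.
exact: z_bound.
Qed.

(** The bound on finite sums, applied to a block of the sequence, shows that the
    partial sums are Cauchy. *)
Lemma partial_cvg a (K : R) : (forall N, power_sum r a N <= K) ->
  exists l : X, partial a @ \oo --> l.
Proof.
move=> aK; apply: cauchy_eps_cvg => eps eps0.
have ps_mono m n : (m <= n)%N -> power_sum r a m <= power_sum r a n.
  by move=> /subnKC <-; rewrite /power_sum big_split_ord lerDl sumr_ge0.
have : cvgn (power_sum r a).
  apply: nondecreasing_is_cvgn; first by move=> m n; exact: ps_mono.
  by exists K => _ [n _ <-].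
have A1 : 0 < A + 1 by rewrite ltr_wpDl.
have del0 : 0 < (eps / (A + 1)) `^ r by rewrite powR_gt0 // divr_gt0.
move=> /(cvg_epsP _ _).1/(_ (((eps / (A + 1)) `^ r) / 2)); rewrite divr_gt0 //.
move=> /(_ isT)[N HN]; exists N => n Nn.
have -> : n = (N + (n - N))%N by rewrite subnKC.
apply: le_lt_trans (partial_diff _ _ _) _; rewrite subnKC //.
set d := power_sum r a n - _.
have d0 : 0 <= d by rewrite subr_ge0 ps_mono.
have dlt : d < (eps / (A + 1)) `^ r.
  have := HN n Nn; have := HN N (leqnn N); rewrite !ltr_norml /d.
  by move=> /andP[? ?] /andP[? ?]; lra.
have : d `^ r^-1 <= eps / (A + 1).
  rewrite -[leRHS](powRK r_neq0); last by rewrite divr_ge0 ?ltW.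
  by apply: powR_le; rewrite ?invr_ge0 ?(ltW r_gt0) // ltW.
have : 0 <= d `^ r^-1 := powR_ge0 _ _.
move=> d'0 d'le; apply: (@le_lt_trans _ _ (A * (eps / (A + 1)))).
  by rewrite ler_wpM2l.
by rewrite mulrCA gtr_pMr // ltr_pdivrMr // mul1r ltrDl.
Qed.

Definition synthesis (a : nat -> R) : X := lim (partial a @ \oo).

Lemma synthesis_cvg a (K : R) : (forall N, power_sum r a N <= K) ->
  partial a @ \oo --> synthesis a.
Proof. by move=> /partial_cvg[l al]; apply: (cvgP l). Qed.

Lemma synthesis_norm a (K : R) : 0 <= K -> (forall N, power_sum r a N <= K `^ r) ->
  `|synthesis a| <= A * K.
Proof.
move=> K0 aK; apply: cvg_norm_le (synthesis_cvg aK) _ => N.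
apply: le_trans (z_bound _ _) _; rewrite ler_wpM2l //.
rewrite -[leRHS](powRK r_neq0) //; apply: powR_le; rewrite ?invr_ge0 ?(ltW r_gt0) //; last exact: aK.
exact: power_sum_ge0.
Qed.

Lemma psi_norm n x : `|psi n x| <= B * `|x|.
Proof.
have Bx : 0 <= B * `|x| by rewrite mulr_ge0 // ltW.
apply: (powR_le_inv r_gt0) => //; apply: le_trans (psi_bound n.+1 x).
by rewrite big_ord_recr /= lerDr sumr_ge0 // => i _; exact: powR_ge0.
Qed.

Lemma psi_partial n a N : psi n (partial a N) = if (n < N)%N then a n else 0.
Proof.
rewrite /partial lin_sum //.
under eq_bigr do rewrite linZ // psi_z.
have [nN|Nn] := ltnP n N.
  rewrite (bigD1 (Ordinal nN)) //= eqxx mulr1 big1 ?addr0 // => i ne.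
  suff -> : (n == i :> nat) = false by rewrite mulr0.
  by apply/negbTE; apply: contra ne => /eqP ni; apply/eqP/val_inj.
rewrite big1 // => i _; suff -> : (n == i :> nat) = false by rewrite mulr0.
by rewrite gtn_eqF // (leq_trans (ltn_ord i)).
Qed.

Lemma psi_synthesis n a (K : R) : (forall N, power_sum r a N <= K) ->
  psi n (synthesis a) = a n.
Proof.
move=> /synthesis_cvg/cvg_epsP aC; apply/eqP; rewrite -subr_eq0 -normr_le0.
apply/ler_addgt0Pr => eps eps0; rewrite add0r.
have [N HN] := aC (eps / B) (divr_gt0 eps0 B_gt0).
pose m := maxn N n.+1.
have -> : a n = psi n (partial a m) by rewrite psi_partial leq_maxr.
rewrite -linB //; apply: le_trans (psi_norm _ _) _.
by rewrite -ler_pdivlMl // mulrC -normrN opprB ltW // HN // leq_maxl.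
Qed.

Lemma power_sum_psi x N : power_sum r (fun n => psi n x) N <= (B * `|x|) `^ r.
Proof. exact: psi_bound. Qed.

Definition projection x : X := synthesis (fun n => psi n x).

Lemma synthesis_lin (c : R) a b d (K L : R) : (forall N, power_sum r a N <= K) ->
  (forall N, power_sum r b N <= L) -> (forall n, d n = c * a n + b n) ->
  synthesis d = c *: synthesis a + synthesis b.
Proof.
move=> aK bL dE; apply: cvg_lim => //.
have -> : partial d = fun N => c *: partial a N + partial b N.
  apply/funext => N; rewrite /partial scaler_sumr -big_split; apply: eq_bigr => n _.
  by rewrite dE scalerDl scalerA.
by apply: cvgD (synthesis_cvg bL); apply: cvgZr; exact: synthesis_cvg aK.
Qed.

Lemma projection_lin : linear projection.
Proof.
move=> c x y; apply: synthesis_lin (power_sum_psi x) (power_sum_psi y) _ => n.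
exact: psi_lin.
Qed.

Lemma projection_norm x : `|projection x| <= A * B * `|x|.
Proof.
rewrite -mulrA; apply: synthesis_norm (power_sum_psi x).
by rewrite mulr_ge0 // ltW.
Qed.

Lemma projection_synthesis a (K : R) : (forall N, power_sum r a N <= K) ->
  projection (synthesis a) = synthesis a.
Proof.
move=> aK; rewrite /projection; congr synthesis; apply/funext => n.
exact: psi_synthesis aK.
Qed.

(** The range contains all the [z m], and [n.+1] vectors in the span of [n] vectors
    satisfy a linear relation, which the [psi k] rule out. *)
Lemma range_projection_infinite : infinite_dimensional (range projection).
Proof.
move=> [n [e span]].
have zZ m : range projection (z m).
  exists (z m) => //.
  have -> : projection (z m) = synthesis (fun k => (k == m)%:R).
    by congr synthesis; apply/funext => k; rewrite psi_z.
  apply: cvg_lim => //; apply/cvg_epsP => eps eps0; exists m.+1 => N mN.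
  suff -> : partial (fun k => (k == m)%:R) N = z m by rewrite subrr normr0.
  rewrite /partial (bigD1 (Ordinal mN)) //= eqxx scale1r big1 ?addr0 // => i ne.
  suff -> : (i == m :> nat) = false by rewrite scale0r.
  by apply/negbTE; apply: contra ne => /eqP im; apply/eqP/val_inj.
have /choice[c zE] (m : 'I_n.+1) : exists c : 'I_n -> R, z m = \sum_(i < n) c i *: e i.
  exact: span.
pose C : 'M[R]_(n.+1, n) := \matrix_(m, i) c m i.
have : kermx C != 0.
  rewrite kermx_eq0 /row_free neq_ltn; apply/orP; left.
  by apply: leq_ltn_trans (rank_leq_col _) _.
case/rowV0Pn => v /sub_kermxP vC v0; case/negP: v0; apply/eqP/rowP => k.
have : psi k (\sum_(m < n.+1) v 0 m *: z m) = v 0 k.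
  rewrite lin_sum // (bigD1 k) //= linZ // psi_z eqxx mulr1 big1 ?addr0 // => i ne.
  rewrite linZ // psi_z (_ : (k == i :> nat) = false) ?mulr0 //.
  by apply/negbTE; rewrite eq_sym.
rewrite mxE => <-; have -> : \sum_(m < n.+1) v 0 m *: z m = 0; last exact: lin0.
under eq_bigr do rewrite zE scaler_sumr; rewrite exchange_big big1 // => i _.
have := congr1 (fun W : 'rV_n => W 0 i) vC; rewrite !mxE => vCi.
under eq_bigr do rewrite scalerA; rewrite -scaler_suml.
rewrite (_ : \sum_(m < n.+1) _ = 0) ?scale0r // -[RHS]vCi.
by apply: eq_bigr => m _; rewrite mxE.
Qed.

HB.instance Definition _ := GRing.isLinear.Build R X X *:%R projection projection_lin.

Lemma projection_continuous : continuous projection.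
Proof.
apply: bounded_linear_continuous; apply/linear_boundedP.
near=> M => x; apply: le_trans (projection_norm x) _.
by rewrite ler_wpM2r.
Unshelve. all: by end_near. Qed.

Lemma projectionK x : projection (projection x) = projection x.
Proof. exact: projection_synthesis (power_sum_psi x). Qed.

Lemma range_projection_closed : closed (range projection).
Proof.
have -> : range projection = (fun x => projection x - x) @^-1` [set 0].
  apply/seteqP; split=> [_ [x _ <-]|x /= /eqP]; first by rewrite /= projectionK subrr.
  by rewrite subr_eq0 => /eqP xE; exists x.
apply: closed_comp; last first.
  exact/accessible_closed_set1/hausdorff_accessible/norm_hausdorff.
by move=> x _; apply: cvgB; [exact: projection_continuous|exact: cvg_id].
Qed.

Lemma range_projection_isomorphic : isomorphic_lp (range projection) r.
Proof.
have p1 : (1 <= r%:E)%E by rewrite lee_fin.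
pose f (u : LfunType (@counting nat R) p1) : X := synthesis u.
have f_lin : linear f.
  move=> c u v; apply: synthesis_lin (power_sum_le r_ge1 u) (power_sum_le r_ge1 v) _.
  by [].
pose F : {linear LfunType (@counting nat R) p1 -> X} :=
  HB.pack f (GRing.isLinear.Build R _ _ _ f f_lin).
have norm0 (u : LfunType (@counting nat R) p1) : 0 <= lp_norm r u.
  by rewrite /lp_norm fine_ge0 // Lnorm_ge0.
exists p1, F, B^-1, A; split; first by rewrite invr_gt0.
  move=> u; apply/andP; split.
    rewrite ler_pdivrMl //; apply: lp_norm_le => //; first by rewrite mulr_ge0 // ltW.
    move=> N; apply: le_trans (psi_bound N _).
    apply: ler_sum => n _; rewrite /= /f.
    by rewrite (psi_synthesis n (power_sum_le r_ge1 u)).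
  by apply: synthesis_norm (power_sum_le r_ge1 u).
apply/seteqP; split=> [_ [u _ <-]|_ [x _ <-]].
  by exists (f u) => //; exact: projection_synthesis (power_sum_le r_ge1 u).
have [v vE] := power_sum_Lfun r_ge1 p1 (power_sum_psi x).
by exists v => //; rewrite /= /f; congr synthesis; apply/funext.
Qed.

(** The analysis map [x |-> (psi n x)] followed by the synthesis map
    [a |-> \sum a n *: z n] is the projection; synthesis is an isomorphism of l_r
    onto its range because analysis inverts it. *)
Theorem biorthogonal_copy (Y : set X) : submod_closed (mem Y) -> closed Y ->
  (forall n, Y (z n)) ->
  exists Z : set X, [/\ Z `<=` Y, subspace_inf Z, complemented Z & isomorphic_lp Z r].
Proof.
move=> [Y0 Ylin] Ycl Yz; exists (range projection); split.
- move=> _ [x _ <-].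
  apply: (closed_cvg (F := \oo) Y Ycl _ _ (synthesis_cvg (power_sum_psi x))).
  apply: nearW => N; rewrite /partial.
  elim: N => [|N IH]; first by rewrite big_ord0; exact: set_mem.
  rewrite big_ord_recr /= addrC; apply: set_mem; apply: Ylin; exact: mem_set.
- split; [|exact: range_projection_closed|exact: range_projection_infinite].
  split; first by apply: mem_set; exists 0 => //; exact: linear0.
  move=> a u v /set_mem[x _ <-] /set_mem[y _ <-]; apply: mem_set.
  by exists (a *: x + y) => //; exact: projection_lin.
- exists projection; split=> //; first exact: projection_continuous.
  exact: projectionK.
- exact: range_projection_isomorphic.
Qed.

End BiorthogonalSystem.

(** * Subspaces on which a Hilbertian form controls the norm *)

Section HilbertSubspace.
Context {R : realType} {X : completeNormedModType R}.
Variables (b : X -> X -> R) (C kappa : R) (Y : set X).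
Hypothesis b_lin : forall y, lin (fun x => b x y).
Hypothesis bC : forall x y, b x y = b y x.
Hypothesis b_ge0 : forall x, 0 <= b x x.
Hypothesis C_ge0 : 0 <= C.
Hypothesis b_bound : forall x, b x x <= C * `|x| ^+ 2.
Hypothesis kappa_gt0 : 0 < kappa.
Hypothesis Y_inf : subspace_inf Y.
Hypothesis b_lower : forall y, Y y -> kappa * `|y| ^+ 2 <= b y y.

Let bl y := b_lin y.

Lemma subspace_sum (I : Type) (s : seq I) (c : I -> R) (f : I -> X) :
  (forall i, Y (f i)) -> Y (\sum_(i <- s) c i *: f i).
Proof.
move=> Yf; have [[Y0 Ylin] _ _] := Y_inf.
elim: s => [|i s IH]; first by rewrite big_nil; exact: set_mem.
by rewrite big_cons; apply: set_mem; apply: Ylin; exact: mem_set.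
Qed.

(** A vector of [Y] outside the span of the given ones exists by infinite dimension;
    what remains after orthogonal projection is nonzero, and the lower bound on [Y]
    makes it normalizable. *)
Lemma gram_schmidt_step (n : nat) (z : nat -> X) :
  (forall i, (i < n)%N -> Y (z i)) ->
  (forall i j, (i < n)%N -> (j < n)%N -> b (z i) (z j) = (i == j)%:R) ->
  exists y, [/\ Y y, b y y = 1 & forall i, (i < n)%N -> b y (z i) = 0].
Proof.
move=> Yz zz; have [[Y0 Ylin] _ Yinf] := Y_inf.
have [y0 [Yy0 y0span]] : exists y0, Y y0 /\
    forall c : 'I_n -> R, y0 <> \sum_(i < n) c i *: z i.
  apply: contrapT => /forallNP no; apply: Yinf; exists n, (fun i => z i) => y Yy.
  apply: contrapT => /forallNP nc; apply: (no y); split=> // c; exact: nc.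
pose y1 := y0 - \sum_(i < n) b y0 (z i) *: z i.
have Yy1 : Y y1.
  rewrite /y1 addrC -scaleN1r; apply: set_mem; apply: Ylin; apply: mem_set => //.
  by apply: subspace_sum => i; exact: Yz.
have y1z i : (i < n)%N -> b y1 (z i) = 0.
  move=> i_n; rewrite /y1 (linB _ _ (bl _)) (lin_sum _ _ _ (bl _)).
  rewrite (bigD1 (Ordinal i_n)) //= big1 => [|j ne].
    by rewrite (linZ _ _ (bl _)) zz // eqxx mulr1 addr0 subrr.
  rewrite (linZ _ _ (bl _)) zz // (_ : (j == i :> nat) = false) ?mulr0 //.
  by apply/negbTE; apply: contra ne => /eqP ji; apply/eqP/val_inj.
have y1N0 : y1 != 0.
  by apply/eqP => /eqP; rewrite subr_eq0 => /eqP; exact: y0span.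
have b1 : 0 < b y1 y1.
  apply: lt_le_trans (b_lower Yy1); rewrite mulr_gt0 // exprn_gt0 //.
  by rewrite normr_gt0.
pose s := Num.sqrt (b y1 y1); have s0 : 0 < s by rewrite sqrtr_gt0.
exists (s^-1 *: y1); split.
- rewrite -[_ *: _]addr0; apply: set_mem; apply: Ylin => //; exact: mem_set.
- rewrite (linZ _ _ (bl _)) bC (linZ _ _ (bl _)) mulrA -expr2 exprVn sqr_sqrtr.
    by rewrite mulVf ?gt_eqF.
  exact: ltW.
- by move=> i i_n; rewrite (linZ _ _ (bl _)) y1z // mulr0.
Qed.

Lemma gram_schmidt : exists z : nat -> X, (forall n, Y (z n)) /\
  forall i j, b (z i) (z j) = (i == j)%:R.
Proof.
pose good (n : nat) (s : nat -> X) := (forall i, (i < n)%N -> Y (s i)) /\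
  forall i j, (i < n)%N -> (j < n)%N -> b (s i) (s j) = (i == j)%:R.
have /choice[F HF] (l : seq X) : exists y, good (size l) (nth 0 l) ->
    [/\ Y y, b y y = 1 & forall i, (i < size l)%N -> b y l`_i = 0].
  have [[Yl ll]|bad] := pselect (good (size l) (nth 0 l)); last by exists 0.
  by have [y H] := gram_schmidt_step Yl ll; exists y.
pose U := fix U n := if n is n'.+1 then rcons (U n') (F (U n')) else [::].
pose z n := F (U n).
have sizeU n : size (U n) = n by elim: n => // n IH; rewrite /= size_rcons IH.
have nthU n i : (i < n)%N -> (U n)`_i = z i.
  elim: n => // n IH; rewrite ltnS leq_eqVlt /= nth_rcons sizeU => /orP[/eqP->|i_n].
    by rewrite ltnn eqxx.
  by rewrite i_n IH.
have step n : good n z -> [/\ Y (z n), b (z n) (z n) = 1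
    & forall i, (i < n)%N -> b (z n) (z i) = 0].
  move=> [Yz zz]; have [|Yn nn nz] := HF (U n).
    rewrite sizeU; split=> [i i_n|i j i_n j_n]; rewrite !nthU //; first exact: Yz.
    exact: zz.
  by split=> // i i_n; have := nz i; rewrite sizeU nthU //; apply.
have all n : good n z.
  elim: n => [|n IH]; first by split.
  have [Yn nn nz] := step n IH; have [Yz zz] := IH.
  split=> [i|i j]; rewrite !ltnS leq_eqVlt.
    by move=> /orP[/eqP->//|/Yz].
  rewrite [(j <= n)%N]leq_eqVlt => /orP[/eqP->|i_n] /orP[/eqP->|j_n].
  - by rewrite eqxx.
  - by rewrite nz // gtn_eqF.
  - by rewrite bC nz // ltn_eqF.
  - exact: zz.
exists z; split=> [n|i j]; first by have [] := step n (all n).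
by have [_] := all (maxn i j).+1; apply; rewrite ltnS ?leq_maxl ?leq_maxr.
Qed.

(** Orthonormality bounds the synthesis map by the lower estimate on [Y], and
    Bessel's inequality bounds the analysis map by the upper estimate on [X]. *)
Theorem hilbert_subspace : exists Z : set X,
  [/\ Z `<=` Y, subspace_inf Z, complemented Z & isomorphic_lp Z 2].
Proof.
have [z [Yz zz]] := gram_schmidt; have [Ysub Ycl _] := Y_inf.
have sq (a : R) : `|a| `^ 2 = a ^+ 2 by rewrite powR_mulrn // real_normK ?num_real.
have sumz N (a : nat -> R) : b (\sum_(n < N) a n *: z n) (\sum_(n < N) a n *: z n) =
    \sum_(n < N) a n ^+ 2.
  rewrite (lin_sum _ _ _ (bl _)); apply: eq_bigr => n _.
  rewrite (linZ _ _ (bl _)) bC (lin_sum _ _ _ (bl _)) (bigD1 n) //= big1 => [|i ne].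
    by rewrite (linZ _ _ (bl _)) zz eqxx mulr1 addr0 expr2.
  rewrite (linZ _ _ (bl _)) zz (_ : (i == n :> nat) = false) ?mulr0 //.
  by apply/negbTE; apply: contra ne => /eqP ji; apply/eqP/val_inj.
have kV0 : 0 <= kappa^-1 by rewrite invr_ge0 ltW.
have two : 2 != 0 :> R by rewrite pnatr_eq0.
apply: (@biorthogonal_copy _ _ 2 _ z (fun n x => b x (z n)) (kappa^-1 `^ 2^-1) (C + 1)) => //.
- by rewrite ler1n.
- exact: powR_ge0.
- by rewrite ltr_wpDl.
- by move=> n m; rewrite bC zz.
- move=> N x; have -> : ((C + 1) * `|x|) `^ 2 = ((C + 1) * `|x|) ^+ 2.
    by rewrite -sq ger0_norm // mulr_ge0 // addr_ge0.
  under eq_bigr do rewrite sq.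
  set S := \sum_(n < N) _; pose s := \sum_(n < N) b x (z n) *: z n.
  have bss : b s s = S by exact: (sumz N (fun n => b x (z n))).
  have bsx : b s x = S.
    rewrite (lin_sum _ _ _ (bl _)); apply: eq_bigr => n _.
    by rewrite (linZ _ _ (bl _)) (bC (z n)) expr2.
  have : 0 <= b (x - s) (x - s) := b_ge0 _.
  rewrite (linB _ _ (bl _)) (bC x) (bC s) !(linB _ _ (bl _)) bss bsx (bC x s) bsx => H.
  have Sb : S <= b x x by lra.
  apply: le_trans Sb _; apply: le_trans (b_bound x) _; rewrite exprMn.
  by rewrite ler_wpM2r ?sqr_ge0 // expr2; nra.
- move=> N a; apply: (@powR_le_inv _ 2) => //.
    by rewrite mulr_ge0 ?powR_ge0.
  rewrite powRM ?powR_ge0 // !powRVK //; last by apply: sumr_ge0 => i _; exact: powR_ge0.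
  under [X in _ <= _ * X]eq_bigr do rewrite sq.
  rewrite -sumz ler_pdivlMl // powR_mulrn //; apply: b_lower; exact: subspace_sum.
Qed.

End HilbertSubspace.

(** * Geometric series and perturbation of the identity *)

Section Perturbation.
Context {R : realType} {X : completeNormedModType R}.

Lemma geo_sum_le (m k : nat) : \sum_(i < k) 2^-1 ^+ (m + i) <= 2 * 2^-1 ^+ m :> R.
Proof.
suff -> : \sum_(i < k) 2^-1 ^+ (m + i) = 2 * 2^-1 ^+ m - 2 * 2^-1 ^+ (m + k) :> R.
  by rewrite lerBlDr lerDl mulr_ge0 // exprn_ge0 // invr_ge0.
elim: k => [|k IH]; first by rewrite big_ord0 addn0 subrr.
by rewrite big_ord_recr /= IH addnS exprS; lra.
Qed.

Lemma geometric_series (w : nat -> X) (K : R) :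
  (forall n, `|w n| <= K * 2^-1 ^+ n) ->
  exists W, (fun N => \sum_(n < N) w n) @ \oo --> W /\
    forall N, `|W - \sum_(n < N) w n| <= K * (2 * 2^-1 ^+ N).
Proof.
move=> wK; have K0 : 0 <= K by have := wK 0%N; rewrite expr0 mulr1; apply: le_trans.
have tail m k : `|\sum_(n < m + k) w n - \sum_(n < m) w n| <= K * (2 * 2^-1 ^+ m).
  rewrite big_split_ord /= addrC addrK; apply: le_trans (ler_norm_sum _ _ _) _.
  apply: le_trans (ler_sum _ (fun i _ => wK _)) _; rewrite -mulr_sumr.
  by rewrite ler_wpM2l // geo_sum_le.
have [W WC] : exists W : X, (fun N => \sum_(n < N) w n) @ \oo --> W.
  apply: cauchy_eps_cvg => eps eps0.
  have K1 : 0 < 2 * (K + 1) by rewrite mulr_gt0 // ltr_wpDl.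
  have [N HN] := geo_small (divr_gt0 eps0 K1).
  exists N => n Nn; rewrite -(subnKC Nn); apply: le_lt_trans (tail _ _) _.
  have := HN; rewrite ltr_pdivlMr // => lt.
  have : 0 <= 2^-1 ^+ N :> R by rewrite exprn_ge0 // invr_ge0.
  by move: lt; set q := 2^-1 ^+ N; nra.
exists W; split=> // N; have WN := cvgB WC (cvg_cst (\sum_(n < N) w n)).
apply: (@cvg_norm_le _ _ (fun k => \sum_(n < N + k) w n - \sum_(n < N) w n)) => //.
apply: cvgB; last exact: cvg_cst.
exact: (cvg_addn N WC).
Qed.

(** [G v] is the unique solution of [w = v + D w], the sum of the series of the
    [D^n v]; uniqueness makes it linear in [v]. *)
Lemma neumann_inverse (D : X -> X) : linear D -> (forall x, `|D x| <= 2^-1 * `|x|) ->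
  exists G : X -> X, [/\ linear G, forall x, G (x - D x) = x
    & forall x, `|G x| <= 2 * `|x|].
Proof.
move=> Dlin Dhalf.
have DB x y : D (x - y) = D x - D y.
  by have := Dlin (-1) y x; rewrite !scaleN1r ![- _ + _]addrC.
have D0 : D 0 = 0 by have := DB 0 0; rewrite !subrr.
have uniq v w w' : w = v + D w -> w' = v + D w' -> w = w'.
  move=> wE w'E; apply/eqP; rewrite -subr_eq0 -normr_le0.
  have : w - w' = D (w - w') by rewrite DB {1}wE {1}w'E; vlin.
  by move=> E; have := Dhalf (w - w'); rewrite -E; lra.
have sol v : exists w, w = v + D w.
  pose w n := iter n D v.
  have wn n : `|w n| <= `|v| * 2^-1 ^+ n.
    elim: n => [|n IH]; first by rewrite expr0 mulr1.
    by rewrite /= exprS mulrCA (le_trans (Dhalf _)) // ler_wpM2l // invr_ge0.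
  have [W [WC _]] := geometric_series wn; exists W.
  have DW : (fun N => v + D (\sum_(n < N) w n)) @ \oo --> v + D W.
    apply/cvg_epsP => eps eps0; have [N HN] := (cvg_epsP _ _).1 WC eps eps0.
    exists N => n Nn; rewrite opprD addrACA subrr add0r -DB.
    apply: le_lt_trans (HN n Nn); apply: le_trans (Dhalf _) _.
    by rewrite ler_piMl // invf_le1 // ler1n.
  have WS : (fun N => \sum_(n < N.+1) w n) @ \oo --> W by exact: (cvg_addn 1 WC).
  have SE : (fun N => \sum_(n < N.+1) w n) = (fun N => v + D (\sum_(n < N) w n)).
    apply/funext => N; rewrite big_ord_recl; congr (_ + _).
    elim: N => [|N IH]; first by rewrite !big_ord0 D0.
    rewrite !big_ord_recr /= IH.
    by have := Dlin 1 (w N) (\sum_(n < N) w n); rewrite !scale1r => DS; rewrite [in RHS]addrC DS addrC.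
  by rewrite SE in WS; exact: cvg_unique WS DW.
have /choice[G GE] := sol; exists G; split=> [a x y|x|x].
- apply: (uniq (a *: x + y)); first exact: GE.
  by rewrite Dlin {1}(GE x) {1}(GE y); vlin.
- by apply: (uniq (x - D x)); [exact: GE|rewrite subrK].
- have : `|G x| <= `|x| + 2^-1 * `|G x|.
    rewrite {1}(GE x); apply: le_trans (ler_normD _ _) _.
    by rewrite lerD2l Dhalf.
  by lra.
Qed.

Variables (r : R) (r_ge1 : 1 <= r).

(** The operator [D v = \sum psi n v *: (x n - y n)] has norm at most [1/2], so
    [1 - D] is invertible; it maps [x n] to [y n], and composing the [psi n] with its
    inverse gives functionals biorthogonal to the [y n]. *)
Theorem perturbed_copy (Y : set X) (x y : nat -> X) (psi : nat -> X -> R) (A B eta : R) :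
  submod_closed (mem Y) -> closed Y -> (forall n, Y (y n)) ->
  0 <= A -> 0 < B -> (forall n, lin (psi n)) ->
  (forall n m, psi n (x m) = (n == m)%:R) ->
  (forall N v, \sum_(n < N) `|psi n v| `^ r <= (B * `|v|) `^ r) ->
  (forall N (a : nat -> R),
    `|\sum_(n < N) a n *: x n| <= A * (\sum_(n < N) `|a n| `^ r) `^ r^-1) ->
  0 <= eta -> B * eta <= 4^-1 -> (forall n, `|x n - y n| <= eta * 2^-1 ^+ n) ->
  exists Z : set X, [/\ Z `<=` Y, subspace_inf Z, complemented Z & isomorphic_lp Z r].
Proof.
move=> Ysub Ycl Yy A0 B0 psil psix psiB xA eta0 Beta xy.
have r_gt0 : 0 < r by exact: lt_le_trans r_ge1.
have psin n v : `|psi n v| <= B * `|v| by exact: (psi_norm r_ge1 B0 psiB).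
have term v n : `|psi n v *: (x n - y n)| <= (B * `|v| * eta) * 2^-1 ^+ n.
  by rewrite normrZ -mulrA ler_pM.
have /choice[D DE] v := geometric_series (term v).
have Dl : linear D.
  move=> c u v; have [Du _] := DE u; have [Dv _] := DE v; have [Duv _] := DE (c *: u + v).
  apply: cvg_unique Duv _ => //.
  rewrite (_ : (fun _ => _) = (fun N => c *: (\sum_(n < N) psi n u *: (x n - y n)) +
      \sum_(n < N) psi n v *: (x n - y n))).
    by apply: cvgD Dv; exact: cvgZr.
  apply/funext => N; rewrite scaler_sumr -big_split; apply: eq_bigr => n _.
  by rewrite psil scalerDl scalerA.
have Dhalf v : `|D v| <= 2^-1 * `|v|.
  have [_ /(_ 0%N)] := DE v; rewrite big_ord0 subr0 expr0 mulr1; move/le_trans; apply.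
  have := ler_wpM2r (normr_ge0 v) Beta; rewrite mulrAC; set Bn := B * `|v| * eta.
  by move=> H; lra.
have Dx m : D (x m) = x m - y m.
  have [Dm _] := DE (x m); apply: cvg_unique Dm _ => //.
  apply/cvg_epsP => eps eps0; exists m.+1 => N mN.
  rewrite (bigD1 (Ordinal mN)) //= psix eqxx scale1r big1 ?addr0 ?subrr ?normr0 //.
  move=> i ne; rewrite psix (_ : (i == m :> nat) = false) ?scale0r //.
  by apply/negbTE; apply: contra ne => /eqP im; apply/eqP/val_inj.
have [G [Gl GK G2]] := neumann_inverse Dl Dhalf.
have Gy m : G (y m) = x m by rewrite -[in RHS](GK (x m)) Dx opprB addrC subrK.
apply: (@biorthogonal_copy _ _ r r_ge1 y (fun n v => psi n (G v)) (2 * A) (2 * B)) => //.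
- by rewrite mulr_ge0.
- by rewrite mulr_gt0.
- by move=> n a u v; rewrite Gl psil.
- by move=> n m; rewrite Gy.
- move=> N v; apply: le_trans (psiB _ _) _; apply: powR_le; first exact: ltW.
    by rewrite mulr_ge0 // ltW.
  by have := ler_wpM2l (ltW B0) (G2 v); lra.
- move=> N a; have -> : \sum_(n < N) a n *: y n =
      \sum_(n < N) a n *: x n - D (\sum_(n < N) a n *: x n).
    have -> : D (\sum_(n < N) a n *: x n) = \sum_(n < N) a n *: (x n - y n).
      elim: N => [|N IH].
        rewrite !big_ord0; have := Dl (-1) 0 0.
        by rewrite scaler0 addr0 scaleN1r addNr.
      by rewrite !big_ord_recr /= addrC Dl Dx IH addrC.
    by rewrite -sumrB; apply: eq_bigr => n _; rewrite scalerBr opprB addrC subrK.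
  apply: le_trans (ler_normB _ _) _.
  set s := \sum_(n < N) a n *: x n; have := Dhalf s; have := xA N a; rewrite -/s -mulrA.
  by have := normr_ge0 s; lra.
Qed.

End Perturbation.

(** * Almost disjoint sequences *)

Section AlmostDisjoint.
Context {R : realType} {X : banachLatticeType R}.
Implicit Types x y u v e : X.

Lemma opp_ble x : 0 <=b x -> - x <=b x.
Proof. by move=> x0; apply: (ble_tr _ x0); rewrite -bleN opprK oppr0. Qed.

(** [y] with the part of its modulus up to [u] removed. *)
Definition shrink y u : X := pos (pos y - u) - pos (pos (- y) - u).

Lemma shrink_modulus y u : 0 <=b u -> modulus (shrink y u) <=b pos (modulus y - u).
Proof.
move=> u0; set a := pos (pos y - u); set c := pos (pos (- y) - u).
have a0 : 0 <=b a := pos_ge0 _; have c0 : 0 <=b c := pos_ge0 _.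
have ac : a /\b c = 0 by apply: disj_le (pos_disjoint y) => //; exact: pos_sub_le.
apply: (@ble_tr _ _ (a + c)); last first.
  apply: disj_add_le => //; apply: pos_mono; rewrite bleD2r.
    exact: pos_modulus.
  exact: posN_modulus.
apply: modulus_ble; rewrite ?opprB; first by rewrite bleD // opp_ble.
by rewrite addrC bleD // opp_ble.
Qed.

Lemma shrink_dist y u : 0 <=b u -> modulus (y - shrink y u) <=b modulus y /\b u.
Proof.
move=> u0; have E : y - shrink y u = pos y /\b u - pos (- y) /\b u.
  by rewrite /shrink !pos_meet {1}(pos_sub y); vlin.
have p0 z : 0 <=b pos z /\b u by rewrite bmeet_ge0.
apply: (@ble_tr _ _ (pos y /\b u + pos (- y) /\b u)).
  rewrite E; apply: modulus_ble; first by rewrite bleD // opp_ble.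
  by rewrite opprB [X in _ <=b X]addrC bleD // opp_ble.
apply: disj_add_le => //.
- by apply: disj_le (pos_disjoint y) => //; exact: bmeetl.
- by apply: bmeet_mono => //; exact: pos_modulus.
- by apply: bmeet_mono => //; exact: posN_modulus.
Qed.

(** If the unit sphere of [Y] meets every neighbourhood of being disjoint from a
    given element, choose [y_n] almost disjoint from a large multiple of its
    predecessors; removing from [y_n] what lies below its predecessors, and below
    small multiples of its successors, makes the sequence disjoint. *)
Theorem almost_disjoint_sequence (Y : set X) :
  (forall e (eps : R), 0 <=b e -> 0 < eps ->
     exists y, [/\ Y y, `|y| = 1 & `|modulus y /\b e| < eps]) ->
  exists y x : nat -> X, [/\ forall n, Y (y n), forall n, `|x n| = 1,
    forall m n, m <> n -> lattice_disjoint (x m) (x n)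
    & forall n, `|x n - y n| <= 2^-1 ^+ n].
Proof.
move=> small.
(* The offset 3 keeps all perturbations below 1/4, so that the disjoint vectors can
   be normalized. *)
pose t n : R := 2 ^+ (n + 3); pose s n : R := 2^-1 ^+ (n + 3).
have t0 n : 0 < t n by rewrite exprn_gt0.
have s0 n : 0 < s n by rewrite exprn_gt0 // invr_gt0.
have ts n : t n * s n = 1 by rewrite /t /s -exprMn mulfV ?pnatr_eq0 // expr1n.
have sE n : s n = 8^-1 * 2^-1 ^+ n by rewrite /s exprD !exprS expr0; field.
have /choice[F HF] (l : seq X) : exists y, [/\ Y y, `|y| = 1 &
    `|modulus y /\b (t (size l) *: \sum_(v <- l) modulus v)| < s (size l)].
  by apply: small => //; rewrite bleZ0 ?(ltW (t0 _)) // sum_ble0.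
pose U := fix U n := if n is n'.+1 then rcons (U n') (F (U n')) else [::].
pose y n := F (U n).
have sizeU n : size (U n) = n by elim: n => // n IH; rewrite /= size_rcons IH.
pose before n := \sum_(i < n) modulus (y i).
have sumU n : \sum_(v <- U n) modulus v = before n.
  elim: n => [|n IH]; first by rewrite /before big_nil big_ord0.
  by rewrite /= -cats1 big_cat /= IH big_seq1 /before big_ord_recr.
have Yy n : Y (y n) by have [] := HF (U n).
have y1 n : `|y n| = 1 by have [] := HF (U n).
have y_before n : `|modulus (y n) /\b (t n *: before n)| < s n.
  by have [_ _] := HF (U n); rewrite sizeU sumU.
pose w n := s n *: modulus (y n).
have w0 n : 0 <=b w n by rewrite bleZ0 // ltW.
have w_norm n : `|w n| <= 8^-1 * 2^-1 ^+ n.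
  by rewrite normrZ norm_modulus y1 mulr1 ger0_norm ?(ltW (s0 n)) // sE.
have [W [WC W_tail]] := geometric_series w_norm.
have W_ge N : \sum_(n < N) w n <=b W.
  apply: (@cvg_bge_cst _ _ (fun k => \sum_(n < N + k) w n)); first exact: cvg_addn WC.
  by move=> k; apply: sum_ord_mono => //; exact: leq_addr.
pose v i := W - \sum_(n < i.+1) w n.
have v0 i : 0 <=b v i by rewrite /v -ble_sub.
have v_norm i : `|v i| <= s i.
  by apply: le_trans (W_tail _) _; rewrite sE exprS; lra.
have wv i n : (i < n)%N -> w n <=b v i.
  move=> i_n; rewrite /v bleDl opprK; apply: ble_tr (W_ge n.+1).
  by rewrite [X in _ <=b X]big_ord_recr /= addrC bleD // sum_ord_mono.
have before0 n : 0 <=b before n by exact: sum_ble0.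
pose u i := t i *: before i + v i.
have tb0 i : 0 <=b t i *: before i by rewrite bleZ0 // ltW.
have u0 i : 0 <=b u i by rewrite bleD0.
pose x i := shrink (y i) (u i).
have xy i : `|y i - x i| <= 2 * s i.
  apply: (@le_trans _ _ `|modulus (y i) /\b (t i *: before i) + v i|).
    apply: norm_le_modulus; apply: ble_tr (shrink_dist _ (u0 i)) _.
    rewrite bmeetC; apply: ble_tr (bmeet_addl _ _ _) _ => //.
    by rewrite [(t i *: _) /\b _]bmeetC bleD // bmeetl.
  apply: le_trans (ler_normD _ _) _; have := y_before i; have := v_norm i; lra.
have s_le i : s i <= 8^-1.
  by rewrite sE ler_piMr // exprn_ile1 // ?invr_ge0 // invf_le1 // ler1n.
have x_norm i : 1 - 2 * s i <= `|x i| <= 1 + 2 * s i.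
  have := xy i; have := lerB_dist (y i) (x i); have := lerB_dist (x i) (y i).
  by rewrite [`|x i - y i|]distrC y1 => *; apply/andP; split; lra.
have nx0 i : 0 < `|x i|.
  by have /andP[+ _] := x_norm i; have := s_le i; lra.
have x_disj i n : (i < n)%N -> modulus (x i) /\b modulus (x n) = 0.
  move=> i_n.
  have xn : modulus (x n) <=b pos (modulus (y n) - t n *: modulus (y i)).
    apply: ble_tr (shrink_modulus _ (u0 n)) _; apply: pos_mono.
    rewrite ![modulus (y n) - _]addrC bleD2r bleN /u.
    apply: (@ble_tr _ _ (t n *: before n)); last exact: ble_addl.
    apply: bleZ; first exact: ltW.
    by rewrite /before (bigD1 (Ordinal i_n)) //= ble_addl // sum_ble0.
  have xi : modulus (x i) <=b s n *: pos (t n *: modulus (y i) - modulus (y n)).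
    apply: ble_tr (shrink_modulus _ (u0 i)) _.
    rewrite -posZ ?(ltW (s0 n)) // scalerBr scalerA [s n * _]mulrC ts scale1r.
    apply: pos_mono; rewrite ![modulus (y i) - _]addrC bleD2r bleN /u addrC.
    by apply: (@ble_tr _ _ (v i)); [exact: wv|exact: ble_addl].
  apply: (@disj_le _ _ _ _ _ _ _ _ xi xn) => //.
  rewrite -[X in _ /\b X]scale1r disj_scale ?(ltW (s0 n)) //.
  by rewrite -[modulus (y n) - _]opprB pos_disjoint.
exists y, (fun n => `|x n|^-1 *: x n); split=> // [n|m n mn|n].
- by rewrite normrZ normfV normr_id mulVf ?gt_eqF.
- rewrite /lattice_disjoint !modulusZ disj_scale //.
  have : m != n by exact/eqP.
  by rewrite neq_ltn => /orP[/x_disj|/x_disj] //; rewrite bmeetC.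
- have -> : `|x n|^-1 *: x n - y n = (`|x n|^-1 *: x n - x n) - (y n - x n) by vlin.
  apply: le_trans (ler_normB _ _) _.
  have -> : `| `|x n|^-1 *: x n - x n| = `|1 - `|x n| |.
    rewrite -[X in _ - X]scale1r -scalerBl normrZ -[X in _ * X]normr_id -normrM.
    by rewrite mulrBl mulVf ?gt_eqF // mul1r.
  have : `|1 - `|x n| | <= 2 * s n.
    by have /andP[? ?] := x_norm n; rewrite ler_norml; apply/andP; split; lra.
  have : 0 <= 2^-1 ^+ n :> R by rewrite exprn_ge0 // invr_ge0.
  by have := xy n; rewrite sE; lra.
Qed.

End AlmostDisjoint.

(** * Functionals biorthogonal to a disjoint sequence *)

Section LpFunctionals.
Context {R : realType} {X : banachLatticeType R}.
Variables (p : R) (M : R).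
Hypothesis p_gt1 : 1 < p.
Hypothesis M_ge1 : 1 <= M.
Hypothesis M_convex : forall (n : nat) (x : 'I_n -> X) (z : X), is_lp_mean p x z ->
  `|z| <= M * (\sum_(i < n) `|x i| `^ p) `^ p^-1.
Hypothesis oc : @order_continuous_norm R X.

Let p_gt0 : 0 < p. Proof. exact: lt_trans p_gt1. Qed.
Let p_neq0 : p != 0. Proof. by rewrite gt_eqF. Qed.

(** The p-th powers of a disjoint l_p-sequence span a copy of l_1 in the
    p-concavification, so one functional [phi] is bounded below on all of them;
    restricting [phi] to the bands of the [x_n] gives the coordinates. *)
Theorem disjoint_lp_functionals (x : nat -> X) (c : R) : 0 < c ->
  (forall n, `|x n| = 1) -> (forall m n, m <> n -> lattice_disjoint (x m) (x n)) ->
  (forall N (a : nat -> R),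
    c * (\sum_(n < N) `|a n| `^ p) `^ p^-1 <= `|\sum_(n < N) a n *: x n|) ->
  exists (psi : nat -> X -> R) (B : R), [/\ 0 < B, forall n, lin (psi n),
    forall n m, psi n (x m) = (n == m)%:R
    & forall N v, \sum_(n < N) `|psi n v| `^ p <= (B * `|v|) `^ p].
Proof.
move=> c0 x1 x_disj xc; pose s n : R := 2^-1 ^+ n; pose t n : R := 2 ^+ n.
have t0 n : 0 < t n by rewrite exprn_gt0.
have s0 n : 0 < s n by rewrite exprn_gt0 // invr_gt0.
have ts n : t n * s n = 1 by rewrite /t /s -exprMn mulfV ?pnatr_eq0 // expr1n.
pose m n := modulus (x n); pose d n := s n *: m n.
have m0 n : 0 <=b m n := modulus_ge0 _.
have d0 n : 0 <=b d n by rewrite bleZ0 // ltW.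
have dd i j : i <> j -> d i /\b d j = 0.
  by move=> ij; rewrite disj_scale ?(ltW (s0 _)) //; exact: x_disj.
have td n : t n *: d n = m n by rewrite scalerA ts scale1r.
have d_norm n : `|d n| <= 1 * 2^-1 ^+ n.
  by rewrite normrZ norm_modulus x1 mulr1 mul1r ger0_norm // ltW.
have [e [eC _]] := geometric_series d_norm.
have e_ge N : \sum_(n < N) d n <=b e.
  apply: (@cvg_bge_cst _ _ (fun k => \sum_(n < N + k) d n)); first exact: cvg_addn eC.
  by move=> k; apply: sum_ord_mono => //; exact: leq_addr.
have e0 : 0 <=b e by have := e_ge 0%N; rewrite big_ord0.
have ed n : component e (d n).
  have dN : (fun k => d n /\b (\sum_(i < n.+1 + k) d i - d n)) @ \oo --> d n /\b (e - d n).
    by apply: cvg_bmeet; apply: cvgB; [exact: cvg_addn eC|exact: cvg_cst].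
  apply: cvg_unique dN _ => //.
  rewrite (_ : (fun _ => _) = fun=> 0); first exact: cvg_cst.
  apply/funext => k; have nk : (n < n.+1 + k)%N by rewrite addSn ltnS leq_addr.
  rewrite (bigD1 (Ordinal nk)) //= addrC addrK bmeetC.
  apply: disj_suml => // i ne; apply: dd => in_; case/eqP: ne; exact: val_inj.
have cp0 : 0 < c `^ p by rewrite powR_gt0.
have [c1 [L [c10 L0 H]]] := power_functional_exists p_gt1 M_ge1 M_convex oc e0 cp0.
pose T n := t n `^ p *: d n.
(* Repeated members of [K] are collected: [Lam n] is the total weight of [T n]. *)
have [|phi phiP phiT] := H [set u | exists n, u = T n].
  move=> J lam u lam0 /choice[f fE].
  pose N := (\max_j f j).+1.
  have fN j : (f j < N)%N by rewrite ltnS leq_bigmax.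
  pose Lam (n : nat) := \sum_(j | f j == n) lam j.
  have Lam0 n : 0 <= Lam n by exact: sumr_ge0.
  have sum_f (V : nmodType) (G : J -> V) : \sum_j G j = \sum_(n < N) \sum_(j | f j == n) G j.
    by rewrite (partition_big (fun j => Ordinal (fN j)) xpredT).
  pose a n := Lam n `^ p^-1.
  have a0 n : 0 <= a n := powR_ge0 _ _.
  exists (\sum_(n < N) a n *: m n).
    have -> : \sum_j lam j *: u j = \sum_(n < N) Lam n *: T n.
      rewrite sum_f; apply: eq_bigr => n _; rewrite scaler_suml.
      by apply: eq_bigr => j /eqP fj; rewrite fE fj.
    apply: step_power_sum_disj => // [|n].
      split=> [n|i j ij]; first by rewrite bleZ0.
      by rewrite disj_scale //; apply: x_disj => /val_inj.
    rewrite -td scalerA /T scalerA -[Lam n](powRVK p_neq0) // -powRM ?(ltW (t0 _)) ?powR_ge0 //.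
    by apply: step_power_component; rewrite ?mulr_ge0 ?(ltW (t0 _)) //; exact: a0.
  have -> : \sum_j lam j = \sum_(n < N) `|a n| `^ p.
    rewrite sum_f; apply: eq_bigr => n _.
    by rewrite ger0_norm // /a powRVK.
  have xm : `|\sum_(n < N) a n *: x n| <= `|\sum_(n < N) a n *: m n|.
    apply: norm_le_modulus.
    have : forall k, modulus (\sum_(n < k) a n *: x n) <=b \sum_(n < k) a n *: m n.
      elim=> [|k IH]; first by rewrite !big_ord0 modulus_id.
      rewrite !big_ord_recr /=; apply: ble_tr (modulusD _ _) _; apply: bleD => //.
      by rewrite modulusZ ger0_norm.
    exact.
  have := le_trans (xc N a) xm; set S := \sum_(n < N) _ => Sm.
  have S0 : 0 <= S by apply: sumr_ge0 => i _; exact: powR_ge0.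
  have cS : 0 <= c * S `^ p^-1 by rewrite mulr_ge0 ?powR_ge0 // ltW.
  have := powR_le (ltW p_gt0) cS Sm.
  by rewrite powRM ?powR_ge0 ?(ltW c0) // powRVK.
have [phil phi0 _ _] := phiP.
have mono := lin_mono phil phi0.
have T_ge n : c1 <= t n `^ p * phi (d n) by rewrite -linZ //; apply: phiT; exists n.
have w0 n : 0 < phi (d n).
  by have := lt_le_trans c10 (T_ge n); rewrite pmulr_rgt0 // powR_gt0.
have phim n : phi (m n) = t n * phi (d n) by rewrite -td linZ.
have pm0 n : 0 < phi (m n) by rewrite phim mulr_gt0.
pose dp n := s n *: pos (x n); pose dn n := s n *: pos (- x n).
have dp0 n : 0 <=b dp n by rewrite bleZ0 // ltW.
have dn0 n : 0 <=b dn n by rewrite bleZ0 // ltW.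
have d_split n : d n = dp n + dn n by rewrite /d /m modulusE scalerDr.
have dpn n : dp n /\b dn n = 0 by rewrite disj_scale ?pos_disjoint ?(ltW (s0 n)).
have dpl n := band_form_lin phil phi0 (dp0 n).
have dnl n := band_form_lin phil phi0 (dn0 n).
pose psi n v := (band_form phi (dp n) v - band_form phi (dn n) v) / phi (m n).
have psil n : lin (psi n).
  by move=> k u v; rewrite /psi (dpl n k u v) (dnl n k u v); ring.
have psi_le n v : `|psi n v| <= band_form phi (d n) (modulus v) / phi (m n).
  rewrite /psi normrM (ger0_norm (_ : 0 <= (phi (m n))^-1)) ?invr_ge0 ?(ltW (pm0 n)) //.
  rewrite ler_wpM2r ?invr_ge0 ?(ltW (pm0 n)) // d_split band_form_add //.
  apply: le_trans (ler_normB _ _) _; apply: lerD.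
    by apply: lin_modulus (dpl n) _ _ => u; exact: band_form_ge0.
  by apply: lin_modulus (dnl n) _ _ => u; exact: band_form_ge0.
exists psi, (c1^-1 `^ p^-1); split=> //.
- by rewrite powR_gt0 // invr_gt0.
- move=> n k; have [<-|nk] := eqVneq n k.
    have selfZ g h : 0 <=b h -> g = s n *: h -> band_form phi g h = phi h.
      move=> h0 gE; have g0 : 0 <=b g by rewrite gE bleZ0 // ltW.
      have hE : h = t n *: g by rewrite gE scalerA ts scale1r.
      rewrite hE linZ ?band_form_self // ?linZ //; exact: band_form_lin.
    have off g h : 0 <=b h -> 0 <=b g -> h /\b g = 0 -> band_form phi g h = 0.
      by move=> h0 g0 hg; exact: band_form_disj.
    have split f : lin f -> f (x n) = f (pos (x n)) - f (pos (- x n)).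
      by move=> fl; rewrite -linB // -pos_sub.
    rewrite /psi (split _ (dpl n)) (split _ (dnl n)).
    rewrite (selfZ (dp n) (pos (x n))) // (selfZ (dn n) (pos (- x n))) //.
    rewrite (off (dp n) (pos (- x n))) //; last first.
      by rewrite -[pos (- _)]scale1r disj_scale ?(ltW (s0 n)) // bmeetC pos_disjoint.
    rewrite (off (dn n) (pos (x n))) //; last first.
      by rewrite -[pos (x n)]scale1r disj_scale ?(ltW (s0 n)) // pos_disjoint.
    rewrite subr0 sub0r opprK -linD // -modulusE -/(m n) mulfV ?gt_eqF //.
  apply/eqP; rewrite -normr_le0; apply: le_trans (psi_le _ _) _.
  rewrite band_form_disj // ?mul0r //.
  rewrite -[modulus _]scale1r disj_scale ?(ltW (s0 n)) //.
  by apply: x_disj => kn; rewrite kn eqxx in nk.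
- move=> N v; pose a n := band_form phi (d n) (modulus v).
  have a0 n : 0 <= a n by exact: band_form_ge0.
  have term n : `|psi n v| `^ p <= c1^-1 * (a n `^ p * phi (d n) `^ (1 - p)).
    apply: (@le_trans _ _ ((a n / phi (m n)) `^ p)).
      by apply: powR_le => //; exact: ltW.
    have tp0 : 0 < t n `^ p by rewrite powR_gt0.
    have wN0 : phi (d n) != 0 by rewrite gt_eqF.
    have wp0 : 0 < phi (d n) `^ p by rewrite powR_gt0.
    rewrite powRM ?invr_ge0 ?(ltW (pm0 n)) // mulrCA ler_wpM2l ?powR_ge0 //.
    rewrite -powR_inv1 ?(ltW (pm0 n)) // -powRrM mulN1r phim powRN.
    rewrite powRM ?(ltW (t0 n)) ?(ltW (w0 n)) // powRB ?wN0 ?implybT //.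
    rewrite powRr1 ?(ltW (w0 n)) // invfM mulrA ler_wpM2r ?invr_ge0 ?powR_ge0 //.
    rewrite ler_pdivlMl // mulrC ler_pdivrMl //; exact: T_ge.
  apply: (@le_trans _ _ (\sum_(n < N) c1^-1 * (a n `^ p * phi (d n) `^ (1 - p)))).
    exact: ler_sum.
  have B0 : 0 <= c1^-1 by rewrite invr_ge0 ltW.
  rewrite -mulr_sumr powRM ?powR_ge0 // powRVK // ler_wpM2l //.
  rewrite -[`|v|]norm_modulus.
  apply: (conditional_expectation_bound p_gt1 oc e0 phiP (d := fun n : 'I_N => d n)) => //.
  by split=> // i j ij; apply: dd => /val_inj.
Qed.

End LpFunctionals.

(** * The dichotomy *)

Section Dichotomy.
Context {R : realType} {X : banachLatticeType R}.
Variables (p : R) (M : R).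
Hypothesis p_ge2 : 2 <= p.
Hypothesis M_ge1 : 1 <= M.
Hypothesis M_convex : forall (n : nat) (x : 'I_n -> X) (z : X), is_lp_mean p x z ->
  `|z| <= M * (\sum_(i < n) `|x i| `^ p) `^ p^-1.
Hypothesis X_dh : disjointly_homogeneous X p.
Variable Y : set X.
Hypothesis Y_inf : subspace_inf Y.

Let p_gt1 : 1 < p. Proof. by apply: lt_le_trans p_ge2; rewrite ltr1n. Qed.
Let p_gt0 : 0 < p. Proof. exact: lt_trans p_gt1. Qed.
Let oc : @order_continuous_norm R X. Proof. exact: increasing_cvg p_gt0 X_dh. Qed.

(** The Hilbertian form of a uniformly positive functional is equivalent to the norm
    on [Y]. *)
Lemma strongly_embedded_case e (eps : R) : 0 <=b e -> 0 < eps ->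
  (forall y, Y y -> `|y| = 1 -> eps <= `|modulus y /\b e|) ->
  exists Z : set X, [/\ Z `<=` Y, subspace_inf Z, complemented Z & isomorphic_lp Z 2].
Proof.
move=> e0 eps0 far; have eps2 : 0 < eps / 2 by rewrite divr_gt0.
have [L [delta [phi [delta0 phiP large]]]] :=
  uniform_functional p_gt1 M_ge1 M_convex oc e0 eps2.
have [phil phi0 _ _] := phiP.
have form_lin := hilbert_form_lin p_ge2 oc e0 phiP.
have formC := hilbert_formC p_ge2 oc e0 phiP.
have E0 : 0 < 2 * (`|e| + 1) by rewrite mulr_gt0 // ltr_wpDl.
pose kappa := (eps / (2 * (`|e| + 1))) ^+ 2 * delta.
have kappa0 : 0 < kappa by rewrite /kappa mulr_gt0 // exprn_gt0 // divr_gt0.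
apply: (hilbert_subspace (b := hilbert_form e phi) (C := phi e + 1) (kappa := kappa)) => //.
- by move=> x; exact: (hilbert_form_ge0 p_ge2 oc e0 phiP x).
- by rewrite addr_ge0 // phi0.
- by move=> x; exact: (hilbert_form_bound p_ge2 oc e0 phiP x).
move=> y Yy; have [->|yN0] := eqVneq y 0.
  by rewrite normr0 expr0n mulr0 (hilbert_form_ge0 p_ge2 oc e0 phiP).
have ny0 : 0 < `|y| by rewrite normr_gt0.
have [[Y0 Ylin] _ _] := Y_inf.
have Yu : Y (`|y|^-1 *: y).
  by rewrite -[_ *: _]addr0; apply: set_mem; apply: Ylin => //; exact: mem_set.
have u1 : `| `|y|^-1 *: y| = 1 by rewrite normrZ normfV normr_id mulVf ?gt_eqF.
have := hilbert_form_lower p_ge2 oc e0 phiP eps0 delta0 large (far _ Yu u1).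
rewrite -/kappa (linZ _ _ (form_lin _)) formC (linZ _ _ (form_lin _)) mulrA -expr2.
by rewrite exprVn ler_pdivlMl ?exprn_gt0 // mulrC.
Qed.

(** The constant [B] of the functionals is known only after the subsequence has been
    chosen; dropping its first [K] terms then makes the perturbation small
    relative to [B]. *)
Lemma almost_disjoint_case :
  (forall e (eps : R), 0 <=b e -> 0 < eps ->
     exists y, [/\ Y y, `|y| = 1 & `|modulus y /\b e| < eps]) ->
  exists Z : set X, [/\ Z `<=` Y, subspace_inf Z, complemented Z & isomorphic_lp Z p].
Proof.
move=> /almost_disjoint_sequence[y [x [Yy x1 x_disj xy]]].
have [phi phi_inc [c [C [c0 cC]]]] := X_dh x1 x_disj.
have phi_inj : injective phi := increasing_seq_injective phi_inc.
have phi_ge n : (n <= phi n)%N.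
  elim: n => // n IH; apply: leq_ltn_trans IH _.
  by rewrite ltnNge; have := phi_inc n.+1 n; rewrite ltnn leEnat => ->.
have equiv N (a : nat -> R) :
    c * (\sum_(n < N) `|a n| `^ p) `^ p^-1 <= `|\sum_(n < N) a n *: x (phi n)|
    <= C * (\sum_(n < N) `|a n| `^ p) `^ p^-1.
  exact: cC N (fun n : 'I_N => a n).
have [||N a|psi [B [B0 psil psix psiB]]] :=
  disjoint_lp_functionals p_gt1 M_ge1 M_convex oc (x := x \o phi) c0.
- by move=> n /=; exact: x1.
- by move=> m n mn /=; apply: x_disj => /phi_inj.
- by have /andP[] := equiv N a.
have four : 0 < 4^-1 :> R by rewrite invr_gt0.
have [K HK] := geo_small (divr_gt0 four B0).
have p_ge1 : 1 <= p by exact: ltW.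
have [Ysub Ycl _] := Y_inf.
apply: (@perturbed_copy _ _ p p_ge1 Y (fun n => x (phi (K + n)%N))
  (fun n => y (phi (K + n)%N)) (fun n => psi (K + n)%N) `|C| B (2^-1 ^+ K)) => //.
- by move=> n m; rewrite psix eqn_add2l.
- move=> N v; apply: le_trans (psiB (K + N)%N v).
  rewrite big_split_ord /= lerDr; apply: sumr_ge0 => i _; exact: powR_ge0.
- move=> N a; pose b n := if (n < K)%N then 0 else a (n - K)%N.
  have /andP[_] := equiv (K + N)%N b.
  rewrite !big_split_ord /= [X in `|X + _|]big1 => [|i _]; last first.
    by rewrite /b ltn_ord scale0r.
  rewrite [X in (X + _) `^ _]big1 => [|i _]; last by rewrite /b ltn_ord normr0 powR0 // gt_eqF.
  have bE n : b (K + n)%N = a n by rewrite /b ltnNge leq_addr addKn.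
  rewrite !add0r.
  have -> : \sum_(i < N) b (K + i)%N *: x (phi (K + i)%N) =
      \sum_(i < N) a i *: x (phi (K + i)%N) by apply: eq_bigr => i _; rewrite bE.
  have -> : \sum_(i < N) `|b (K + i)%N| `^ p = \sum_(i < N) `|a i| `^ p.
    by apply: eq_bigr => i _; rewrite bE.
  by move/le_trans; apply; rewrite ler_wpM2r ?powR_ge0 // ler_norm.
- by rewrite mulrC -ler_pdivlMr // ltW.
- move=> n; apply: le_trans (xy _) _; rewrite -exprD.
  by apply: ler_wiXn2l => //; rewrite ?invr_ge0 // invf_le1 // ler1n.
Qed.

Theorem complemented_copy : exists Z : set X,
  [/\ Z `<=` Y, subspace_inf Z, complemented Z & isomorphic_lp Z p \/ isomorphic_lp Z 2].
Proof.
have [small|not_small] := pselect (forall e (eps : R), 0 <=b e -> 0 < eps ->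
    exists y, [/\ Y y, `|y| = 1 & `|modulus y /\b e| < eps]).
  by have [Z [? ? ? ?]] := almost_disjoint_case small; exists Z; split=> //; left.
have [e [eps [e0 eps0 far]]] : exists e (eps : R), [/\ 0 <=b e, 0 < eps &
    forall y, Y y -> `|y| = 1 -> eps <= `|modulus y /\b e|].
  apply: contrapT => no; apply: not_small => e eps e0 eps0.
  apply: contrapT => none; apply: no; exists e, eps; split=> // y Yy y1.
  by rewrite leNgt; apply/negP => lt; apply: none; exists y.
by have [Z [? ? ? ?]] := strongly_embedded_case e0 eps0 far; exists Z; split=> //; right.
Qed.

End Dichotomy.

Unset Implicit Arguments.
Set Strict Implicit.

Theorem proposition6p2 (R : realType) (p : R) (X : banachLatticeType R)
    (p_ge2 : 2 <= p)
    (X_inf : infinite_dimensional [set: X])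
    (X_convex : p_convex X p)
    (X_dh : disjointly_homogeneous X p) :
  (forall Y : set X, subspace_inf Y ->
     exists Z : set X,
       [/\ Z `<=` Y, subspace_inf Z, complemented Z
         & isomorphic_lp Z p \/ isomorphic_lp Z 2])
  /\ subprojective X.
Proof.
have [M HM] := X_convex; pose M' := Num.max M 1.
have M'_ge1 : 1 <= M' by rewrite le_max lexx orbT.
have M'_convex (n : nat) (x : 'I_n -> X) (z : X) : is_lp_mean p x z ->
    `|z| <= M' * (\sum_(i < n) `|x i| `^ p) `^ p^-1.
  move=> /HM/le_trans; apply; rewrite ler_wpM2r ?powR_ge0 //.
  by rewrite le_max lexx.
have copies (Y : set X) (Y_inf : subspace_inf Y) :=
  complemented_copy p_ge2 M'_ge1 M'_convex X_dh Y_inf.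
split=> // Y /copies[Z [ZY Z_inf Z_compl _]].
by exists Z.
Qed.
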